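(* Let $0<b\le\infty$, let $\chi$ be a locally finite signed Borel measure on $[0,b)$, and let $m(z)$ be the Weyl function of the self-adjoint operator $S$ in $L^2(0,b)$ associated with $\tau f=\left(-f'+\int f\,d\chi\right)'$, with Dirichlet boundary condition at $0$ and, if $\tau$ is in the limit-circle case at $b$, a fixed boundary condition at $b$ (all as defined in the context). Then for every $x_0\in(0,b)$ the Weyl function has the asymptotic behavior $$m(z) = -\sqrt{-z} - \int_{[0,x_0)} e^{-2\sqrt{-z}\,y}\, d\chi(y) + o(z^{-1/2})$$ as $\operatorname{Im}(z)\to\infty$. Moreover, the error satisfies an estimate of the type $|o(z^{-1/2})|\le C|z|^{-1/2}$, where the constant $C$ depends only on the total variation $|\chi|([0,x_0))$.
   Context: Setting. $\chi$ is a signed (real-valued) Borel measure on $[0,b)$ with $|\chi|([0,x))<\infty$ for every $x\in(0,b)$, where $|\chi|$ denotes the total variation measure; point masses, also at $0$, are allowed. The differential expression is $\tau f=\left(-f'+\int f\,d\chi\right)'$, meaning $\tau f(x)=\frac{d}{dx}\left(-f'(x)+\int_{[0,x)}f\,d\chi\right)$. Its maximal domain $\mathfrak D_\tau$ consists of all $f\in AC_{\mathrm{loc}}[0,b)$ such that $x\mapsto -f'(x)+\int_{[0,x)} f\,d\chi$ is (after choosing the representative of $f'$) in $AC_{\mathrm{loc}}[0,b)$. Thus $f'$ satisfies the jump condition $f'(x+)-f'(x-)=\chi(\{x\})f(x)$; $f'$ is always taken left continuous, and at $x=0$ the jump condition defines the left limit $f'(0)=f'(0-):=f'(0+)-\chi(\{0\})f(0)$.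 A solution of $\tau u=zu$ is a $u\in\mathfrak D_\tau$ satisfying this equation almost everywhere. A prime denotes the derivative in $x$; $^*$ denotes complex conjugation. Wronskian: $W_x(f,g)=f(x)g'(x)-f'(x)g(x)$, with $W_b$ the limit as $x\nearrow b$. Operator: $\operatorname{dom}(T_{\max})=\{f\in\mathfrak D_\tau : f,\tau f\in L^2(0,b)\}$. $\tau$ is in the limit-circle case at $b$ if all solutions of $\tau u=zu$ are square integrable near $b$, and in the limit-point case at $b$ otherwise. $S$ is the restriction of $f\mapsto\tau f$ to $\{f\in\operatorname{dom}(T_{\max}): f(0)=0\}$ in the limit-point case, and to $\{f\in\operatorname{dom}(T_{\max}): f(0)=0,\ W_b(f,w^* )=0\}$ in the limit-circle case, where $w\in\operatorname{dom}(T_{\max})$ is fixed with $W_b(w,w^* )=0$ and $W_b(h,w^* )\ne0$ for some $h\in\operatorname{dom}(T_{\max})$. $S$ is self-adjoint. Weyl function: $c(z,x),s(z,x)$ are the solutions of $\tau u=zu$ with $c(z,0)=1$, $c'(z,0)=0$, $s(z,0)=0$, $s'(z,0)=1$. For $z\in\mathbb C\setminus\mathbb R$, $m(z)$ is the number such that $u(z,x)=c(z,x)+m(z)s(z,x)$ is square integrable near $b$ and satisfies the boundary condition of $S$ at $b$ (if there is one), i.e. $W_b(u(z,\cdot),w^* )=0$ in the limit-circle case. $\sqrt{\cdot}$ is the standard branch of the square root with branch cut along $(-\infty,0)$. The notation $o(z^{-1/2})$ means a term whose modulus divided by $|z|^{-1/2}$ tends to $0$.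
   Formalization: The limit Im(z)→∞ and the error bound (for large Im z) are taken in sectors Re z ≤ K·Im z, for every K; with unrestricted Re z the claim fails, e.g. χ=0, b=1, Dirichlet at b, where m+√(-z) = -2k/(e^{2k}-1), k=√(-z), and Re k→0 is possible. *)

(* Defs.v *)
From HB Require Import structures.
From mathcomp Require Import all_boot all_order all_algebra.
From mathcomp Require Import all_classical all_reals all_analysis.
From mathcomp Require Import complex.

Set Implicit Arguments.
Unset Strict Implicit.
Unset Printing Implicit Defensive.

Import Order.TTheory GRing.Theory Num.Theory.
Import numFieldNormedType.Exports.

Local Open Scope classical_set_scope.
Local Open Scope ring_scope.
Local Open Scope complex_scope.

(* A signed Borel measure on [0, b[ that is finite on every [0, x[ with x < b;
   its value on the whole of [0, b[ may be undefined, so only Borel sets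
   contained in some [0, x[ with x < b are constrained.  Since the values are
   real numbers, the total variation of each [0, x[ is automatically finite. *)
Record signed_measure (R : realType) (b : \bar R) := SignedMeasure {
  sm_val :> set R -> R ;
  sm_set0 : sm_val set0 = 0 ;
  sm_sigma_additive : forall x : R, 0 < x -> (x%:E < b)%E ->
    forall F : (set (measurableTypeR R))^nat,
      (forall i, measurable (F i)) -> trivIset setT F ->
      (forall i, F i `<=` `[0, x[) ->
      (fun n => \sum_(0 <= i < n) sm_val (F i)) @ \oo
        --> sm_val (\bigcup_i F i) }.

(* The restriction of chi to [0, x[, as a finite charge on the line; it is set
   to zero when x is not in ]0, b[. *)
Definition sm_restr (R : realType) (b : \bar R) (chi : signed_measure b) (x : R)
    (A : set (measurableTypeR R)) : \bar R :=
  if (0 < x) && (x%:E < b)%E then (chi (A `&` `[0, x[))%:E else 0%E.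

Section SmRestrCharge.
Context (R : realType) (b : \bar R) (chi : signed_measure b) (x : R).

Let restr0 : sm_restr chi x set0 = 0%E.
Proof. by rewrite /sm_restr set0I sm_set0; case: ifP. Qed.

Let restr_fin A : measurable A -> sm_restr chi x A \is a fin_num.
Proof. by rewrite /sm_restr; case: ifP. Qed.

Let restr_sigma_additive : semi_sigma_additive (sm_restr chi x).
Proof.
move=> F mF tF mUF; rewrite /sm_restr; case: ifP => [/andP[x0 xb]|_]; last first.
  have -> : (fun n => \sum_(0 <= i < n) (0 : \bar R))%E = cst 0%E.
    by apply/funext => n; rewrite big1.
  exact: cvg_cst.
rewrite setI_bigcupl; under eq_fun do rewrite sumEFin.
apply/fine_cvgP; split; first exact: nearW.
apply: (@sm_sigma_additive _ _ chi x) => //.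
- by move=> i; apply: measurableI => //; exact: measurable_itv.
- exact: trivIset_setIr.
Qed.

HB.instance Definition _ := isCharge.Build _ (measurableTypeR R) R
  (sm_restr chi x) restr0 restr_fin restr_sigma_additive.

End SmRestrCharge.

Section SignedIntegral.
Context (R : realType) (b : \bar R) (chi : signed_measure b).

Lemma sm_hahn_ex (x : R) :
  exists PN, hahn_decomposition (sm_restr chi x) PN.1 PN.2.
Proof. by have [P [N PN]] := Hahn_decomposition (sm_restr chi x); exists (P, N). Qed.

Definition sm_hahn (x : R) := svalP (cid (sm_hahn_ex x)).

(* |chi|([0, x[), for x in ]0, b[ *)
Definition sm_variation (x : R) : R :=
  fine (charge_variation (sm_hahn x) `[0, x[).

(* integral of f over [0, x[ with respect to chi, for x in [0, b[ *)
Definition sm_integral (x : R) (f : R -> R) : R :=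
  (\int[jordan_pos (sm_hahn x)]_(y in `[0%R, x[) f y
   - \int[jordan_neg (sm_hahn x)]_(y in `[0%R, x[) f y)%R.

Definition sm_cintegral (x : R) (f : R -> R[i]) : R[i] :=
  sm_integral x (fun y => complex.Re (f y))
    +i* sm_integral x (fun y => complex.Im (f y)).

End SignedIntegral.

Section ComplexValuedFunctions.
Context (R : realType).
Implicit Types (f : R -> R[i]) (b : \bar R).

Definition cabs (z : R[i]) : R := Normc.normc z.

Definition cexp (z : R[i]) : R[i] :=
  expR (complex.Re z) * cos (complex.Im z)
    +i* (expR (complex.Re z) * sin (complex.Im z)).

Definition is_cderive f (x : R) (l : R[i]) : Prop :=
  is_derive x 1 (fun y => complex.Re (f y)) (complex.Re l) /\
  is_derive x 1 (fun y => complex.Im (f y)) (complex.Im l).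

Definition abs_continuous (a c : R) f : Prop :=
  forall e : R, 0 < e -> exists2 d : R, 0 < d &
    forall (n : nat) (s t : 'I_n -> R),
      (forall i, [/\ a <= s i, s i <= t i & t i <= c]) ->
      (forall i j, i != j -> t i <= s j \/ t j <= s i) ->
      \sum_(i < n) (t i - s i) < d ->
      \sum_(i < n) cabs (f (t i) - f (s i)) < e.

(* AC_loc [0, b[ *)
Definition AC_loc b f : Prop :=
  forall x : R, 0 < x -> (x%:E < b)%E -> abs_continuous 0 x f.

Definition right_of (c : R) b : set R := [set x | c < x /\ (x%:E < b)%E].

(* f is in L^2(c, b) *)
Definition L2 (c : R) b f : Prop :=
  [/\ measurable_fun (right_of c b : set (measurableTypeR R))
        (fun x => complex.Re (f x)),
      measurable_fun (right_of c b : set (measurableTypeR R))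
        (fun x => complex.Im (f x)) &
      (@lebesgue_measure R).-integrable (right_of c b)
        (fun x => ((cabs (f x)) ^+ 2)%:E)].

Definition L2_near_end b f : Prop :=
  exists c : R, [/\ 0 < c, (c%:E < b)%E & L2 c b f].

(* x tends to b from below, b being finite or +oo *)
Definition at_end b : set_system R :=
  [set A | exists2 c : R, (c%:E < b)%E & right_of c b `<=` A].

End ComplexValuedFunctions.

Section SturmLiouville.
Context (R : realType) (b : \bar R) (chi : signed_measure b).
Implicit Types (f df g dg u du w dw : R -> R[i]).

(* - f' + \int f dchi, df being the derivative of f *)
Definition quasi_derivative f df (x : R) : R[i] := - df x + sm_cintegral chi x f.

(* f is in the maximal domain D_tau and df is its left-continuous derivative.
   The continuity of quasi_derivative f df on [0, b[ makes df, which is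
   prescribed almost everywhere, unique on [0, b[: df is left continuous on
   ]0, b[, its jump at x is chi {x} * f x, and
   df 0 = df (0+) - chi {0} * f 0 since the integral over [0, 0[ vanishes. *)
Definition in_Dtau f df : Prop :=
  [/\ AC_loc b f,
      {ae (@lebesgue_measure R),
        forall x, right_of 0 b x -> is_cderive f x (df x)} &
      AC_loc b (quasi_derivative f df)].

(* tau f = h almost everywhere in ]0, b[ *)
Definition tau_eq f df (h : R -> R[i]) : Prop :=
  {ae (@lebesgue_measure R), forall x, right_of 0 b x ->
    is_cderive (quasi_derivative f df) x (h x)}.

Definition is_solution (z : R[i]) u du : Prop :=
  in_Dtau u du /\ tau_eq u du (fun x => z * u x).

Definition dom_Tmax f df : Prop :=
  [/\ in_Dtau f df, L2 0 b f & exists2 h, L2 0 b h & tau_eq f df h].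

Definition wronskian f df g dg (x : R) : R[i] := f x * dg x - df x * g x.

(* W_b(f, g^* ) = l *)
Definition wronskian_conj_end f df g dg (l : R[i]) : Prop :=
  (fun x => cabs (wronskian f df (conjc \o g) (conjc \o dg) x - l)) @ at_end b
    --> (0 : R).

Definition limit_circle : Prop :=
  forall z u du, is_solution z u du -> L2_near_end b u.

(* admissible functions w for the boundary condition W_b(f, w^* ) = 0 *)
Definition boundary_function w dw : Prop :=
  [/\ dom_Tmax w dw, wronskian_conj_end w dw w dw 0 &
      exists h dh l,
        [/\ dom_Tmax h dh, wronskian_conj_end h dh w dw l & l != 0]].

(* the boundary condition of S at b; there is none in the limit-point case *)
Definition bc_at_end w dw f df : Prop :=
  limit_circle -> wronskian_conj_end f df w dw 0.

Definition weyl_function w dw (m : R[i] -> R[i]) : Prop :=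
  forall z : R[i], complex.Im z != 0 ->
    exists c dc s ds : R -> R[i],
      [/\ [/\ is_solution z c dc, c 0 = 1 & dc 0 = 0],
          [/\ is_solution z s ds, s 0 = 0 & ds 0 = 1],
          L2_near_end b (fun x => c x + m z * s x) &
          bc_at_end w dw (fun x => c x + m z * s x)
                         (fun x => dc x + m z * ds x)].

(* sqrtc is the principal branch of the complex square root *)
Definition weyl_error (m : R[i] -> R[i]) (x0 : R) (z : R[i]) : R[i] :=
  m z - (- sqrtc (- z)
         - sm_cintegral chi x0 (fun y => cexp (- 2%:R * sqrtc (- z) * y%:C))).

End SturmLiouville.

(* Im z tends to +oo inside the sector Re z <= K * Im z of the upper half
   plane.  Some restriction of this kind is needed: for chi = 0, b = 1 and a
   Dirichlet condition at b one has m z = - k * coth k with k = sqrt (- z), and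
   m z + k is not o(1/k) when Re z tends to +oo so fast that Re k tends to 0. *)
Definition im_infty (R : realType) (K : R) : set_system R[i] :=
  [set A | exists Y : R, forall z : R[i],
    Y < complex.Im z -> complex.Re z <= K * complex.Im z -> A z].

(* Main.v *)
Require Import Defs.
From mathcomp Require Import all_boot all_order all_algebra.
From mathcomp Require Import all_classical all_reals all_analysis.
From mathcomp Require Import complex measurable_realfun.
From mathcomp Require Import ring lra.
Import Order.TTheory GRing.Theory Num.Theory.
Import numFieldNormedType.Exports.

(* Integrating the equation turns tau f = h into the system
     f(x) = f(0) + int_0^x f',
     f'(x) = f'(0) + int_[0,x) phi dchi - int_0^x h,
   with phi = f for functions of D_tau and phi = 0 for exponentials.  Fubini
   gives for two such systems the Lagrange identity
     W(f,g)(x) - W(f,g)(0) =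
       int_[0,x) (f psi - g phi) dchi - int_0^x (f k - g h).
   Let u = c + m s be the Weyl solution.  At the end point W(u,u^* ) tends to 0:
   in the limit-circle case by the Pluecker relation with w and h, in the
   limit-point case because s is not square integrable (Weyl's alternative)
   while |W(u^*,s)|^2 = 1 + 4 Im(u' u^* ) Im(s' s^* ).  Hence Im(u' u^* ) is
   nonnegative at x0.  With k = sqrt(-z), comparing u with e^{-kx} gives
     m + k = e^{-k x0}(u'(x0) + k u(x0)) - int_[0,x0) e^{-ky} u dchi,
   and the same identity for e^{kx} yields an a priori bound
   |u(x)| <= 2 (e^{-Kx} + beta e^{Kx}), K = Re k.  Finally
   Im z int_0^x0 |u|^2 <= Im m forces beta to be exponentially small. *)

Set Implicit Arguments.
Unset Strict Implicit.
Unset Printing Implicit Defensive.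
Local Open Scope classical_set_scope.
Local Open Scope ring_scope.
Local Open Scope complex_scope.

(** * Bounded measurable functions *)

(** Beyond x0 the Weyl solution is known only through the sign of its flux; on [0,x0) it may contain
    a growing exponential of unknown amplitude beta, and chi is not small there. Integrals against
    chi enter divided by |k|, however, so 24 |chi|([0,x0)) <= |k| makes the integral equation
    improve bounds by a factor one half in the norm weighted by e^{-Kx} + beta e^{Kx}, uniformly in
    chi and beta. If t = beta e^{K x0} were large, |u| would be comparable with t on an interval of
    length 1/(2K) before x0, so int |u|^2 would be at least of order t^2 / K, whereas Im m is at
    most of order |k| t; hence t <= C |k|^2. What remains is the chi-integral of e^{-ky} (u -
    e^{-ky}), of size e^{-2Ky} / |k| up to terms in beta. A further o(1) is gained because this
    integrand vanishes at y = 0, whatever the atom of chi there, while |chi|(]0,eps[) tends to 0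
    with eps and e^{-2K eps} tends to 0 for fixed eps. This last limit, and the absorption of powers
    of |k| by e^{K x0}, need K >= c |k|, which is what the sector provides. *)

Section BoundedMeasurable.
Context {R : realType}.
Implicit Types (f g : R -> R) (x X : R).
Notation T := (measurableTypeR R).

(** A class closed under products and under x -> int_[0,x) f ([bmeas_integral]), and integrable for
    Lebesgue measure and for every finite measure. It accommodates [df], which may jump. *)
Definition bmeas X f :=
  measurable_fun (`[0, X[%classic : set T) f /\
  exists M, forall x, 0 <= x < X -> `|f x| <= M.

Definition cont X f := {within `[0, X], continuous f}.

Lemma cont_cst X c : cont X (fun=> c).
Proof. by apply: continuous_subspaceT => x; exact: cvg_cst. Qed.

Lemma cont_bounded X f : cont X f ->
  exists M, forall x, 0 <= x <= X -> `|f x| <= M.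
Proof.
move=> cf.
have [M [_ mrt]] := compact_bounded (continuous_compact cf (@segment_compact _ 0 X)).
exists (M + 1) => x x0X; apply: (mrt (M + 1)); first by rewrite ltrDl.
by exists x => //=; rewrite in_itv.
Qed.

Lemma cont_bmeas X f : cont X f -> bmeas X f.
Proof.
move=> cf; split.
  apply: (@measurable_funS _ _ T R (`[0, X]%classic : set T)) => //.
    by move=> x /=; rewrite !in_itv /= => /andP[-> /ltW].
  apply: subspace_continuous_measurable_fun => //.
have [M hM] := cont_bounded cf.
by exists M => x /andP[x0 xX]; apply: hM; rewrite x0 ltW.
Qed.

Lemma bmeasD X f g : bmeas X f -> bmeas X g -> bmeas X (fun x => f x + g x).
Proof.
move=> [mf [M hM]] [mg [N hN]]; split; first exact: measurable_funD.
exists (M + N) => x xX; apply: (le_trans (ler_normD _ _)).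
by apply: lerD; [exact: hM|exact: hN].
Qed.

Lemma bmeasN X f : bmeas X f -> bmeas X (fun x => - f x).
Proof.
move=> [mf [M hM]]; split; first exact: measurableT_comp.
by exists M => x xX; rewrite normrN; exact: hM.
Qed.

Lemma bmeasB X f g : bmeas X f -> bmeas X g -> bmeas X (fun x => f x - g x).
Proof. by move=> bf bg; apply: bmeasD => //; exact: bmeasN. Qed.

Lemma bmeasM X f g : bmeas X f -> bmeas X g -> bmeas X (fun x => f x * g x).
Proof.
move=> [mf [M hM]] [mg [N hN]]; split; first exact: measurable_funM.
exists (M * N) => x xX; rewrite normrM.
by apply: ler_pM => //; [exact: hM|exact: hN].
Qed.

Lemma bmeas_cst X c : bmeas X (fun=> c).
Proof. by apply: cont_bmeas; exact: cont_cst. Qed.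

Lemma bmeasS X Y f : Y <= X -> bmeas X f -> bmeas Y f.
Proof.
move=> YX [mf [M hM]]; split.
  apply: (measurable_funS _ _ mf) => //.
  by move=> x /=; rewrite !in_itv /= => /andP[-> /lt_le_trans]; exact.
by exists M => x /andP[x0 xY]; apply: hM; rewrite x0 (lt_le_trans xY).
Qed.

Lemma bmeas_integrable (nu : {measure set T -> \bar R}) X f :
  (nu `[0%R, X[%classic < +oo)%E -> bmeas X f -> nu.-integrable `[0%R, X[%classic (EFin \o f).
Proof.
move=> nuX [mf [M hM]]; apply: measurable_bounded_integrable => //.
exists M; split; first exact: num_real.
move=> y My x /=; rewrite in_itv /= => xX.
by apply: (le_trans (hM x xX)); exact: ltW.
Qed.

Lemma bmeas_mul_integrable (nu : {measure set T -> \bar R}) X f g :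
  bmeas X f -> nu.-integrable `[0%R, X[%classic (EFin \o g) ->
  nu.-integrable `[0%R, X[%classic (EFin \o (fun x => f x * g x)).
Proof.
move=> [mf [M hM]] ig.
have := @integrableMr _ T R nu `[0%R, X[%classic (measurable_itv _) f (EFin \o g) mf.
apply => //.
exists M; split; first exact: num_real.
move=> y My x /=; rewrite in_itv /= => xX.
by apply: (le_trans (hM x xX)); exact: ltW.
Qed.

End BoundedMeasurable.

Section IntegralBounds.
Context {R : realType}.
Notation T := (measurableTypeR R).
Variable nu : {measure set T -> \bar R}.
Implicit Types (f g : R -> R) (D : set T).

Lemma Rintegral_norm_le D f g : measurable D ->
  nu.-integrable D (EFin \o f) -> nu.-integrable D (EFin \o g) ->
  (forall x, D x -> `|f x| <= g x) ->
  `|\int[nu]_(x in D) f x| <= \int[nu]_(x in D) g x.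
Proof.
move=> mD fi gi fg; apply: (le_trans (le_normr_Rintegral mD fi)).
by apply: le_Rintegral => //; exact: integrable_norm.
Qed.

Lemma Rintegral_norm_cst_le D f M : measurable D -> (nu D < +oo)%E ->
  nu.-integrable D (EFin \o f) ->
  (forall x, D x -> `|f x| <= M) ->
  `|\int[nu]_(x in D) f x| <= M * fine (nu D).
Proof.
move=> mD nuD fi fM; rewrite -Rintegral_cst//.
apply: Rintegral_norm_le => //; apply: measurable_bounded_integrable => //.
exact: bounded_cst.
Qed.

Lemma integrable_itvS (X : R) (D : set T) (f : R -> R) : measurable D ->
  D `<=` `[0%R, X[ ->
  nu.-integrable `[0%R, X[%classic (EFin \o f) -> nu.-integrable D (EFin \o f).
Proof. by move=> mD DX; apply: integrableS => //; exact: measurable_itv. Qed.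

Lemma subset_bcoo (a b X : R) : 0 <= a -> b <= X -> `[a, b[ `<=` `[0, X[.
Proof.
move=> a0 bX x /=; rewrite !in_itv /= => /andP[ax xb].
by rewrite (le_trans a0 ax) (lt_le_trans xb bX).
Qed.

Lemma Rintegral_split (a b : R) f : 0 <= a -> a <= b ->
  nu.-integrable `[0%R, b[%classic (EFin \o f) ->
  \int[nu]_(x in `[0, b[) f x =
  \int[nu]_(x in `[0, a[) f x + \int[nu]_(x in `[a, b[) f x.
Proof.
move=> a0 ab fi.
have E : `[0, b[%classic = `[0, a[%classic `|` `[a, b[%classic :> set R.
  apply/seteqP; split => x /=; rewrite !in_itv /=.
    move=> /andP[x0 xb]; have [xa|ax] := ltP x a; [left|right];
      by rewrite ?x0 ?xa ?ax.
  move=> [/andP[-> xa]|/andP[ax ->]]; first by rewrite (lt_le_trans xa ab).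
  by rewrite (le_trans a0 ax).
rewrite E Rintegral_setU//; first by rewrite -E.
apply/disj_setPRL => x /=; rewrite !in_itv /= => /andP[ax _].
by apply/negP; rewrite negb_and -!leNgt ax orbT.
Qed.

End IntegralBounds.

(** * Absolutely continuous functions *)

Section Cousin.
Context {R : realType}.
Implicit Types (a b s t x : R).

(** Interval induction: the supremum [c] of the points that can be reached from [a] is reached as
    well, and its gauge leads beyond it unless [c] is [b]. *)
Lemma cousin (Q : R -> R -> Prop) a b : a <= b ->
  (forall s t r, a <= s -> s <= t -> t <= r -> r <= b -> Q s t -> Q t r -> Q s r) ->
  (forall x, a <= x <= b -> exists2 d, 0 < d &
    forall s t, a <= s -> s <= x -> x <= t -> t <= b ->
      x - d < s -> t < x + d -> Q s t) ->
  Q a b.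
Proof.
move=> ab Qtrans Qloc.
pose S := [set c | a <= c <= b /\ Q a c].
have Sa : S a.
  split; first by rewrite lexx.
  have [|d d0 H] := Qloc a; first by rewrite lexx.
  by apply: H; rewrite // ?ltrBlDr ltrDl.
have hS : has_sup S by split; [exists a|exists b => c [/andP[]]].
set c := sup S.
have ac : a <= c by apply: ub_le_sup => //; exact: hS.2.
have cb : c <= b by apply: ge_sup; [exists a|move=> y [/andP[]]].
have [d d0 H] := Qloc c (introT andP (conj ac cb)).
have [c' Sc' cc'] : exists2 c', S c' & c - d < c'.
  by apply: sup_adherent.
have c'c : c' <= c by apply: ub_le_sup => //; exact: hS.2.
have [/andP[ac' _] Qc'] := Sc'.
pose e := Num.min b (c + d / 2).
have ce : c <= e by rewrite le_min cb lerDl divr_ge0 ?ltW.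
have eb : e <= b by rewrite ge_min lexx.
have ed : e < c + d.
  by rewrite gt_min; apply/orP; right; rewrite ltrD2l; lra.
have Qe : Q a e.
  apply: (Qtrans a c' e) => //; first exact: le_trans ce.
  exact: H.
have Se : S e by split=> //; rewrite eb (le_trans ac).
have ec : e <= c by apply: ub_le_sup => //; exact: hS.2.
suff -> : b = e by [].
apply/eqP; rewrite eq_le eb andbT; move: ec; rewrite /e ge_min => /orP[bc|cdc].
  by rewrite le_min lexx (le_trans bc) // lerDl divr_ge0 ?ltW.
by move: cdc; rewrite gerDl leNgt divr_gt0.
Qed.

End Cousin.

Section AbsoluteContinuity.
Context {R : realType}.
Notation T := (measurableTypeR R).
Notation mu := (@lebesgue_measure R).
Implicit Types (f g h : R -> R) (s t x X : R) (l : seq (R * R)).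

(** Consecutive intervals, from left to right, between [s] and [t]. Unlike the indexed families of
    [abs_continuous], ordered lists concatenate ([chain_cat]), which is what transitivity in
    [cousin] asks for. *)
Fixpoint chain s l t : Prop :=
  if l is p :: l' then [/\ s <= p.1, p.1 <= p.2 & chain p.2 l' t] else s <= t.

Lemma chain_le s l t : chain s l t -> s <= t.
Proof.
elim: l s => [//|p l ih] s /= [sp pp /ih]; exact: (le_trans (le_trans sp pp)).
Qed.

Lemma chain_cat s l t l' r : chain s l t -> chain t l' r -> chain s (l ++ l') r.
Proof.
elim: l s => [|p l ih] s /=; last by move=> [sp pp cl] cl'; split=> //; exact: ih.
case: l' => [|q l']; first exact: le_trans.
by move=> /= st [tq qq cl]; split=> //; exact: (le_trans st).
Qed.

Lemma chain_nth s l t : chain s l t -> forall i, (i < size l)%N ->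
  [/\ s <= (nth (0, 0) l i).1, (nth (0, 0) l i).1 <= (nth (0, 0) l i).2 &
      (nth (0, 0) l i).2 <= t].
Proof.
elim: l s => [//|p l ih] s /= [sp pp cl] [|i] /=.
  by move=> _; split=> //; exact: chain_le cl.
rewrite ltnS => /(ih _ cl)[H1 H2 H3]; split=> //.
exact: (le_trans (le_trans sp pp)).
Qed.

Lemma chain_lt s l t : chain s l t -> forall i j, (i < j)%N -> (j < size l)%N ->
  (nth (0, 0) l i).2 <= (nth (0, 0) l j).1.
Proof.
elim: l s => [//|p l ih] s /= [sp pp cl] [|i] [|j] //=.
  by move=> _; rewrite ltnS => /(chain_nth cl)[].
by rewrite !ltnS => ij jl; exact: (ih _ cl).
Qed.

Definition clength l := \sum_(p <- l) (p.2 - p.1).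
Definition cvariation g l := \sum_(p <- l) `|g p.2 - g p.1|.

Definition abscont X g := forall e, 0 < e -> exists2 d, 0 < d &
  forall l, chain 0 l X -> clength l < d -> cvariation g l < e.

Lemma abscontB X g h : abscont X g -> abscont X h ->
  abscont X (fun x => g x - h x).
Proof.
move=> ag ah e e0; have e2 : 0 < e / 2 by rewrite divr_gt0.
have [d d0 hd] := ag _ e2; have [d' d'0 hd'] := ah _ e2.
exists (Num.min d d'); first by rewrite lt_min d0.
move=> l cl; rewrite lt_min => /andP[ld ld'].
rewrite (splitr e); apply: le_lt_trans (ltrD (hd _ cl ld) (hd' _ cl ld')).
rewrite -big_split /=; apply: ler_sum => p _.
have -> : g p.2 - h p.2 - (g p.1 - h p.1) = (g p.2 - g p.1) - (h p.2 - h p.1).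
  by ring.
exact: ler_normB.
Qed.

(** A chain is in particular a family of non-overlapping intervals. Meant for [g] the real or the
    imaginary part of [F]. *)
Lemma abs_continuous_abscont X (F : R -> R[i]) g :
  (forall x y, `|g x - g y| <= cabs (F x - F y)) ->
  abs_continuous 0 X F -> abscont X g.
Proof.
move=> gF aF e /aF[d d0 H]; exists d => // l cl ld.
pose s (i : 'I_(size l)) := (nth (0, 0) l i).1.
pose t (i : 'I_(size l)) := (nth (0, 0) l i).2.
have := H (size l) s t; rewrite /cvariation (big_nth (0, 0)) big_mkord => H'.
apply: le_lt_trans (H' _ _ _).
- by apply: ler_sum => i _; exact: gF.
- by move=> i; exact: (chain_nth cl).
- move=> i j ij; have [lt_ij|] := ltnP i j; first by left; exact: (chain_lt cl).
  rewrite leq_eqVlt => /orP[/eqP ji|ji]; last by right; exact: (chain_lt cl).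
  by move: ij; rewrite -val_eqE /= ji eqxx.
- by move: ld; rewrite /clength (big_nth (0, 0)) big_mkord.
Qed.

(** The half-open intervals of a chain are disjoint, so their lengths add up to the measure of a
    subset of [O]. *)
Lemma chain_measure s l t (O : set T) : measurable O -> chain s l t ->
  (forall p, p \in l -> `[p.1, p.2[ `<=` O) ->
  ((clength l)%:E <= mu (O `&` `[s, t[%classic))%E.
Proof.
move=> mO; elim: l s => [|p l ih] s /=.
  by move=> _ _; rewrite /clength big_nil measure_ge0.
move=> [sp pp cl] H; rewrite /clength big_cons EFinD.
have pt := chain_le cl.
apply: (@le_trans _ _ ((p.2 - p.1)%:E + mu (O `&` `[p.2, t[%classic))%E).
  by apply: leeD2l; apply: ih => // q ql; apply: H; rewrite inE ql orbT.
have -> : (p.2 - p.1)%:E = mu (`[p.1, p.2[%classic : set T).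
  rewrite lebesgue_measure_itv /= lte_fin; case: ltP => // h.
  by rewrite (le_anti (introT andP (conj pp h))) subrr.
rewrite -measureU//; last 2 first.
- exact: measurableI.
- apply/seteqP; split=> [x|//] [] /=; rewrite !in_itv /=.
  by move=> /andP[_ xp] [_ /andP[]]; rewrite leNgt xp.
apply: le_measure.
- by rewrite inE; apply: measurableU => //; exact: measurableI.
- by rewrite inE; exact: measurableI.
move=> x [] /=; rewrite !in_itv /=.
  move=> /andP[px xp]; split; last by rewrite (le_trans sp px) (lt_le_trans xp pt).
  by apply: (H p); rewrite ?mem_head //= in_itv /= px.
by move=> [Ox /andP[px ->]]; split=> //; rewrite andbT (le_trans (le_trans sp pp)).
Qed.

Lemma is_derive0_near g x e : 0 < e -> is_derive x 1 g 0 ->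
  exists2 d, 0 < d & forall y, `|y - x| < d -> `|g y - g x| <= e * `|y - x|.
Proof.
move=> e0 [dg g0].
move: dg; rewrite /derivable => /cvg_ex[l hl].
have l0 : l = 0 by rewrite -g0; apply/esym/cvg_lim => //; exact: Rhausdorff.
move: hl; rewrite l0 => /cvgrPdist_le/(_ e e0).
case=> d /= d0 H; exists d => // y yx.
have [->|yx0] := eqVneq y x; first by rewrite !subrr normr0 mulr0.
have yx1 : y - x != 0 by rewrite subr_eq0.
have := H (y - x); rewrite /ball /= sub0r normrN => /(_ yx yx1).
rewrite sub0r normrN [_ *: 1](mulr1) subrK normrM normfV.
by rewrite mulrC ler_pdivrMr ?normr_gt0.
Qed.

(* Cousin's lemma for a gauge controlling the slope of [g] off the null set and
   staying in an open set of small measure around it. *)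
Lemma abscont_cst X g : 0 <= X -> abscont X g ->
  {ae mu, forall x, 0 < x < X -> is_derive x 1 g 0} -> g X = g 0.
Proof.
move=> X0 ag [N [mN N0 HN]]; apply/eqP; rewrite -subr_eq0 -normr_le0.
apply/ler_addgt0Pl => e e0; rewrite addr0.
have e2 : 0 < e / 2 by rewrite divr_gt0.
have [d d0 hd] := ag _ e2.
(* The end points join the exceptional set, since the derivative is given only on the open
   interval. *)
pose N' : set T := N `|` [set 0; X].
have mN' : measurable N' by apply: measurableU => //; apply: measurableU.
have N'0 : mu N' = 0%E.
  have m0 : mu [set 0; X] = 0%E.
    by apply: countable_lebesgue_measure0; apply: finite_set_countable.
  by rewrite -N0; apply: measureU0 => //; exact: measurableU.
have [U [oU N'U mU]] : exists V : set R, [/\ open V, N' `<=` V & (mu (V `\` N') < d%:E)%E].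
  have N'y : (mu N' < +oo)%E by rewrite N'0 ltry.
  exact: lebesgue_regularity_outer N'y d0.
have mU' : (mu U < d%:E)%E.
  apply: le_lt_trans mU.
  have mUm : measurable (U : set T) by exact: open_measurable.
  rewrite -[X in (mu X <= _)%E](setUIDK U N') setUC.
  apply: (le_trans (measureU2 _ _ _)).
  - exact: measurableD.
  - exact: measurableI.
  rewrite -[leRHS]adde0 leeD2l //.
  by rewrite -N'0; apply: le_measure; rewrite ?inE //; exact: measurableI.
pose e' := e / 2 / (X + 1).
have e'0 : 0 < e' by rewrite divr_gt0 // ltr_wpDl.
(* The chain collects the intervals tagged by points of [N'], where the increment of [g] is charged
   to its variation; elsewhere it is charged to the slope [e']. *)
pose Q s t := exists l, [/\ chain s l t, forall p, p \in l -> `[p.1, p.2[ `<=` U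
  & `|g t - g s| <= e' * (t - s) + cvariation g l].
suff [l [cl lU gl]] : Q 0 X.
  apply: (le_trans gl); rewrite [leRHS](splitr e).
  apply: lerD.
    rewrite subr0 /e' mulrAC ler_pdivrMr ?ltr_wpDl // ler_pM2l // lerDl //.
  apply/ltW/hd => //; rewrite -lte_fin.
  apply: (le_lt_trans _ mU').
  apply: (le_trans (chain_measure _ cl lU)); first exact: open_measurable.
  apply: le_measure; rewrite ?inE; [|exact: open_measurable|by move=> x []].
  by apply: measurableI => //; exact: open_measurable.
apply: cousin => //.
  move=> s t r _ st tr _ [l [cl lU gl]] [l' [cl' lU' gl']].
  exists (l ++ l'); split; first exact: chain_cat cl cl'.
    by move=> p; rewrite mem_cat => /orP[/lU|/lU'].
  rewrite /cvariation big_cat /= -/(cvariation _ _) -/(cvariation _ _).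
  have -> : g r - g s = (g t - g s) + (g r - g t) by ring.
  apply: (le_trans (ler_normD _ _)); apply: (le_trans (lerD gl gl')).
  by rewrite le_eqVlt; apply/orP; left; apply/eqP; ring.
move=> x /andP[x0 xX].
have [N'x|N'x] := pselect (N' x).
  have /nbhs_ballP[r r0 hr] : nbhs x U by apply: open_nbhs_nbhs; split=> //; exact: N'U.
  exists r => // s t s0 sx xt tX xs tx.
  exists [:: (s, t)]; split => /=; first by split=> //; exact: le_trans xt.
    move=> p; rewrite inE => /eqP -> y /=; rewrite in_itv /= => /andP[sy yt].
    by apply: hr; rewrite /ball /= ltr_norml; lra.
  rewrite /cvariation big_seq1 /= lerDr mulr_ge0 ?(ltW e'0) // subr_ge0.
  exact: le_trans xt.
have [Nx [xn0 xnX]] : ~ N x /\ x != 0 /\ x != X.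
  split; first by move=> Nx; apply: N'x; left.
  by split; apply/eqP => xe; apply: N'x; right; rewrite xe; [left|right].
have gx : is_derive x 1 g 0.
  apply: contrapT => h; apply: Nx; apply: HN => /= h'; apply: h; apply: h'.
  by rewrite !lt_neqAle x0 xX eq_sym xn0 xnX.
have [r r0 hr] := is_derive0_near e'0 gx.
exists r => // s t s0 sx xt tX xs tx.
exists [::]; split => //=; first exact: le_trans xt.
rewrite /cvariation big_nil addr0.
have -> : g t - g s = (g t - g x) - (g s - g x) by ring.
apply: (le_trans (ler_normB _ _)).
have -> : e' * (t - s) = e' * `|t - x| + e' * `|s - x|.
  by rewrite ger0_norm ?subr_ge0// ler0_norm ?subr_le0//; ring.
by apply: lerD; apply: hr; rewrite ltr_norml; lra.
Qed.

End AbsoluteContinuity.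

(** * The fundamental theorem of calculus for absolutely continuous functions *)

Section FundamentalTheorem.
Context {R : realType}.
Notation T := (measurableTypeR R).
Notation mu := (@lebesgue_measure R).
Implicit Types (f g h : R -> R) (s t x X : R) (l : seq (R * R)).

(** Open on the left and closed on the right, to match the increments of a primitive taken over
    ]-oo, y]. *)
Fixpoint cset l : set R :=
  if l is p :: l' then `]p.1, p.2]%classic `|` cset l' else set0.

Lemma chain_cset s l t : chain s l t ->
  [/\ measurable (cset l : set T), cset l `<=` `]s, t] &
      (mu (cset l) <= (clength l)%:E)%E].
Proof.
elim: l s => [|p l ih] s /=.
  by move=> _; split=> //; rewrite /clength big_nil measure0.
move=> [sp pp cl]; have pt := chain_le cl.
have [ml lt ll] := ih _ cl; split.
- exact: measurableU.
- move=> x [|/lt] /=; rewrite !in_itv /= => /andP[px xp].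
    by rewrite (le_lt_trans sp px) (le_trans xp).
  by rewrite xp (le_lt_trans (le_trans sp pp)).
- have mp : (mu (`]p.1, p.2]%classic : set T) <= (p.2 - p.1)%:E)%E.
    rewrite lebesgue_measure_itv /= lte_fin; case: ltP => // h.
    by rewrite lee_fin subr_ge0.
  apply: (le_trans (measureU2 _ _ _)) => //.
  by rewrite /clength big_cons EFinD; exact: leeD.
Qed.

Lemma cset_integral s l t h : chain s l t -> mu.-integrable setT (EFin \o h) ->
  \int[mu]_(x in cset l) h x = \sum_(p <- l) \int[mu]_(x in `]p.1, p.2]) h x.
Proof.
move=> + hi; elim: l s => [|p l ih] s /=.
  by move=> _; rewrite big_nil Rintegral_set0.
move=> [sp pp cl]; have [ml lt _] := chain_cset cl.
rewrite big_cons Rintegral_setU//.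
- by rewrite (ih p.2).
- by apply: integrableS hi => //; exact: measurableU.
- apply/disj_setPRL => x /lt /=; rewrite !in_itv /= => /andP[px _].
  by apply/negP; rewrite negb_and -!leNgt -ltNge px orbT.
Qed.

Lemma integrable_itvNyc h (y : R) : mu.-integrable setT (EFin \o h) ->
  mu.-integrable `]-oo, y]%classic (EFin \o h).
Proof. by apply: integrableS. Qed.

(** Absolute continuity of the integral as a set function, applied to the union [cset l], whose
    measure is at most [clength l]. *)
Lemma integral_abscont X h : mu.-integrable setT (EFin \o h) ->
  abscont X (fun y => \int[mu]_(t in `]-oo, y]) h t).
Proof.
move=> hi e /(integral_normr_continuous hi)[d [d0 hd]].
exists d => // l cl ld; have [ml _ ll] := chain_cset cl.
have := hd _ ml (le_lt_trans ll _); rewrite lte_fin => /(_ ld).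
rewrite (cset_integral cl); last exact: integrable_norm.
apply: le_lt_trans.
rewrite /cvariation big_seq [leRHS]big_seq; apply: ler_sum => p pl.
have pp : p.1 <= p.2.
  have [i il <-] := nthP (0, 0) pl.
  by have [] := chain_nth cl il.
rewrite Rintegral_itvB //; first by apply: le_normr_Rintegral => //; exact: integrableS hi.
exact: integrable_itvNyc.
Qed.

Lemma abscontS X Y g : Y <= X -> abscont X g -> abscont Y g.
Proof.
move=> YX ag e /ag[d d0 hd]; exists d => // l cl; apply: hd.
by rewrite -[l]cats0; apply: chain_cat cl _.
Qed.

(** By Lebesgue differentiation the primitive of [h] has derivative [h] almost everywhere, so its
    difference with [g] is absolutely continuous with derivative 0 almost everywhere, and
    [abscont_cst] applies. *)
Let FTC_end X g h : 0 < X -> abscont X g ->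
  mu.-integrable `[0, X[%classic (EFin \o h) ->
  {ae mu, forall x, 0 < x < X -> is_derive x 1 g (h x)} ->
  g X = g 0 + \int[mu]_(t in `[0, X[) h t.
Proof.
move=> X0 ag hi gh.
(* With the extension by zero the primitive can start at -oo; up to 0 it meets only the null set
   {0}. *)
pose k := h \_ `[0, X[%classic.
have ki : mu.-integrable setT (EFin \o k).
  have /(integrable_mkcond _) := hi.
  by move=> /(_ (measurable_itv _)); rewrite restrict_EFin.
pose F y := \int[mu]_(t in `]-oo, y]) k t.
have F0 : F 0 = 0.
  rewrite /F -Rintegral_mkcondr.
  rewrite (_ : _ `&` _ = [set 0]) ?Rintegral_set1//.
  apply/seteqP; split => x /=; rewrite !in_itv /=.
    by move=> [x0 /andP[x0' _]]; apply/eqP; rewrite eq_le x0 x0'.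
  by move=> ->; rewrite lexx X0.
have FX : F X = \int[mu]_(t in `[0, X[) h t.
  rewrite /F -Rintegral_mkcondr; congr (Rintegral _ _ _).
  apply/seteqP; split => x /=; rewrite !in_itv /=; first by case.
  by move=> /andP[-> xX]; rewrite xX ltW.
have aF : abscont X F by exact: integral_abscont.
have := @abscont_cst R X (fun x => g x - F x) (ltW X0) (abscontB ag aF).
rewrite F0 subr0 FX => H; apply/eqP; rewrite -subr_eq; apply/eqP; apply: H.
have kloc : locally_integrable [set: R] k.
  by apply: open_integrable_locally => //; exact: openT.
have := FTC1Ny (fun y => integrable_itvNyc y ki) kloc.
have aeF := ae_filter_ringOfSetsType mu.
apply: filterS2 gh => x gh [dF F'] xX.
have gx := gh xX.
have Fx : is_derive x 1 F (k x) by split=> //; rewrite -derive1E.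
have kx : k x = h x.
  by rewrite /k patchE mem_set //= in_itv /=; case/andP: xX => /ltW -> ->.
have := is_deriveB gx Fx; rewrite kx subrr; exact.
Qed.

Lemma abscont_FTC X g h : abscont X g ->
  mu.-integrable `[0, X[%classic (EFin \o h) ->
  {ae mu, forall x, 0 < x < X -> is_derive x 1 g (h x)} ->
  forall x, 0 <= x <= X -> g x = g 0 + \int[mu]_(t in `[0, x[) h t.
Proof.
move=> ag hi gh x /andP[]; rewrite le_eqVlt => /predU1P[<- _|x0 xX].
  by rewrite set_itvco0 Rintegral_set0 addr0.
apply: FTC_end => //; first exact: abscontS ag.
  apply: integrable_itvS hi => //; exact: subset_bcoo.
have aeF := ae_filter_ringOfSetsType mu.
apply: filterS gh => y gh /andP[y0 yx]; apply: gh.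
by rewrite y0 (lt_le_trans yx).
Qed.

End FundamentalTheorem.

(** * The Lagrange identity *)

Section FubiniTriangle.
Context {R : realType}.
Notation T := (measurableTypeR R).
Notation mu := (@lebesgue_measure R).
Variable nu : {sigma_finite_measure set T -> \bar R}.
Variables (X : R) (g phi : R -> R).
Hypothesis gi : mu.-integrable `[0, X[%classic (EFin \o g).
Hypothesis phii : nu.-integrable `[0, X[%classic (EFin \o phi).

Let gX := g \_ `[0, X[%classic.
Let phiX := phi \_ `[0, X[%classic.

Let gXi : mu.-integrable setT (EFin \o gX).
Proof.
have /(integrable_mkcond _) := gi.
by move=> /(_ (measurable_itv _)); rewrite restrict_EFin.
Qed.

Let phiXi : nu.-integrable setT (EFin \o phiX).
Proof.
have /(integrable_mkcond _) := phii.
by move=> /(_ (measurable_itv _)); rewrite restrict_EFin.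
Qed.

(** The inequality is strict because an atom of [nu] at y counts in int_[0,t) only for t > y. *)
Let tri (z : T * T) : R := if z.2 < z.1 then gX z.1 * phiX z.2 else 0.

Let mgX : measurable_fun setT (gX : T -> R).
Proof. by have /integrableP[/measurable_EFinP] := gXi. Qed.

Let mphiX : measurable_fun setT (phiX : T -> R).
Proof. by have /integrableP[/measurable_EFinP] := phiXi. Qed.

Let mtri : measurable_fun setT tri.
Proof.
apply: measurable_fun_ifT => //; first exact: measurable_fun_ltr.
apply: measurable_funM.
  exact: (measurableT_comp mgX).
exact: (measurableT_comp mphiX).
Qed.

Let tri_le z : `|tri z| <= `|gX z.1| * `|phiX z.2|.
Proof. by rewrite /tri; case: ifP; rewrite ?normrM // normr0 mulr_ge0. Qed.

Let itri : (mu \x nu)%E.-integrable setT (EFin \o tri).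
Proof.
apply/integrable12ltyP; first exact/measurable_EFinP.
have phin : (\int[nu]_y (`|phiX y|)%:E < +oo)%E by have /integrableP[] := phiXi.
have phin0 : (0 <= \int[nu]_y (`|phiX y|)%:E)%E by apply: integral_ge0.
have phinf : (\int[nu]_y (`|phiX y|)%:E)%E \is a fin_num by rewrite ge0_fin_numE.
set C := (\int[nu]_y (`|phiX y|)%:E)%E in phin phin0 phinf.
apply: (@le_lt_trans _ _ (\int[mu]_x (C * (`|gX x|)%:E))%E).
  apply: ge0_le_integral => //.
  - by move=> x _; apply: integral_ge0.
  - apply: (@measurable_fun_fubini_tonelli_F _ _ _ _ _ nu (fun z => `|(tri z)%:E|%E)) => //.
    by apply: measurableT_comp => //; exact/measurable_EFinP.
  - apply: measurable_funeM; apply/measurable_EFinP; exact: measurableT_comp.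
  move=> x _.
  apply: (@le_trans _ _ (\int[nu]_y ((`|gX x|)%:E * (`|phiX y|)%:E))%E).
    apply: ge0_le_integral => //.
    - apply/measurable_EFinP; apply: measurableT_comp => //.
      by apply: (measurableT_comp mtri); exact: measurable_pair1.
    - apply: measurable_funeM; apply/measurable_EFinP; exact: measurableT_comp.
    - by move=> y _; rewrite /= lee_fin tri_le.
  rewrite ge0_integralZl//; first by rewrite muleC.
  by apply/measurable_EFinP; exact: measurableT_comp.
rewrite ge0_integralZl//.
  rewrite lte_mul_pinfty //.
  by have /integrableP[] := gXi.
by apply/measurable_EFinP; exact: measurableT_comp.
Qed.

Let tri1 t : (\int[nu]_y (tri (t, y))%:E =
  (gX t * \int[nu]_(y in `[0, t[) phi y)%:E)%E.
Proof.
have [tX|tX] := boolP (t \in `[0, X[%classic); last first.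
  rewrite /gX patchE (negbTE tX) mul0r integral0_eq // => y _.
  by rewrite /tri /gX /= patchE (negbTE tX) mul0r; case: ifP.
have {}tX : 0 <= t < X by move: tX; rewrite inE /= in_itv.
case/andP: tX => t0 tX.
have ti : nu.-integrable `[0, t[%classic (EFin \o phi).
  by apply: (integrable_itvS _ _ phii) => //; apply: subset_bcoo => //; exact: ltW.
rewrite Rintegral_mkcond -RintegralZl //; last first.
  have /(integrable_mkcond _) := ti.
  by move=> /(_ (measurable_itv _)); rewrite restrict_EFin.
rewrite /Rintegral fineK; last first.
  apply: integrable_fin_num => //; apply: (@integrableZl _ _ _ nu _ _ (gX t) (EFin \o (phi \_ `[0, t[%classic))) => //.
  have /(integrable_mkcond _) := ti.
  by move=> /(_ (measurable_itv _)); rewrite restrict_EFin.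
apply: eq_integral => y _; rewrite /tri /=; congr EFin.
rewrite /phiX !patchE.
case: ifPn => [yt|]; last first.
  rewrite -leNgt => ty; rewrite [X in if X then _ else _](_ : _ = false) ?mulr0 //.
  by apply/negbTE; rewrite notin_setE /= in_itv /= ltNge ty andbF.
have -> : (y \in `[0, X[%classic) = (y \in `[0, t[%classic) by [
  rewrite !mem_setE !in_itv /= yt (lt_trans yt tX)].
by [].
Qed.

Let tri2 y : (\int[mu]_t (tri (t, y))%:E =
  (phiX y * \int[mu]_(t in `]y, X[) g t)%:E)%E.
Proof.
have [yX|yX] := boolP (y \in `[0, X[%classic); last first.
  rewrite /phiX patchE (negbTE yX) mul0r integral0_eq // => t _.
  by rewrite /tri /phiX /= patchE (negbTE yX) mulr0; case: ifP.
have {}yX : 0 <= y < X by move: yX; rewrite inE /= in_itv.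
case/andP: yX => y0 yX.
have ti : mu.-integrable `]y, X[%classic (EFin \o g).
  apply: (integrable_itvS _ _ gi) => // t /=.
  by rewrite !in_itv /= => /andP[yt ->]; rewrite (le_trans y0 (ltW yt)).
rewrite Rintegral_mkcond -RintegralZl //; last first.
  have /(integrable_mkcond _) := ti.
  by move=> /(_ (measurable_itv _)); rewrite restrict_EFin.
rewrite /Rintegral fineK; last first.
  apply: integrable_fin_num => //; apply: (@integrableZl _ _ _ mu _ _ (phiX y) (EFin \o (g \_ `]y, X[%classic))) => //.
  have /(integrable_mkcond _) := ti.
  by move=> /(_ (measurable_itv _)); rewrite restrict_EFin.
apply: eq_integral => t _; rewrite /tri /=; congr EFin.
rewrite /gX !patchE mulrC.
case: ifPn => [yt|]; last first.
  rewrite -leNgt => ty; rewrite [X in if X then _ else _](_ : _ = false) ?mulr0 //.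
  by apply/negbTE; rewrite notin_setE /= in_itv /= ltNge ty.
have -> : (t \in `[0, X[%classic) = (t \in `]y, X[%classic).
  by rewrite !mem_setE !in_itv /= yt (le_trans y0 (ltW yt)).
by [].
Qed.

(** Both sides integrate [tri] over the triangle y < t, in the two possible orders. *)
Lemma triangle_fubini :
  \int[mu]_(t in `[0, X[) (g t * \int[nu]_(y in `[0, t[) phi y) =
  \int[nu]_(y in `[0, X[) (phi y * \int[mu]_(t in `]y, X[) g t).
Proof.
have := Fubini itri => /(congr1 fine).
under eq_integral do rewrite /= tri1.
under [in X in _ = X -> _]eq_integral do rewrite /= tri2.
rewrite [in X in _ -> X]Rintegral_mkcond [in X in _ -> _ = X]Rintegral_mkcond.
have E1 : gX \* (fun t => \int[nu]_(y in `[0, t[) phi y) =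
    (fun t => g t * \int[nu]_(y in `[0, t[) phi y) \_ `[0, X[%classic.
  by apply/funext => t; rewrite /gX /= !patchE; case: ifP; rewrite ?mul0r.
have E2 : phiX \* (fun y => \int[mu]_(t in `]y, X[) g t) =
    (fun y => phi y * \int[mu]_(t in `]y, X[) g t) \_ `[0, X[%classic.
  by apply/funext => t; rewrite /phiX /= !patchE; case: ifP; rewrite ?mul0r.
by rewrite -E1 -E2.
Qed.

(** A by-product of Fubini's theorem; with g = 1 it gives the measurability claimed in
    [bmeas_integral], where the function may jump at atoms of [nu]. *)
Lemma triangle_measurable : measurable_fun setT
  (gX \* (fun t => \int[nu]_(y in `[0, t[) phi y) : T -> R).
Proof.
apply/measurable_EFinP.
rewrite (_ : _ \o _ = fubini_F nu (EFin \o tri)); first exact: (measurable_fubini_F itri).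
by apply/funext => t; rewrite /fubini_F /= tri1.
Qed.

End FubiniTriangle.

Section IntegralFunction.
Context {R : realType}.
Notation T := (measurableTypeR R).
Notation mu := (@lebesgue_measure R).

Lemma lebesgue_itvco_fin (X : R) : (mu (`[0%R, X[%classic : set T) < +oo)%E.
Proof. by rewrite lebesgue_measure_itv /= lte_fin; case: ifP => _; rewrite -?EFinB ltry. Qed.

Lemma bmeas_integral (nu : {sigma_finite_measure set T -> \bar R}) (X : R) phi :
  nu.-integrable `[0, X[%classic (EFin \o phi) ->
  bmeas X (fun t => \int[nu]_(y in `[0, t[) phi y).
Proof.
move=> phii; split.
  have ci : mu.-integrable `[0, X[%classic (EFin \o (fun=> 1 : R)).
    by apply: bmeas_integrable; [exact: lebesgue_itvco_fin|exact: bmeas_cst].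
  have := triangle_measurable ci phii.
  rewrite (_ : _ \* _ = (fun t => \int[nu]_(y in `[0, t[) phi y) \_ `[0, X[%classic).
    move=> h; apply: (iffRL (@measurable_restrictT _ _ T R `[0, X[%classic
      (fun t : R => \int[nu]_(y in `[0, t[) phi y) _)) => //.
  by apply/funext => t; rewrite /= !patchE; case: ifP; rewrite ?mul0r ?mul1r.
exists (\int[nu]_(y in `[0, X[) `|phi y|) => t /andP[t0 tX].
have ti : nu.-integrable `[0, t[%classic (EFin \o phi).
  by apply: (integrable_itvS _ _ phii) => //; apply: subset_bcoo => //; exact: ltW.
apply: (le_trans (le_normr_Rintegral _ ti)) => //.
rewrite (Rintegral_split t0 (ltW tX) (integrable_norm phii)) lerDl.
by apply: Rintegral_ge0 => y _ /=.
Qed.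

End IntegralFunction.

(** * Integral systems and integration by parts *)

Section SignedSystem.
Context {R : realType}.
Notation T := (measurableTypeR R).
Notation mu := (@lebesgue_measure R).
Variables mu1 mu2 : {finite_measure set T -> \bar R}.
Implicit Types (f df g dg h k phi psi : R -> R) (x y X : R).

Definition sI (D : set T) f := \int[mu1]_(y in D) f y - \int[mu2]_(y in D) f y.

Lemma bmeas_eq X f g : (forall x, 0 <= x < X -> f x = g x) ->
  bmeas X g -> bmeas X f.
Proof.
move=> fg [mg [M hM]]; split.
  apply: eq_measurable_fun mg => x; rewrite inE /= in_itv /= => xX.
  by rewrite fg.
by exists M => x xX; rewrite fg //; exact: hM.
Qed.

Lemma fin_itv (nu : {finite_measure set T -> \bar R}) (D : set T) :
  measurable D -> (nu D < +oo)%E.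
Proof. by move=> mD; rewrite ltey_eq fin_num_measure. Qed.

Lemma bmeas_fint (nu : {finite_measure set T -> \bar R}) X f :
  bmeas X f -> nu.-integrable `[0, X[%classic (EFin \o f).
Proof. by apply: bmeas_integrable; exact: fin_itv. Qed.

Lemma bmeas_lint X f : bmeas X f -> mu.-integrable `[0, X[%classic (EFin \o f).
Proof. by apply: bmeas_integrable; exact: lebesgue_itvco_fin. Qed.

Lemma sID x f g : bmeas x f -> bmeas x g ->
  sI `[0, x[%classic (fun y => f y + g y) =
  sI `[0, x[%classic f + sI `[0, x[%classic g.
Proof.
move=> bf bg; rewrite /sI !RintegralD //; try exact: bmeas_fint.
by ring.
Qed.

Lemma sIB x f g : bmeas x f -> bmeas x g ->
  sI `[0, x[%classic (fun y => f y - g y) =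
  sI `[0, x[%classic f - sI `[0, x[%classic g.
Proof.
move=> bf bg; rewrite /sI !RintegralB //; try exact: bmeas_fint.
by ring.
Qed.

Lemma sIZ x c f : bmeas x f ->
  sI `[0, x[%classic (fun y => c * f y) = c * sI `[0, x[%classic f.
Proof.
move=> bf; rewrite /sI !RintegralZl //; try exact: bmeas_fint.
by ring.
Qed.

(* [df] is [f'], and [- df' + phi dchi = h dx] with [chi = mu1 - mu2]. *)
Definition rep X f df phi h :=
  [/\ bmeas X phi, mu.-integrable `[0, X[%classic (EFin \o h),
      forall x, 0 <= x <= X -> df x = df 0 + sI `[0, x[%classic phi
                                      - \int[mu]_(t in `[0, x[) h t &
      forall x, 0 <= x <= X -> f x = f 0 + \int[mu]_(t in `[0, x[) df t].

Lemma rep_df X f df phi h : rep X f df phi h -> bmeas X df.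
Proof.
move=> [bphi hi dfE _].
pose e x := df 0 + (\int[mu1]_(y in `[0, x[) phi y - \int[mu2]_(y in `[0, x[) phi y)
  - \int[mu]_(t in `[0, x[) h t.
apply: (@bmeas_eq _ _ e).
  by move=> x /andP[x0 xX]; rewrite dfE // x0 ltW.
apply: bmeasB; last exact: bmeas_integral.
apply: bmeasD; first exact: bmeas_cst.
by apply: bmeasB; apply: bmeas_integral; exact: bmeas_fint.
Qed.

Lemma rep_f X f df phi h : rep X f df phi h -> bmeas X f.
Proof.
move=> rf; have bdf := rep_df rf; case: rf => _ _ _ fE.
apply: (@bmeas_eq _ _ (fun x => f 0 + \int[mu]_(t in `[0, x[) df t)).
  by move=> x /andP[x0 xX]; rewrite fE // x0 ltW.
apply: bmeasD; first exact: bmeas_cst.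
by apply: bmeas_integral; exact: bmeas_lint.
Qed.

(** Integration by parts against the distribution function of psi dnu: after [triangle_fubini] the
    inner integral of [df] over ]y, X[ is f X - f y. *)
Lemma triangle_rep (nu : {sigma_finite_measure set T -> \bar R}) X f df psi :
  0 <= X -> bmeas X df -> bmeas X f ->
  nu.-integrable `[0, X[%classic (EFin \o psi) ->
  (forall x, 0 <= x <= X -> f x = f 0 + \int[mu]_(t in `[0, x[) df t) ->
  \int[mu]_(t in `[0, X[) (df t * \int[nu]_(y in `[0, t[) psi y) =
  f X * (\int[nu]_(y in `[0, X[) psi y) - \int[nu]_(y in `[0, X[) (f y * psi y).
Proof.
move=> X0 bdf bf ipsi fE; have idf := bmeas_lint bdf.
rewrite triangle_fubini //.
rewrite -RintegralZl // -RintegralB //; last 2 first.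
- exact: (bmeas_mul_integrable (bmeas_cst X (f X)) ipsi).
- exact: (bmeas_mul_integrable bf ipsi).
apply: eq_Rintegral => y; rewrite inE /= in_itv /= => /andP[y0 yX].
have -> : \int[mu]_(t in `]y, X[) df t = f X - f y.
  rewrite Rintegral_itv_obnd_cbnd; last first.
    apply: (integrable_itvS _ _ idf) => // t /=.
    by rewrite !in_itv /= => /andP[yt ->]; rewrite (le_trans y0 (ltW yt)).
  rewrite (fE X) ?X0 ?lexx // (fE y) ?y0 ?ltW //.
  by rewrite (Rintegral_split y0 (ltW yX) idf); ring.
by ring.
Qed.

(** The integral formula for [dg] is inserted into the integral of df dg, and each of [mu1], [mu2]
    and Lebesgue measure is integrated by parts with [triangle_rep]. *)
Lemma rep_product X f df phi h g dg psi k :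
  0 <= X -> rep X f df phi h -> rep X g dg psi k ->
  f X * dg X - f 0 * dg 0 =
  \int[mu]_(t in `[0, X[) (df t * dg t) +
  (sI `[0, X[%classic (fun y => f y * psi y)
   - \int[mu]_(t in `[0, X[) (f t * k t)).
Proof.
move=> X0 rf rg.
have bdf := rep_df rf; have bf := rep_f rf; have bdg := rep_df rg.
have [_ _ _ fE] := rf; have [bpsi ki dgE _] := rg.
pose A1 t := \int[mu1]_(y in `[0, t[) psi y.
pose A2 t := \int[mu2]_(y in `[0, t[) psi y.
pose A3 t := \int[mu]_(y in `[0, t[) k y.
have bA1 : bmeas X A1 by apply: bmeas_integral; exact: bmeas_fint.
have bA2 : bmeas X A2 by apply: bmeas_integral; exact: bmeas_fint.
have bA3 : bmeas X A3 by exact: bmeas_integral.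
have -> : \int[mu]_(t in `[0, X[) (df t * dg t) =
    \int[mu]_(t in `[0, X[) (dg 0 * df t + (df t * A1 t - df t * A2 t)
       - df t * A3 t).
  apply: eq_Rintegral => t; rewrite inE /= in_itv /= => /andP[t0 tX].
  by rewrite (dgE t) ?t0 ?ltW // /sI -/(A1 t) -/(A2 t) -/(A3 t); ring.
have b0 : bmeas X (fun t => dg 0 * df t) by apply: bmeasM => //; exact: bmeas_cst.
have b1 : bmeas X (fun t => df t * A1 t) by exact: bmeasM.
have b2 : bmeas X (fun t => df t * A2 t) by exact: bmeasM.
have b3 : bmeas X (fun t => df t * A3 t) by exact: bmeasM.
have b12 := bmeasB b1 b2.
rewrite RintegralB //; [|exact: bmeas_lint (bmeasD b0 b12)|exact: bmeas_lint].
rewrite RintegralD //; [|exact: bmeas_lint..].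
rewrite RintegralB //; [|exact: bmeas_lint..].
rewrite RintegralZl //; last exact: bmeas_lint.
rewrite !(triangle_rep X0 bdf bf _ fE) //; try exact: bmeas_fint.
rewrite -/(A1 X) -/(A2 X) -/(A3 X) (dgE X) ?X0 ?lexx // /sI -/(A1 X) -/(A2 X) -/(A3 X).
rewrite (fE X) ?X0 ?lexx //.
by ring.
Qed.

(** The product rules for (f, g) and (g, f) share the integral of f' g', which cancels in the
    difference. *)
Lemma rep_lagrange X f df phi h g dg psi k :
  0 <= X -> rep X f df phi h -> rep X g dg psi k ->
  (f X * dg X - df X * g X) - (f 0 * dg 0 - df 0 * g 0) =
  (sI `[0, X[%classic (fun y => f y * psi y)
   - \int[mu]_(t in `[0, X[) (f t * k t)) -
  (sI `[0, X[%classic (fun y => g y * phi y)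
   - \int[mu]_(t in `[0, X[) (g t * h t)).
Proof.
move=> X0 rf rg.
have E1 := rep_product X0 rf rg; have E2 := rep_product X0 rg rf.
have E3 : \int[mu]_(t in `[0, X[) (df t * dg t) = \int[mu]_(t in `[0, X[) (dg t * df t).
  by apply: eq_Rintegral => t _; rewrite mulrC.
rewrite E3 in E1.
have -> : (f X * dg X - df X * g X) - (f 0 * dg 0 - df 0 * g 0) =
  (f X * dg X - f 0 * dg 0) - (g X * df X - g 0 * df 0) by ring.
by rewrite E1 E2; ring.
Qed.

End SignedSystem.

(** * Solutions as integral systems *)

Section HahnConsistency.
Context {R : realType} {b : \bar R} (chi : signed_measure b).
Notation T := (measurableTypeR R).
Implicit Types (x X : R) (A : set T).

Lemma sm_restr_sub x X A : 0 < x -> x <= X -> (X%:E < b)%E ->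
  sm_restr chi x A = sm_restr chi X (A `&` `[0, x[%classic).
Proof.
move=> x0 xX Xb; rewrite /sm_restr x0 (lt_le_trans x0 xX) Xb /=.
rewrite (le_lt_trans _ Xb) ?lee_fin // -setIA; congr (chi (_ `&` _))%:E.
apply/seteqP; split=> y /=; rewrite !in_itv /=; last by case.
by move=> /andP[-> yx]; rewrite yx (lt_le_trans yx xX).
Qed.

(** The signs on both parts survive restriction, since the charge for x is the charge for X
    evaluated on intersections with [0, x[. *)
Lemma sm_hahn_restr x X : 0 < x -> x <= X -> (X%:E < b)%E ->
  hahn_decomposition (sm_restr chi x)
    (sval (cid (sm_hahn_ex chi X))).1 (sval (cid (sm_hahn_ex chi X))).2.
Proof.
move=> x0 xX Xb.
have [[mP PP] [mN NN] PN PN0] := sm_hahn chi X.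
split => //; split => // A mA AP.
- suff : (0 <= sm_restr chi x A)%E by [].
  rewrite (sm_restr_sub _ x0 xX Xb).
  by apply: PP; [exact: measurableI|move=> y [/AP]].
- suff : (sm_restr chi x A <= 0)%E by [].
  rewrite (sm_restr_sub _ x0 xX Xb).
  by apply: NN; [exact: measurableI|move=> y [/AP]].
Qed.

(** [sm_integral chi x] chooses a Hahn decomposition for each x separately. Since decompositions
    agree up to null sets, the Jordan parts belonging to X serve every x <= X, and one pair of
    measures suffices on [0, X[. *)
Lemma jordan_restr x X A : 0 < x -> x <= X -> (X%:E < b)%E ->
  measurable A -> A `<=` `[0, x[ ->
  jordan_pos (sm_hahn chi x) A = jordan_pos (sm_hahn chi X) A /\
  jordan_neg (sm_hahn chi x) A = jordan_neg (sm_hahn chi X) A.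
Proof.
move=> x0 xX Xb mA Ax.
have [EP EN] := Hahn_decomposition_uniq (sm_hahn chi x) (sm_hahn_restr x0 xX Xb) mA.
have AE D : A `&` D `&` `[0, x[%classic = A `&` D.
  by rewrite setIAC; congr (_ `&` _); exact/setIidl.
have RE D : sm_restr chi x (A `&` D) = sm_restr chi X (A `&` D).
  by rewrite (sm_restr_sub _ x0 xX Xb) AE.
rewrite !jordan_posE !jordan_negE !cjordan_posE !cjordan_negE /crestr0 mem_set //.
by rewrite /crestr EP EN; split; [exact: RE|congr (- _)%E; exact: RE].
Qed.

Definition chiI X (D : set T) f :=
  sI (jordan_pos (sm_hahn chi X)) (jordan_neg (sm_hahn chi X)) D f.

Lemma sm_integralE x X f : 0 <= x -> x <= X -> (X%:E < b)%E ->
  sm_integral chi x f = chiI X `[0, x[%classic f.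
Proof.
rewrite le_eqVlt => /predU1P[<- _ _|x0 xX Xb].
  by rewrite /sm_integral /chiI /sI set_itvco0 !Rintegral_set0.
rewrite /sm_integral /chiI /sI; congr (_ - _); congr fine;
  apply: eq_measure_integral => A mA Ax.
- by have [] := jordan_restr x0 xX Xb mA Ax.
- by have [] := jordan_restr x0 xX Xb mA Ax.
Qed.

Lemma sm_variationE X :
  sm_variation chi X = fine (jordan_pos (sm_hahn chi X) `[0, X[%classic)
    + fine (jordan_neg (sm_hahn chi X) `[0, X[%classic).
Proof.
rewrite /sm_variation /charge_variation /= fineD //.
- exact: fin_num_measure.
- exact: fin_num_measure.
Qed.

End HahnConsistency.

Section ComplexModulus.
Context {R : realType}.
Implicit Types z w : R[i].

Lemma cabs_ge0 z : 0 <= cabs z.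
Proof. by case: z => x y; exact: sqrtr_ge0. Qed.

Lemma cabs_sqr z : cabs z ^+ 2 = complex.Re z ^+ 2 + complex.Im z ^+ 2.
Proof. by case: z => x y /=; rewrite sqr_sqrtr // addr_ge0 ?sqr_ge0. Qed.

Lemma Re_le_cabs z : `|complex.Re z| <= cabs z.
Proof.
rewrite -(ler_pXn2r (n:=2)) ?nnegrE ?cabs_ge0 // cabs_sqr real_normK ?num_real //.
by rewrite lerDl sqr_ge0.
Qed.

Lemma Im_le_cabs z : `|complex.Im z| <= cabs z.
Proof.
rewrite -(ler_pXn2r (n:=2)) ?nnegrE ?cabs_ge0 // cabs_sqr real_normK ?num_real //.
by rewrite lerDr sqr_ge0.
Qed.

Lemma cabs_le_ReIm z : cabs z <= `|complex.Re z| + `|complex.Im z|.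
Proof.
rewrite -(ler_pXn2r (n:=2)) ?nnegrE ?cabs_ge0 ?addr_ge0 // cabs_sqr.
rewrite sqrrD !real_normK ?num_real // addrAC lerDl.
by rewrite mulrn_wge0 // mulr_ge0.
Qed.

Lemma cabsM z w : cabs (z * w) = cabs z * cabs w.
Proof. exact: Normc.normcM. Qed.

Lemma cabsN z : cabs (- z) = cabs z.
Proof. exact: normcN. Qed.

Lemma cabsD_le z w : cabs (z + w) <= cabs z + cabs w.
Proof. exact: le_normcD. Qed.

Lemma cabsB_le z w : cabs (z - w) <= cabs z + cabs w.
Proof. by rewrite -[cabs w]cabsN; exact: cabsD_le. Qed.

Lemma cabs_real (x : R) : cabs x%:C = `|x|.
Proof. by rewrite /cabs /= expr0n addr0 sqrtr_sqr. Qed.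

Lemma cabs0 : cabs (0 : R[i]) = 0.
Proof. exact: Normc.normc0. Qed.

Lemma cabs1 : cabs (1 : R[i]) = 1.
Proof. exact: Normc.normc1. Qed.

Lemma cabs_conj z : cabs (conjc z) = cabs z.
Proof. by case: z => x y; rewrite /cabs /= sqrrN. Qed.

Lemma cabs_eq0 z : (cabs z == 0) = (z == 0).
Proof.
by apply/eqP/eqP => [/Normc.eq0_normc|->]; rewrite ?cabs0.
Qed.

Lemma cabs_gt0 z : (0 < cabs z) = (z != 0).
Proof. by rewrite lt0r cabs_eq0 cabs_ge0 andbT. Qed.

End ComplexModulus.

Section DomainRepresentation.
Context {R : realType}.
Notation T := (measurableTypeR R).
Notation mu := (@lebesgue_measure R).

Lemma abscont_cont (X : R) g : abscont X g -> cont X g.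
Proof.
move=> ag; apply/subspace_continuousP => x /=; rewrite in_itv /= => /andP[x0 xX].
apply/cvgrPdist_lt => e /ag[d d0 hd].
rewrite near_withinE near_nbhs; exists d => //= y xy.
rewrite in_itv /= => /andP[y0 yX].
have [yx|xy'] := leP y x.
  have := hd [:: (y, x)]; rewrite /cvariation /clength !big_seq1 /=; apply => //.
  by apply: le_lt_trans xy; exact: ler_norm.
have := hd [:: (x, y)]; rewrite /cvariation /clength !big_seq1 /= distrC; apply.
  by split=> //; exact: ltW.
by apply: le_lt_trans xy; rewrite distrC; exact: ler_norm.
Qed.

Variables (b : \bar R) (chi : signed_measure b).

Lemma chiI0 X (f : R -> R) : chiI chi X `[0, 0[%classic f = 0.
Proof. by rewrite /chiI /sI set_itvco0 !Rintegral_set0 subrr. Qed.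

Notation jp := (fun X => jordan_pos (sm_hahn chi X)).
Notation jn := (fun X => jordan_neg (sm_hahn chi X)).

(** The fundamental theorem for the quasi-derivative gives the formula for [df] at every point, not
    merely almost everywhere. Thus [df] is bounded and measurable, and the theorem applies to [f] in
    turn. *)
Lemma Dtau_rep X (f df h : R -> R) : 0 < X -> (X%:E < b)%E ->
  abscont X f ->
  {ae mu, forall x, 0 < x < X -> is_derive x 1 f (df x)} ->
  abscont X (fun x => - df x + sm_integral chi x f) ->
  {ae mu, forall x, 0 < x < X ->
    is_derive x 1 (fun x => - df x + sm_integral chi x f) (h x)} ->
  mu.-integrable `[0, X[%classic (EFin \o h) ->
  rep (jp X) (jn X) X f df f h.
Proof.
move=> X0 Xb af f' aq q' hi.
have bf : bmeas X f by apply: cont_bmeas; exact: abscont_cont.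
have dfE x : 0 <= x <= X -> df x = df 0 + chiI chi X `[0, x[%classic f
                                      - \int[mu]_(t in `[0, x[) h t.
  move=> xX; have := abscont_FTC aq hi q' xX.
  case/andP: xX => x0 xX.
  rewrite (sm_integralE chi f x0 xX Xb) (sm_integralE chi f (lexx 0) (ltW X0) Xb) chiI0.
  by move=> E; lra.
have bdf : bmeas X df.
  pose e x := df 0 + (\int[jp X]_(y in `[0, x[) f y - \int[jn X]_(y in `[0, x[) f y)
    - \int[mu]_(t in `[0, x[) h t.
  apply: (@bmeas_eq _ _ _ e).
    by move=> x /andP[x0 xX]; rewrite dfE // x0 ltW.
  apply: bmeasB; last exact: bmeas_integral.
  apply: bmeasD; first exact: bmeas_cst.
  by apply: bmeasB; apply: bmeas_integral; exact: bmeas_fint.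
by split=> //; apply: abscont_FTC => //; exact: bmeas_lint.
Qed.

Notation Re := (@complex.Re R).
Notation Im := (@complex.Im R).
Implicit Types (f df g dg phi psi h k : R -> R[i]).

Definition csys f df phi h := forall X, 0 < X -> (X%:E < b)%E ->
  rep (jp X) (jn X) X (Re \o f) (Re \o df) (Re \o phi) (Re \o h) /\
  rep (jp X) (jn X) X (Im \o f) (Im \o df) (Im \o phi) (Im \o h).

Definition cloc_integrable h := forall X, 0 < X -> (X%:E < b)%E ->
  mu.-integrable `[0, X[%classic (EFin \o (Re \o h)) /\
  mu.-integrable `[0, X[%classic (EFin \o (Im \o h)).

Lemma Dtau_csys f df h : in_Dtau chi f df -> tau_eq chi f df h ->
  cloc_integrable h -> csys f df f h.
Proof.
move=> [af f' aq] q' hi X X0 Xb.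
have [hr him] := hi X X0 Xb.
have aeF := ae_filter_ringOfSetsType mu.
have sub x : 0 < x < X -> right_of 0 b x.
  move=> /andP[x0 xX]; split => //.
  by apply: lt_trans Xb; rewrite lte_fin.
split; apply: Dtau_rep => //.
- apply: (abs_continuous_abscont _ (af X X0 Xb)) => x y /=.
  by apply: le_trans (Re_le_cabs _); case: (f x) (f y) => ? ? [? ?].
- by apply: filterS f' => x H /sub/H[].
- apply: (abs_continuous_abscont _ (aq X X0 Xb)) => x y /=.
  apply: le_trans (Re_le_cabs _); rewrite /quasi_derivative /=.
  by case: (df x) (df y) => ? ? [? ?].
- apply: filterS q' => x H /sub/H[] /=.
  rewrite /quasi_derivative (_ : (fun y => _) = (fun x0 => - (Re \o df) x0 + sm_integral chi x0 (Re \o f))) //.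
  by apply/funext => y /=; case: (df y).
- apply: (abs_continuous_abscont _ (af X X0 Xb)) => x y /=.
  by apply: le_trans (Im_le_cabs _); case: (f x) (f y) => ? ? [? ?].
- by apply: filterS f' => x H /sub/H[].
- apply: (abs_continuous_abscont _ (aq X X0 Xb)) => x y /=.
  apply: le_trans (Im_le_cabs _); rewrite /quasi_derivative /=.
  by case: (df x) (df y) => ? ? [? ?].
- apply: filterS q' => x H /sub/H[_] /=.
  rewrite /quasi_derivative (_ : (fun y => Im _) = (fun x0 => - (Im \o df) x0 + sm_integral chi x0 (Im \o f))) //.
  by apply/funext => y /=; case: (df y).
Qed.

End DomainRepresentation.

Section ComplexParts.
Context {R : realType}.
Implicit Types z w : R[i].
Notation Re := (@complex.Re R).
Notation Im := (@complex.Im R).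

Lemma cReM z w : Re (z * w) = Re z * Re w - Im z * Im w.
Proof. by case: z w => ? ? [? ?]. Qed.

Lemma cImM z w : Im (z * w) = Re z * Im w + Im z * Re w.
Proof. by case: z w => ? ? [? ?]. Qed.

Lemma cReD z w : Re (z + w) = Re z + Re w.
Proof. by case: z w => ? ? [? ?]. Qed.

Lemma cImD z w : Im (z + w) = Im z + Im w.
Proof. by case: z w => ? ? [? ?]. Qed.

Lemma cReN z : Re (- z) = - Re z.
Proof. by case: z => ? ?. Qed.

Lemma cImN z : Im (- z) = - Im z.
Proof. by case: z => ? ?. Qed.

Lemma complex_ext z w : Re z = Re w -> Im z = Im w -> z = w.
Proof. by case: z w => ? ? [? ?] /= -> ->. Qed.

Lemma cReJ z : Re (conjc z) = Re z. Proof. by case: z. Qed.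
Lemma cImJ z : Im (conjc z) = - Im z. Proof. by case: z. Qed.

Definition partE := (cReM, cImM, cReD, cImD, cReN, cImN, cReJ, cImJ).

End ComplexParts.

(** * The Lagrange identity for complex-valued systems *)

Section ComplexLagrange.
Context {R : realType}.
Notation T := (measurableTypeR R).
Notation mu := (@lebesgue_measure R).
Variables (b : \bar R) (chi : signed_measure b).
Notation jp := (fun X => jordan_pos (sm_hahn chi X)).
Notation jn := (fun X => jordan_neg (sm_hahn chi X)).
Notation Re := (@complex.Re R).
Notation Im := (@complex.Im R).
Implicit Types (f df g dg phi psi h k : R -> R[i]).

Definition clI (x : R) (f : R -> R[i]) : R[i] :=
  (\int[mu]_(t in `[0, x[) Re (f t)) +i* (\int[mu]_(t in `[0, x[) Im (f t)).

Let sI4B (nu1 nu2 : {finite_measure set T -> \bar R}) x (p q r s : R -> R) :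
  bmeas x p -> bmeas x q -> bmeas x r -> bmeas x s ->
  sI nu1 nu2 `[0, x[%classic (fun y => p y - q y - (r y - s y)) =
  sI nu1 nu2 `[0, x[%classic p - sI nu1 nu2 `[0, x[%classic q
  - (sI nu1 nu2 `[0, x[%classic r - sI nu1 nu2 `[0, x[%classic s).
Proof. by move=> *; rewrite !sIB //; exact: bmeasB. Qed.

Let sI4D (nu1 nu2 : {finite_measure set T -> \bar R}) x (p q r s : R -> R) :
  bmeas x p -> bmeas x q -> bmeas x r -> bmeas x s ->
  sI nu1 nu2 `[0, x[%classic (fun y => p y + q y - (r y + s y)) =
  sI nu1 nu2 `[0, x[%classic p + sI nu1 nu2 `[0, x[%classic q
  - (sI nu1 nu2 `[0, x[%classic r + sI nu1 nu2 `[0, x[%classic s).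
Proof. by move=> *; rewrite sIB ?sID //; exact: bmeasD. Qed.

Let intg (x : R) (p : R -> R) := mu.-integrable `[0, x[%classic (EFin \o p).

Let intgD x p q : intg x p -> intg x q -> intg x (fun y => p y + q y).
Proof. exact: (@integrableD _ T R mu `[0, x[%classic (measurable_itv _) (EFin \o p) (EFin \o q)). Qed.

Let intgB x p q : intg x p -> intg x q -> intg x (fun y => p y - q y).
Proof. exact: (@integrableB _ T R mu `[0, x[%classic (measurable_itv _) (EFin \o p) (EFin \o q)). Qed.

Let lI4B x (p q r s : R -> R) : intg x p -> intg x q -> intg x r -> intg x s ->
  \int[mu]_(y in `[0, x[) (p y - q y - (r y - s y)) =
  \int[mu]_(y in `[0, x[) p y - \int[mu]_(y in `[0, x[) q y
  - (\int[mu]_(y in `[0, x[) r y - \int[mu]_(y in `[0, x[) s y).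
Proof.
move=> *; rewrite RintegralB //; [|exact: intgB..].
by rewrite RintegralB // RintegralB.
Qed.

Let lI4D x (p q r s : R -> R) : intg x p -> intg x q -> intg x r -> intg x s ->
  \int[mu]_(y in `[0, x[) (p y + q y - (r y + s y)) =
  \int[mu]_(y in `[0, x[) p y + \int[mu]_(y in `[0, x[) q y
  - (\int[mu]_(y in `[0, x[) r y + \int[mu]_(y in `[0, x[) s y).
Proof.
move=> *; rewrite RintegralB //; [|exact: intgD..].
by rewrite RintegralD // RintegralD.
Qed.

(** By bilinearity, from the four real instances for real and imaginary parts. *)
Lemma csys_lagrange f df phi h g dg psi k x :
  csys chi f df phi h -> csys chi g dg psi k -> 0 < x -> (x%:E < b)%E ->
  wronskian f df g dg x - wronskian f df g dg 0 =
  sm_cintegral chi x (fun y => f y * psi y - g y * phi y)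
  - clI x (fun y => f y * k y - g y * h y).
Proof.
move=> sf sg x0 xb.
have [fr fi] := sf x x0 xb; have [gr gi] := sg x x0 xb.
have bfr := rep_f fr; have bfi := rep_f fi.
have bgr := rep_f gr; have bgi := rep_f gi.
have [bphr ihr _ _] := fr; have [bphi ihi _ _] := fi.
have [bpsr ikr _ _] := gr; have [bpsi iki _ _] := gi.
have Lrr := rep_lagrange (ltW x0) fr gr.
have Lri := rep_lagrange (ltW x0) fr gi.
have Lir := rep_lagrange (ltW x0) fi gr.
have Lii := rep_lagrange (ltW x0) fi gi.
have E1 : sm_integral chi x (fun y => Re (f y * psi y - g y * phi y)) =
  sI (jp x) (jn x) `[0, x[%classic (fun y => Re (f y) * Re (psi y) - Im (f y) * Im (psi y)
    - (Re (g y) * Re (phi y) - Im (g y) * Im (phi y))).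
  by rewrite /sm_integral /sI; congr (_ - _); apply: eq_Rintegral => y _; rewrite !partE.
have E2 : sm_integral chi x (fun y => Im (f y * psi y - g y * phi y)) =
  sI (jp x) (jn x) `[0, x[%classic (fun y => Re (f y) * Im (psi y) + Im (f y) * Re (psi y)
    - (Re (g y) * Im (phi y) + Im (g y) * Re (phi y))).
  by rewrite /sm_integral /sI; congr (_ - _); apply: eq_Rintegral => y _; rewrite !partE.
have E3 : \int[mu]_(y in `[0, x[) Re (f y * k y - g y * h y) =
  \int[mu]_(y in `[0, x[) (Re (f y) * Re (k y) - Im (f y) * Im (k y)
    - (Re (g y) * Re (h y) - Im (g y) * Im (h y))).
  by apply: eq_Rintegral => y _; rewrite !partE.
have E4 : \int[mu]_(y in `[0, x[) Im (f y * k y - g y * h y) =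
  \int[mu]_(y in `[0, x[) (Re (f y) * Im (k y) + Im (f y) * Re (k y)
    - (Re (g y) * Im (h y) + Im (g y) * Re (h y))).
  by apply: eq_Rintegral => y _; rewrite !partE.
apply: complex_ext; rewrite /wronskian !partE /sm_cintegral /clI /=.
- rewrite E1 E3 sI4B; [|exact: bmeasM..].
  rewrite lI4B; [|exact: bmeas_mul_integrable..].
  have /= H := congr2 (fun p q => p - q) Lrr Lii.
  by apply: etrans (etrans _ H) _; ring.
- rewrite E2 E4 sI4D; [|exact: bmeasM..].
  rewrite lI4D; [|exact: bmeas_mul_integrable..].
  have /= H := congr2 (fun p q => p + q) Lri Lir.
  by apply: etrans (etrans _ H) _; ring.
Qed.

End ComplexLagrange.

(** * Square-integrable solutions *)

Section RepLinear.
Context {R : realType}.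
Notation T := (measurableTypeR R).
Notation mu := (@lebesgue_measure R).
Variables mu1 mu2 : {finite_measure set T -> \bar R}.

Lemma repD X f df phi h g dg psi k :
  rep mu1 mu2 X f df phi h -> rep mu1 mu2 X g dg psi k ->
  rep mu1 mu2 X (fun x => f x + g x) (fun x => df x + dg x)
    (fun x => phi x + psi x) (fun x => h x + k x).
Proof.
move=> rf rg; have bdf := rep_df rf; have bdg := rep_df rg.
case: rf => bphi hi dfE fE; case: rg => bpsi ki dgE gE.
have subi x F : 0 <= x <= X -> mu.-integrable `[0, X[%classic (EFin \o F) ->
    mu.-integrable `[0, x[%classic (EFin \o F).
  by move=> /andP[x0 xX]; apply: integrable_itvS => //; exact: subset_bcoo.
split.
- exact: bmeasD.
- exact: (@integrableD _ T R mu `[0, X[%classic (measurable_itv _) (EFin \o h) (EFin \o k)).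
- move=> x xX; have [x0 xX'] := andP xX.
  rewrite dfE // dgE // RintegralD //; [|exact: subi..].
  rewrite sID; [|exact: bmeasS bphi|exact: bmeasS bpsi].
  by ring.
- move=> x xX; rewrite fE // gE // RintegralD //; first by ring.
  + by apply: subi => //; exact: bmeas_lint.
  + by apply: subi => //; exact: bmeas_lint.
Qed.

Lemma repZ X c f df phi h : rep mu1 mu2 X f df phi h ->
  rep mu1 mu2 X (fun x => c * f x) (fun x => c * df x)
    (fun x => c * phi x) (fun x => c * h x).
Proof.
move=> rf; have bdf := rep_df rf.
case: rf => bphi hi dfE fE.
have subi x F : 0 <= x <= X -> mu.-integrable `[0, X[%classic (EFin \o F) ->
    mu.-integrable `[0, x[%classic (EFin \o F).
  by move=> /andP[x0 xX]; apply: integrable_itvS => //; exact: subset_bcoo.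
split.
- by apply: bmeasM => //; exact: bmeas_cst.
- exact: (bmeas_mul_integrable (bmeas_cst X c) hi).
- move=> x xX; have [x0 xX'] := andP xX.
  rewrite dfE // RintegralZl //; last exact: subi.
  rewrite sIZ; last exact: bmeasS bphi.
  by ring.
- move=> x xX; rewrite fE // RintegralZl //; first by ring.
  by apply: subi => //; exact: bmeas_lint.
Qed.

Lemma rep_ext X f df phi h f' df' phi' h' : f =1 f' -> df =1 df' ->
  phi =1 phi' -> h =1 h' -> rep mu1 mu2 X f df phi h -> rep mu1 mu2 X f' df' phi' h'.
Proof. by move=> /funext <- /funext <- /funext <- /funext <-. Qed.

End RepLinear.

Section ComplexLinear.
Context {R : realType}.
Notation T := (measurableTypeR R).
Notation mu := (@lebesgue_measure R).
Variables (b : \bar R) (chi : signed_measure b).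
Notation Re := (@complex.Re R).
Notation Im := (@complex.Im R).
Implicit Types (f df g dg phi psi h k : R -> R[i]).

Lemma csysD f df phi h g dg psi k :
  csys chi f df phi h -> csys chi g dg psi k ->
  csys chi (fun x => f x + g x) (fun x => df x + dg x)
    (fun x => phi x + psi x) (fun x => h x + k x).
Proof.
move=> sf sg X X0 Xb; have [fr fi] := sf X X0 Xb; have [gr gi] := sg X X0 Xb.
split.
- by apply: rep_ext (repD fr gr) => x /=; rewrite cReD.
- by apply: rep_ext (repD fi gi) => x /=; rewrite cImD.
Qed.

Lemma csysZ (c : R[i]) f df phi h : csys chi f df phi h ->
  csys chi (fun x => c * f x) (fun x => c * df x)
    (fun x => c * phi x) (fun x => c * h x).
Proof.
move=> sf X X0 Xb; have [fr fi] := sf X X0 Xb; split.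
- by apply: rep_ext (repD (repZ (Re c) fr) (repZ (- Im c) fi)) => x /=;
    rewrite !partE; ring.
- by apply: rep_ext (repD (repZ (Re c) fi) (repZ (Im c) fr)) => x /=;
    rewrite !partE; ring.
Qed.

Lemma csysJ f df phi h : csys chi f df phi h ->
  csys chi (conjc \o f) (conjc \o df) (conjc \o phi) (conjc \o h).
Proof.
move=> sf X X0 Xb; have [fr fi] := sf X X0 Xb; split.
- by apply: rep_ext fr => x /=; rewrite cReJ.
- by apply: rep_ext (repZ (- 1) fi) => x /=; rewrite cImJ; ring.
Qed.

Lemma csys_ext f df phi h f' df' phi' h' : f =1 f' -> df =1 df' ->
  phi =1 phi' -> h =1 h' -> csys chi f df phi h -> csys chi f' df' phi' h'.
Proof. by move=> /funext <- /funext <- /funext <- /funext <-. Qed.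

Lemma sm_cintegral0 x : sm_cintegral chi x (fun=> 0) = 0.
Proof.
have E : sm_integral chi x (fun=> 0) = 0.
  by rewrite /sm_integral !Rintegral_cst // !mul0r subrr.
by apply: complex_ext.
Qed.

(** Here phi = f and psi = g, so the chi-integrand f g - g f vanishes and only Lebesgue integrals
    remain. *)
Lemma csys_lagrange_self f df h g dg k x :
  csys chi f df f h -> csys chi g dg g k -> 0 < x -> (x%:E < b)%E ->
  wronskian f df g dg x - wronskian f df g dg 0 =
  - clI x (fun y => f y * k y - g y * h y).
Proof.
move=> sf sg x0 xb; rewrite (csys_lagrange sf sg x0 xb).
rewrite (_ : (fun y => f y * g y - g y * f y) = fun=> 0) ?sm_cintegral0 ?add0r //.
by apply/funext => y; rewrite mulrC subrr.
Qed.

End ComplexLinear.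

Lemma le_half {R : realFieldType} (p g : R) : 2 * p <= g -> p <= 2^-1 * g.
Proof. by lra. Qed.

Section SquareIntegrable.
Context {R : realType}.
Notation T := (measurableTypeR R).
Notation mu := (@lebesgue_measure R).
Variables (b : \bar R).
Notation Re := (@complex.Re R).
Notation Im := (@complex.Im R).
Implicit Types (f g h : R -> R[i]).

Lemma ereal_between (x : R) (c : \bar R) : (x%:E < b)%E -> (c < b)%E ->
  exists y : R, [/\ x < y, (c < y%:E)%E & (y%:E < b)%E].
Proof.
move=> xb cb.
case: c cb => [c| |] cb; last first.
- case: b xb {cb} => [r| |] //; rewrite ?lte_fin => xr.
    exists ((x + r) / 2); rewrite lte_fin ltNyr; split => //; lra.
  by exists (x + 1); rewrite ltry ltNyr; split => //; lra.
- by move: cb; rewrite ltNge leey.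
case: b xb cb => [r| |] //; rewrite ?lte_fin => xr cr.
  have mr : Num.max x c < r by rewrite gt_max xr cr.
  have mx : x <= Num.max x c by rewrite le_max lexx.
  have mc : c <= Num.max x c by rewrite le_max lexx orbT.
  by exists ((Num.max x c + r) / 2); rewrite !lte_fin; split; lra.
have mx : x <= Num.max x c by rewrite le_max lexx.
have mc : c <= Num.max x c by rewrite le_max lexx orbT.
by exists (Num.max x c + 1); rewrite !lte_fin ltry; split => //; lra.
Qed.

Definition sqmod f (t : R) : R := cabs (f t) ^+ 2.
Definition nsq f (x : R) : R := \int[mu]_(t in `[0, x[) sqmod f t.

Definition loc_sq f := forall X, 0 < X -> (X%:E < b)%E ->
  [/\ measurable_fun (`[0, X[%classic : set T) (Re \o f),
      measurable_fun (`[0, X[%classic : set T) (Im \o f) &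
      mu.-integrable `[0, X[%classic (EFin \o sqmod f)].

(** Square integrability up to [b] in terms of partial integrals, because the Lagrange identity only
    sees intervals [0, x[ with x < b. *)
Definition bnd_sq f := exists M, forall x, 0 < x -> (x%:E < b)%E -> nsq f x <= M.

Lemma sqmod_ge0 f t : 0 <= sqmod f t. Proof. exact: sqr_ge0. Qed.

Lemma csys_loc_sq (chi : signed_measure b) f df phi h : csys chi f df phi h -> loc_sq f.
Proof.
move=> sf X X0 Xb; have [fr fi] := sf X X0 Xb.
have bfr := rep_f fr; have bfi := rep_f fi; split.
- by case: bfr.
- by case: bfi.
apply: bmeas_lint; apply: (@bmeas_eq _ _ _ (fun t => Re (f t) * Re (f t) + Im (f t) * Im (f t))).
  by move=> t _; rewrite /sqmod cabs_sqr !expr2.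
by apply: bmeasD; apply: bmeasM.
Qed.

Lemma Rintegral_subset (D E : set T) (f : R -> R) : measurable D -> measurable E ->
  D `<=` E -> mu.-integrable E (EFin \o f) -> (forall t, 0 <= f t) ->
  \int[mu]_(t in D) f t <= \int[mu]_(t in E) f t.
Proof.
move=> mD mE DE fi f0; have fD := integrableS mE mD DE fi.
apply: fine_le; [exact: integrable_fin_num..|].
apply: ge0_subset_integral => //; first by case/integrableP: fi.
by move=> t _; rewrite lee_fin.
Qed.

Lemma nsq_ge0 f x : 0 <= nsq f x.
Proof. by apply: Rintegral_ge0 => t _; exact: sqmod_ge0. Qed.

Lemma nsq_mono f x y : loc_sq f -> 0 <= x -> x <= y -> 0 < y -> (y%:E < b)%E ->
  nsq f x <= nsq f y.
Proof.
move=> lf x0 xy y0 yb; have [_ _ fi] := lf y y0 yb.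
by apply: Rintegral_subset => // [|t]; [exact: subset_bcoo|exact: sqmod_ge0].
Qed.

Lemma nsqB f x y : loc_sq f -> 0 <= x -> x <= y -> 0 < y -> (y%:E < b)%E ->
  nsq f y - nsq f x = \int[mu]_(t in `[x, y[) sqmod f t.
Proof.
move=> lf x0 xy y0 yb; have [_ _ fi] := lf y y0 yb.
by rewrite /nsq (Rintegral_split x0 xy fi) addrC addKr.
Qed.

Lemma loc_sqJ f : loc_sq f -> loc_sq (conjc \o f).
Proof.
move=> lf X X0 Xb; have [mr mi fi] := lf X X0 Xb; split.
- by rewrite (_ : _ \o _ = Re \o f) //; apply/funext => t /=; rewrite cReJ.
- rewrite (_ : _ \o _ = fun t => - (Im \o f) t); first exact: measurableT_comp.
  by apply/funext => t /=; rewrite cImJ.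
- rewrite (_ : sqmod _ = sqmod f) //; apply/funext => t.
  by rewrite /sqmod /= cabs_conj.
Qed.

Lemma nsqJ f x : nsq (conjc \o f) x = nsq f x.
Proof. by apply: eq_Rintegral => t _; rewrite /sqmod /= cabs_conj. Qed.

Lemma bnd_sqJ f : bnd_sq f -> bnd_sq (conjc \o f).
Proof. by move=> [M hM]; exists M => x x0 xb; rewrite nsqJ; exact: hM. Qed.

Lemma sqmodZ (c : R[i]) f t : sqmod (fun y => c * f y) t = cabs c ^+ 2 * sqmod f t.
Proof. by rewrite /sqmod cabsM exprMn. Qed.

Lemma loc_sqZ (c : R[i]) f : loc_sq f -> loc_sq (fun y => c * f y).
Proof.
move=> lf X X0 Xb; have [mr mi fi] := lf X X0 Xb; split.
- rewrite (_ : _ \o _ = fun t => Re c * (Re \o f) t - Im c * (Im \o f) t).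
    by apply: measurable_funB; exact: measurable_funM.
  by apply/funext => t; exact: cReM.
- rewrite (_ : _ \o _ = fun t => Re c * (Im \o f) t + Im c * (Re \o f) t).
    by apply: measurable_funD; exact: measurable_funM.
  by apply/funext => t; exact: cImM.
- rewrite (_ : sqmod _ = fun t => cabs c ^+ 2 * sqmod f t); last first.
    by apply/funext => t; rewrite sqmodZ.
  exact: (bmeas_mul_integrable (bmeas_cst X _) fi).
Qed.

Lemma nsqZ (c : R[i]) f x : loc_sq f -> 0 < x -> (x%:E < b)%E ->
  nsq (fun y => c * f y) x = cabs c ^+ 2 * nsq f x.
Proof.
move=> lf x0 xb; have [_ _ fi] := lf x x0 xb.
by rewrite /nsq -RintegralZl //; apply: eq_Rintegral => t _; rewrite sqmodZ.
Qed.

Lemma bnd_sqZ (c : R[i]) f : loc_sq f -> bnd_sq f -> bnd_sq (fun y => c * f y).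
Proof.
move=> lf [M hM]; exists (cabs c ^+ 2 * M) => x x0 xb; rewrite nsqZ //.
by apply: ler_wpM2l; [exact: sqr_ge0|exact: hM].
Qed.

(** The partial integrals are monotone and bounded, and [c] is a point where they come within [e] of
    their supremum. *)
Lemma nsq_tail f x1 e : loc_sq f -> bnd_sq f -> 0 < e -> 0 < x1 -> (x1%:E < b)%E ->
  exists c, [/\ x1 <= c, (c%:E < b)%E &
    forall x, c <= x -> (x%:E < b)%E -> nsq f x - nsq f c <= e].
Proof.
move=> lf [M hM] e0 x10 x1b.
pose S := [set nsq f x | x in [set x | x1 <= x /\ (x%:E < b)%E]].
have hS : has_sup S.
  split; first by exists (nsq f x1); exists x1.
  by exists M => _ [x [x1x xb] <-]; apply: hM => //; exact: lt_le_trans x1x.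
have [_ [c [x1c cb] <-] hc] := sup_adherent e0 hS.
exists c; split => // x cx xb.
have : nsq f x <= sup S.
  apply: ub_le_sup; first exact: hS.2.
  by exists x => //; split => //; exact: le_trans cx.
by lra.
Qed.

(** A substitute for the Cauchy-Schwarz inequality: the weight [l] stays free and is later chosen to
    balance the two terms. *)
Lemma cabsM_amgm (l : R) z w : 0 < l ->
  2 * cabs (z * w) <= l * cabs z ^+ 2 + cabs w ^+ 2 / l.
Proof.
move=> l0; rewrite cabsM -subr_ge0.
have -> : l * cabs z ^+ 2 + cabs w ^+ 2 / l - 2 * (cabs z * cabs w) =
  l * (cabs z - cabs w / l) ^+ 2.
  by field; rewrite gt_eqF.
by rewrite mulr_ge0 ?sqr_ge0 // ltW.
Qed.

(** The factor 2 pays for estimating real and imaginary part separately, each by half of [G]. *)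
Lemma clI_bound f (G : R -> R) c x : cloc_integrable b f -> 0 <= c -> c <= x -> 0 < x ->
  (x%:E < b)%E -> mu.-integrable `[0, x[%classic (EFin \o G) ->
  (forall t, c <= t < x -> 2 * cabs (f t) <= G t) ->
  cabs (clI x f - clI c f) <= \int[mu]_(t in `[c, x[) G t.
Proof.
move=> ff c0 cx x0 xb Gi fG; have [fr fi] := ff x x0 xb.
have sub F : mu.-integrable `[0, x[%classic (EFin \o F) ->
    mu.-integrable `[c, x[%classic (EFin \o F).
  by apply: integrable_itvS => //; exact: subset_bcoo.
have -> : clI x f - clI c f = (\int[mu]_(t in `[c, x[) Re (f t))
    +i* (\int[mu]_(t in `[c, x[) Im (f t)).
  apply: complex_ext; rewrite !partE /clI /=.
    by rewrite (Rintegral_split c0 cx fr) addrAC subrr add0r.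
  by rewrite (Rintegral_split c0 cx fi) addrAC subrr add0r.
apply: (le_trans (cabs_le_ReIm _)) => /=.
have G2 : \int[mu]_(t in `[c, x[) G t =
    \int[mu]_(t in `[c, x[) (2^-1 * G t) + \int[mu]_(t in `[c, x[) (2^-1 * G t).
  rewrite RintegralZl //; last exact: sub.
  by field.
rewrite G2; have Gi2 : mu.-integrable `[c, x[%classic (EFin \o (fun t => 2^-1 * G t)).
  by apply: sub; exact: (bmeas_mul_integrable (bmeas_cst x _) Gi).
apply: lerD; apply: Rintegral_norm_le => //; try exact: sub.
  move=> t /=; rewrite in_itv /= => /fG H.
  exact: (le_trans (Re_le_cabs _) (le_half H)).
move=> t /=; rewrite in_itv /= => /fG H.
exact: (le_trans (Im_le_cabs _) (le_half H)).
Qed.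

Lemma loc_sqM f g : loc_sq f -> loc_sq g -> cloc_integrable b (fun t => f t * g t).
Proof.
move=> lf lg X X0 Xb; have [mr mi fi] := lf X X0 Xb; have [nr ni gi] := lg X X0 Xb.
have fgi := @integrableD _ T R mu `[0, X[%classic (measurable_itv _) (EFin \o sqmod f) (EFin \o sqmod g) fi gi.
have key t : cabs (f t * g t) <= sqmod f t + sqmod g t.
  have := @cabsM_amgm 1 (f t) (g t) ltr01; rewrite mul1r divr1.
  have := sqmod_ge0 f t; have := sqmod_ge0 g t; have := cabs_ge0 (f t * g t).
  rewrite /sqmod.
  by move: (cabs (f t * g t)) (cabs (f t) ^+ 2) (cabs (g t) ^+ 2) => p q r; lra.
split; apply: (le_integrable _ _ _ fgi) => //.
- apply/measurable_EFinP; rewrite (_ : _ \o _ = fun t =>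
    (Re \o f) t * (Re \o g) t - (Im \o f) t * (Im \o g) t).
    by apply: measurable_funB; exact: measurable_funM.
  by apply/funext => t; exact: cReM.
- move=> t _; change (`|Re (f t * g t)|%:E <= `|sqmod f t + sqmod g t|%:E)%E.
  rewrite lee_fin [leRHS]ger0_norm ?addr_ge0 ?sqmod_ge0 //.
  exact: (le_trans (Re_le_cabs _)).
- apply/measurable_EFinP; rewrite (_ : _ \o _ = fun t =>
    (Re \o f) t * (Im \o g) t + (Im \o f) t * (Re \o g) t).
    by apply: measurable_funD; exact: measurable_funM.
  by apply/funext => t; exact: cImM.
- move=> t _; change (`|Im (f t * g t)|%:E <= `|sqmod f t + sqmod g t|%:E)%E.
  rewrite lee_fin [leRHS]ger0_norm ?addr_ge0 ?sqmod_ge0 //.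
  exact: (le_trans (Im_le_cabs _)).
Qed.

Lemma clI_cross f g l c x : loc_sq f -> loc_sq g -> 0 < l -> 0 <= c -> c <= x ->
  0 < x -> (x%:E < b)%E ->
  cabs (clI x (fun t => f t * g t) - clI c (fun t => f t * g t)) <=
  l * (nsq f x - nsq f c) + (nsq g x - nsq g c) / l.
Proof.
move=> lf lg l0 c0 cx x0 xb; have [_ _ fi] := lf x x0 xb; have [_ _ gi] := lg x x0 xb.
have fli : mu.-integrable `[0, x[%classic (EFin \o (fun t => l * sqmod f t)).
  exact: (bmeas_mul_integrable (bmeas_cst x l) fi).
have gli : mu.-integrable `[0, x[%classic (EFin \o (fun t => l^-1 * sqmod g t)).
  exact: (bmeas_mul_integrable (bmeas_cst x l^-1) gi).
have sub F : mu.-integrable `[0, x[%classic (EFin \o F) ->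
    mu.-integrable `[c, x[%classic (EFin \o F).
  by apply: integrable_itvS => //; exact: subset_bcoo.
have -> : l * (nsq f x - nsq f c) + (nsq g x - nsq g c) / l =
    \int[mu]_(t in `[c, x[) (l * sqmod f t + l^-1 * sqmod g t).
  rewrite RintegralD //; [|exact: sub..].
  rewrite !RintegralZl //; [|exact: sub..].
  by rewrite !nsqB // [_ / l]mulrC.
apply: clI_bound => //; first exact: loc_sqM.
  exact: (@integrableD _ T R mu `[0, x[%classic (measurable_itv _)
    (EFin \o (fun t => l * sqmod f t)) (EFin \o (fun t => l^-1 * sqmod g t))).
move=> t _; rewrite [l^-1 * _]mulrC; exact: cabsM_amgm.
Qed.

End SquareIntegrable.

Section SquareIntegrableEnd.
Context {R : realType}.
Notation T := (measurableTypeR R).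
Notation mu := (@lebesgue_measure R).
Variables (b : \bar R).
Notation Re := (@complex.Re R).
Notation Im := (@complex.Im R).
Implicit Types (f g h : R -> R[i]).

(** Supplies the sequence for monotone convergence, for finite and infinite [b] alike. *)
Lemma end_exhaustion : (0 < b)%E -> exists y : nat -> R,
  [/\ forall n, 0 < y n /\ ((y n)%:E < b)%E,
      {homo y : m n / (m <= n)%N >-> m <= n} &
      forall x, (x%:E < b)%E -> exists n, x < y n].
Proof.
case: b => [r| |] //; rewrite ?lte_fin => r0.
  (* The denominators start at 2, so that [y 0] is positive. *)
  exists (fun n => r - r / n.+2%:R); split.
  - move=> n; split.
      rewrite subr_gt0 ltr_pdivrMr ?ltr0n // ltr_pMr //.
      by rewrite ltr1n.
    by rewrite lte_fin gtrDl oppr_lt0 divr_gt0 // ltr0n.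
  - move=> m n mn; rewrite lerB // ler_pM2l // lef_pV2 ?posrE ?ltr0n //.
    by rewrite ler_nat !ltnS.
  move=> x; rewrite lte_fin => xr.
  have rx0 : 0 < r - x by rewrite subr_gt0.
  exists (Num.bound (r / (r - x))).
  have := archi_boundP (ltW (divr_gt0 r0 rx0)).
  set n := Num.bound _ => H.
  rewrite ltrBrDr -ltrBrDl ltr_pdivrMr ?ltr0n // mulrC -ltr_pdivrMr //.
  by apply: (lt_le_trans H); rewrite ler_nat leqW.
exists (fun n => n.+1%:R); split.
- by move=> n; rewrite ltr0n ltry.
- by move=> m n mn; rewrite ler_nat ltnS.
move=> x _; exists (Num.bound `|x|).
apply: (le_lt_trans (ler_norm x)); apply: (lt_le_trans (archi_boundP (normr_ge0 x))).
by rewrite ler_nat.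
Qed.

Lemma measurable_right_of c : measurable (right_of c b : set T).
Proof.
rewrite /right_of; case: b => [r| |].
- rewrite (_ : mkset _ = `]c, r[%classic); first exact: measurable_itv.
  apply/seteqP; split=> x /=; rewrite in_itv /= lte_fin; first by move=> [-> ->].
  by move=> /andP[-> ->].
- rewrite (_ : mkset _ = `]c, +oo[%classic); first exact: measurable_itv.
  apply/seteqP; split=> x /=; rewrite in_itv /= ltry andbT; first by case.
  by move=> ->.
- rewrite (_ : mkset _ = set0); first exact: measurable0.
  by apply/seteqP; split=> x //= [].
Qed.

Lemma right_of_sub c X : (X%:E < b)%E -> `]c, X[ `<=` right_of c b.
Proof.
move=> Xb x /=; rewrite in_itv /= => /andP[cx xX]; split => //.
by apply: lt_trans Xb; rewrite lte_fin.
Qed.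

Lemma L2_loc_sq f : L2 0 b f -> loc_sq b f.
Proof.
move=> [mr mi fi] X X0 Xb.
have sub := right_of_sub (c := 0) Xb.
have mR := measurable_right_of 0.
have mco (g : R -> R) : measurable_fun (right_of 0 b : set T) g ->
    measurable_fun (`[0, X[%classic : set T) g.
  move=> mg; apply/measurable_fun_itv_obnd_cbndP.
  exact: (measurable_funS _ sub mg).
split; [exact: mco|exact: mco|].
have [/measurable_EFinP mf foo] := integrableP _ _ _ fi.
apply/integrableP; split; first by apply/measurable_EFinP; exact: mco.
rewrite -integral_itv_obnd_cbnd; last first.
  apply: measurableT_comp => //; apply/measurable_EFinP.
  exact: (measurable_funS _ sub mf).
apply: le_lt_trans foo; apply: ge0_subset_integral => //.
by apply: measurableT_comp => //; apply/measurable_EFinP.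
Qed.

Lemma L2_bnd_sq c f : loc_sq b f -> 0 <= c -> (c%:E < b)%E -> L2 c b f ->
  bnd_sq b f.
Proof.
move=> lf c0 cb [_ _ fi].
exists (nsq f c + \int[mu]_(t in right_of c b) sqmod f t) => x x0 xb.
have mR := measurable_right_of c.
have J0 : 0 <= \int[mu]_(t in right_of c b) sqmod f t.
  by apply: Rintegral_ge0 => t _; exact: sqmod_ge0.
have [cx|xc] := leP c x; last first.
  apply: le_trans (nsq_mono lf (ltW x0) (ltW xc) (lt_trans x0 xc) cb) _.
  by rewrite lerDl.
rewrite -lerBlDl (nsqB lf) //.
have sub := right_of_sub (c := c) xb.
rewrite -Rintegral_itv_obnd_cbnd.
  by apply: Rintegral_subset => // t; exact: sqmod_ge0.
exact: integrableS fi.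
Qed.

(** Monotone convergence along an exhausting sequence; needed to return to [limit_circle], which is
    stated with [L2_near_end]. *)
Lemma bnd_sq_L2 f : (0 < b)%E -> loc_sq b f -> bnd_sq b f -> L2_near_end b f.
Proof.
move=> b0 lf [M hM]; have [y [yb yn yx]] := end_exhaustion b0.
exists (y 0%N); have [y0 y0b] := yb 0%N; split => //.
pose F n : set T := `]y 0%N, y n[%classic.
have FE : right_of (y 0%N) b = \bigcup_n F n.
  apply/seteqP; split=> [x [yx0 /yx[n xn]]|x [n _]] /=.
    by exists n => //; rewrite /F /= in_itv /= yx0.
  by apply: right_of_sub; case: (yb n).
have mF n : measurable (F n) by exact: measurable_itv.
have sub n : F n `<=` `[0, y n[.
  by move=> x /=; rewrite /F /= !in_itv /= => /andP[/ltW/(le_trans (ltW y0)) -> ->].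
have mU (g : R -> R) : (forall X, 0 < X -> (X%:E < b)%E ->
    measurable_fun (`[0, X[%classic : set T) g) ->
    measurable_fun (right_of (y 0%N) b : set T) g.
  move=> mg; rewrite FE; apply/measurable_fun_bigcup => // n.
  have [yn0 ynb] := yb n.
  exact: (measurable_funS _ (sub n) (mg _ yn0 ynb)).
have msq : measurable_fun (right_of (y 0%N) b : set T) (sqmod f).
  by apply: mU => X X0 Xb; have [_ _ /integrableP[/measurable_EFinP]] := lf X X0 Xb.
split.
- by apply: mU => X X0 Xb; have [] := lf X X0 Xb.
- by apply: mU => X X0 Xb; have [] := lf X X0 Xb.
apply/integrableP; split; first exact/measurable_EFinP.
have -> : (\int[mu]_(x in right_of (y 0%N) b) `|(cabs (f x) ^+ 2)%:E| =
    \int[mu]_(x in right_of (y 0%N) b) (sqmod f x)%:E)%E.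
  by apply: eq_integral => x _; rewrite /= ger0_norm ?sqr_ge0.
rewrite FE.
have mFn n : measurable_fun (F n) (EFin \o sqmod f).
  have [yn0 ynb] := yb n; have [_ _ /integrableP[mm _]] := lf _ yn0 ynb.
  exact: (measurable_funS _ (sub n) mm).
have ndF : nondecreasing_seq F.
  move=> m n mn; apply/subsetPset => x; rewrite /F /= !in_itv /= => /andP[-> xm].
  by rewrite (lt_le_trans xm (yn _ _ mn)).
have f0 n x : F n x -> (0 <= (EFin \o sqmod f) x)%E.
  by move=> _; rewrite lee_fin sqmod_ge0.
have cv := ge0_nondecreasing_set_cvg_integral (mu := mu) ndF mF mFn f0.
apply: (@le_lt_trans _ _ M%:E); last exact: ltry.
rewrite -(cvg_lim _ cv) //.
apply: lime_le; first by apply/cvg_ex; eexists; exact: cv.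
apply: nearW => n; have [yn0 ynb] := yb n.
have [_ _ fi] := lf _ yn0 ynb.
have fF : mu.-integrable (F n) (EFin \o sqmod f).
  exact: integrable_itvS (mF n) (sub n) fi.
rewrite -[X in (X <= _)%E]fineK; last exact: integrable_fin_num.
rewrite lee_fin; apply: le_trans (hM _ yn0 ynb).
by apply: Rintegral_subset => // t; exact: sqmod_ge0.
Qed.

End SquareIntegrableEnd.

(** * Weyl's alternative and the sign of the flux at the end *)

Section RealHelpers.
Context {R : realType}.

(** The supremum S is finite by the first hypothesis and satisfies S <= C + S / 2 by the second; the
    crude bound [N0] leaves no trace. *)
Lemma bound_improve (I : Type) (P : I -> Prop) (f : I -> R) (C N0 : R) :
  (forall i, P i -> f i <= N0) ->
  (forall N, (forall i, P i -> f i <= N) -> forall i, P i -> f i <= C + N / 2) ->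
  forall i, P i -> f i <= 2 * C.
Proof.
move=> fN imp i0 Pi0; pose S := [set f i | i in [set i | P i]].
have hS : has_sup S.
  by split; [exists (f i0); exists i0|exists N0 => _ [i Pi <-]; exact: fN].
have fS i : P i -> f i <= sup S.
  by move=> Pi; apply: ub_le_sup; [exact: hS.2|exists i].
have : sup S <= C + sup S / 2.
  by apply: ge_sup; [exact: hS.1|move=> _ [i Pi <-]; exact: imp fS _ Pi].
by have := fS _ Pi0; lra.
Qed.

(** Read S as int |s|^2 up to x, [Wn] and [w] as |W(conj u, s)| at x and at c, [a] as a lower bound
    for minus the flux of u, y as Im z, D as |z - conj z| and d^2 as a bound for the tail of int
    |u|^2. Then [Wn] grows at most like 2 D d sqrt(S), but its square at least like 4 a y S; (p +
    q)^2 <= 2 p^2 + 2 q^2 absorbs the former. *)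
Lemma limit_point_bound (a y S w D d Wn : R) : 0 < a -> 0 < y -> 0 <= S -> 0 <= Wn ->
  8 * (D ^+ 2 * d ^+ 2) <= 2 * (a * y) ->
  Wn <= w + 2 * (D * d * Num.sqrt S) -> 1 + 4 * (a * y * S) <= Wn ^+ 2 ->
  S <= w ^+ 2 / (a * y).
Proof.
move=> a0 y0 S0 Wn0 Dd WnS SW.
have ay : 0 < a * y by rewrite mulr_gt0.
rewrite ler_pdivlMr //.
set t := Num.sqrt S in WnS; have tS : t ^+ 2 = S by rewrite sqr_sqrtr.
have W2 : Wn ^+ 2 <= (w + 2 * (D * d * t)) ^+ 2.
  by rewrite ler_pXn2r ?nnegrE // (le_trans Wn0).
have amgm : (w + 2 * (D * d * t)) ^+ 2 <= 2 * w ^+ 2 + 8 * (D ^+ 2 * d ^+ 2) * S.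
  rewrite -tS -subr_ge0.
  have -> : 2 * w ^+ 2 + 8 * (D ^+ 2 * d ^+ 2) * t ^+ 2 - (w + 2 * (D * d * t)) ^+ 2
    = (w - 2 * (D * d * t)) ^+ 2 by ring.
  exact: sqr_ge0.
have H : 8 * (D ^+ 2 * d ^+ 2) * S <= 2 * (a * y) * S by rewrite ler_wpM2r.
have E1 := le_trans SW (le_trans W2 amgm).
have E2 : S * (a * y) = a * y * S by ring.
have E3 : 2 * (a * y) * S = 2 * (a * y * S) by ring.
rewrite E2; rewrite E3 in H.
move: H E1; move: (8 * _ * S) (a * y * S) (w ^+ 2) => p q r; lra.
Qed.

(* In the limit-circle case: [a] bounds [|W(u, u^* )|] from below, [y] is
   [|W(u, w)|], [e] bounds [|W(u, w^* )|] and [|W(w, w^* )|], and [M] bounds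
   the other Wronskians. *)
Lemma limit_circle_contradiction (M a l : R) : 0 < M -> 0 < a -> 0 < l ->
  exists2 e, 0 < e & forall y, 0 <= y -> y ^+ 2 <= e ^+ 2 + M * e ->
    a * (l / 2) <= e * M + M * y -> False.
Proof.
move=> M0 a0 l0; pose n := a * l / (2 * M).
have n0 : 0 < n by rewrite divr_gt0 ?mulr_gt0.
(* The last hypothesis amounts to n <= e + y, whereas these bounds give e <= n / 2 and y^2 <= (1 +
   M) e <= (n / 4)^2. *)
pose e := Num.min (Num.min 1 (n / 2)) (n ^+ 2 / (16 * (1 + M))).
have e0 : 0 < e by rewrite !lt_min ltr01 divr_gt0 //= divr_gt0 ?exprn_gt0 // mulr_gt0 // addr_gt0.
have e1 : e <= 1 by rewrite /e !ge_min lexx.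
have en : e <= n / 2 by rewrite /e !ge_min lexx orbT.
have en2 : e <= n ^+ 2 / (16 * (1 + M)) by rewrite /e !ge_min lexx !orbT.
exists e => // y y0 yE H.
have {}en2 : e * (1 + M) <= (n / 4) ^+ 2.
  move: en2; rewrite ler_pdivlMr ?mulr_gt0 // ?addr_gt0 // => en2.
  have -> : (n / 4) ^+ 2 = n ^+ 2 / 16 by field.
  rewrite ler_pdivlMr //; apply: le_trans en2.
  by rewrite le_eqVlt; apply/orP; left; apply/eqP; ring.
have ee : e ^+ 2 <= e by rewrite expr2 ger_pMr.
have yn : y <= n / 4.
  have n4 : 0 <= n / 4 by rewrite divr_ge0 // ltW.
  rewrite -(ler_pXn2r (n := 2)) ?nnegrE //.
  apply: (le_trans yE); apply: le_trans en2; rewrite mulrDr mulr1 [M * e]mulrC.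
  by rewrite lerD2r.
have nM : n * M = a * (l / 2).
  by rewrite /n; field; rewrite gt_eqF.
have : M * n <= M * (e + y) by rewrite mulrC nM mulrDr [M * e]mulrC.
rewrite ler_pM2l //; lra.
Qed.

End RealHelpers.

Section WronskianAlgebra.
Context {R : realType}.
Notation Re := (@complex.Re R).
Notation Im := (@complex.Im R).
Implicit Types (u du s ds w dw h dh : R[i]).

(** The relation [plucker] for u, s and their conjugates, since W(u, conj u) = - 2 i Im(u' conj
    u). *)
Lemma plucker_norm u du s ds :
  cabs (conjc u * ds - conjc du * s) ^+ 2 =
  cabs (u * ds - du * s) ^+ 2 + 4 * (Im (du * conjc u) * Im (ds * conjc s)).
Proof. by rewrite !cabs_sqr !partE; ring. Qed.

(** The quadratic relation between the six minors of a 2 by 4 matrix. *)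
Lemma plucker u du w dw h dh v dv :
  (u * dw - du * w) * (h * dv - dh * v) + (u * dh - du * h) * (v * dw - dv * w)
  + (u * dv - du * v) * (w * dh - dw * h) = 0.
Proof. by ring. Qed.

Lemma cabs_wronskian_conj u du :
  cabs (u * conjc du - du * conjc u) = 2 * `|Im (du * conjc u)|.
Proof.
have -> : u * conjc du - du * conjc u = 0 +i* (- (2 * Im (du * conjc u))).
  by apply: complex_ext; rewrite !partE /=; ring.
by rewrite /cabs /= expr0n add0r sqrtr_sqr normrN normrM ger0_norm.
Qed.

Lemma conjcB_wronskian u du w dw :
  cabs (conjc u * conjc dw - conjc du * conjc w) = cabs (u * dw - du * w).
Proof. by rewrite -[RHS]cabs_conj rmorphB !rmorphM. Qed.

End WronskianAlgebra.

Lemma half_solve {R : realFieldType} (p q r : R) :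
  - (2 * p) + 2 * q = 2 * r -> p = q - r.
Proof. by lra. Qed.

(** * Energy identity and the limit-point case *)

Section Weyl.
Context {R : realType}.
Notation T := (measurableTypeR R).
Notation mu := (@lebesgue_measure R).
Variables (b : \bar R) (chi : signed_measure b).
Notation Re := (@complex.Re R).
Notation Im := (@complex.Im R).
Implicit Types (f df g dg u du v dv s ds w dw h dh hh k : R -> R[i]) (z : R[i]).

Definition eigen z u du := csys chi u du u (fun y => z * u y).

(** W(u, conj u) is - 2 i times this quantity; at 0 it is Im m when u 0 = 1 and u' 0 = m. *)
Definition flux u du (x : R) : R := Im (du x * conjc (u x)).

Lemma clI_eq (x : R) f g : (forall y, f y = g y) -> clI x f = clI x g.
Proof. by move=> /funext ->. Qed.

(** The Lagrange identity for u and conj u, with z - conj z = 2 i Im z. For Im z > 0 the flux is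
    nonincreasing, so a negative value persists up to [b]. *)
Lemma energy z u du x : eigen z u du -> 0 < x -> (x%:E < b)%E ->
  flux u du x = flux u du 0 - Im z * nsq u x.
Proof.
move=> su x0 xb; have [_ _ ui] := csys_loc_sq su x0 xb.
have L := congr1 Im (csys_lagrange_self su (csysJ su) x0 xb).
have E1 : Im (wronskian u du (conjc \o u) (conjc \o du) x
    - wronskian u du (conjc \o u) (conjc \o du) 0) =
    - (2 * flux u du x) + 2 * flux u du 0.
  by rewrite /wronskian /flux /= !partE; ring.
have E2 F : (forall y, Im (F y) = - (2 * Im z) * sqmod u y) ->
    Im (- clI x F) = 2 * (Im z * nsq u x).
  move=> FE; rewrite cImN /clI /=.
  under eq_Rintegral do rewrite FE.
  by rewrite RintegralZl // -/(nsq u x); ring.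
rewrite E1 E2 in L; last first.
  by move=> y; rewrite /sqmod cabs_sqr /= !partE; ring.
exact: half_solve L.
Qed.

Lemma wronskian_eigen z u du s ds x : eigen z u du -> eigen z s ds ->
  0 < x -> (x%:E < b)%E ->
  wronskian u du s ds x = wronskian u du s ds 0.
Proof.
move=> su ss x0 xb; apply/eqP; rewrite -subr_eq0 (csys_lagrange_self su ss x0 xb).
rewrite (@clI_eq x _ (fun=> 0)); last by move=> y; ring.
rewrite /clI /= Rintegral_cst // mul0r.
by apply/eqP/complex_ext => /=; rewrite oppr0.
Qed.

Lemma csys_bounded f df phi h x : csys chi f df phi h -> 0 < x -> (x%:E < b)%E ->
  exists N, forall y, 0 <= y <= x -> cabs (f y) <= N /\ cabs (df y) <= N.
Proof.
move=> sf x0 xb; have [X [xX _ Xb]] := ereal_between xb xb.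
have [fr fi] := sf X (lt_trans x0 xX) Xb.
have [_ [N1 h1]] := rep_f fr; have [_ [N2 h2]] := rep_f fi.
have [_ [N3 h3]] := rep_df fr; have [_ [N4 h4]] := rep_df fi.
exists (Num.max (N1 + N2) (N3 + N4)) => y /andP[y0 yx].
have yX : 0 <= y < X by rewrite y0 (le_lt_trans yx).
split; rewrite le_max.
  by rewrite (le_trans (cabs_le_ReIm _)) // lerD //; [exact: h1|exact: h2].
rewrite [X in _ || X](le_trans (cabs_le_ReIm _)) ?orbT // lerD //; [exact: h3|exact: h4].
Qed.

Lemma clI_increment f df h g dg k c x :
  csys chi f df f h -> csys chi g dg g k -> 0 < c -> c <= x -> (x%:E < b)%E ->
  wronskian f df g dg x - wronskian f df g dg c =
  - (clI x (fun y => f y * k y - g y * h y) - clI c (fun y => f y * k y - g y * h y)).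
Proof.
move=> sf sg c0 cx xb; have x0 := lt_le_trans c0 cx.
have cb : (c%:E < b)%E by apply: le_lt_trans xb; rewrite lee_fin.
have := csys_lagrange_self sf sg x0 xb; have := csys_lagrange_self sf sg c0 cb.
move: (clI x _) (clI c _) (wronskian _ _ _ _ x) (wronskian _ _ _ _ c)
  (wronskian _ _ _ _ 0) => p q r t o H1 H2.
have -> : r - t = (r - o) - (t - o) by ring.
by rewrite H1 H2; ring.
Qed.

(** The Lagrange identity over [0, x[, with both integrals bounded by [clI_cross] at weight 1. *)
Lemma wronskian_bounded f df h g dg k :
  csys chi f df f h -> csys chi g dg g k ->
  loc_sq b h -> loc_sq b k -> bnd_sq b f -> bnd_sq b g -> bnd_sq b h -> bnd_sq b k ->
  exists M, forall x, 0 < x -> (x%:E < b)%E -> cabs (wronskian f df g dg x) <= M.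
Proof.
move=> sf sg lh lk [Mf hf] [Mg hg] [Mh hh] [Mk hk].
have lf := csys_loc_sq sf; have lg := csys_loc_sq sg.
exists (cabs (wronskian f df g dg 0) + ((Mf + Mk) + (Mg + Mh))) => x x0 xb.
have := csys_lagrange_self sf sg x0 xb; move=> /(canRL (subrK _)) ->.
rewrite addrC; apply: (le_trans (cabsD_le _ _)); rewrite lerD2l cabsN.
have cl0 F : clI 0 F = 0.
  by rewrite /clI set_itvco0 !Rintegral_set0.
have n0 F : nsq F 0 = 0 by rewrite /nsq set_itvco0 Rintegral_set0.
have -> : clI x (fun y => f y * k y - g y * h y) =
    clI x (fun y => f y * k y) - clI x (fun y => g y * h y).
  have [r1 i1] := loc_sqM lf lk x0 xb; have [r2 i2] := loc_sqM lg lh x0 xb.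
  apply: complex_ext; rewrite !partE /clI /= -RintegralB //;
    by apply: eq_Rintegral => y _; rewrite !partE; ring.
apply: (le_trans (cabsB_le _ _)); apply: lerD.
- have := @clI_cross _ b f k 1 0 x lf lk ltr01 (lexx 0) (ltW x0) x0 xb.
  rewrite cl0 !n0 !subr0 mul1r divr1 => /le_trans; apply.
  by apply: lerD; [exact: hf|exact: hk].
- have := @clI_cross _ b g h 1 0 x lg lh ltr01 (lexx 0) (ltW x0) x0 xb.
  rewrite cl0 !n0 !subr0 mul1r divr1 => /le_trans; apply.
  by apply: lerD; [exact: hg|exact: hh].
Qed.

(* If the flux of [u] were negative at [x1], then [|W(u^*, s)|^2] would grow like
   [int_0^x |s|^2], whereas Cauchy-Schwarz makes it negligible against it. *)
Lemma limit_point_flux z u du s ds : 0 < Im z ->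
  eigen z u du -> eigen z s ds -> s 0 = 0 -> wronskian u du s ds 0 = 1 ->
  bnd_sq b u -> ~ bnd_sq b s ->
  forall x, 0 < x -> (x%:E < b)%E -> 0 <= flux u du x.
Proof.
move=> z0 su ss s0 W0 bu nbs x1 x10 x1b; rewrite leNgt; apply/negP => a0.
apply: nbs; set a := - flux u du x1; have {}a0 : 0 < a by rewrite oppr_gt0.
have lu := csys_loc_sq su; have ls := csys_loc_sq ss.
pose D := cabs (z - conjc z).
have D0 : 0 < D.
  rewrite cabs_gt0; apply/eqP => /(congr1 Im); rewrite !partE /= opprK => E.
  by move: z0; rewrite -[Im z](@mulKf _ 2) ?pnatr_eq0 // mulr2n mulrDl mul1r E mulr0 ltxx.
(* Chosen so that 8 D^2 d^2 = 2 a Im z, as [limit_point_bound] requires. *)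
pose d2 := a * Im z / (4 * D ^+ 2).
have d20 : 0 < d2 by rewrite divr_gt0 ?mulr_gt0 ?exprn_gt0.
pose d := Num.sqrt d2; have d0 : 0 < d by rewrite sqrtr_gt0.
have dE : d ^+ 2 = d2 by rewrite sqr_sqrtr // ltW.
have [c [x1c cb hc]] := nsq_tail lu bu d20 x10 x1b.
have c0 := lt_le_trans x10 x1c.
pose w := cabs (wronskian (conjc \o u) (conjc \o du) s ds c).
exists (Num.max (nsq s c) (w ^+ 2 / (a * Im z))) => x x0 xb.
rewrite le_max; have [xc|/ltW cx] := leP x c.
  by rewrite (nsq_mono ls (ltW x0) xc c0 cb).
apply/orP; right.
have nsx := nsq_ge0 s x.
have flx : flux u du x <= - a.
  rewrite /a opprK (energy su x0 xb) (energy su x10 x1b) lerD2l lerN2.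
  by rewrite ler_pM2l // (nsq_mono lu (ltW x10) (le_trans x1c cx)).
have fls : flux s ds x = - (Im z * nsq s x).
  by rewrite (energy ss x0 xb) /flux s0 rmorph0 mulr0 /= sub0r.
have Wx := wronskian_eigen su ss x0 xb.
have PN := plucker_norm (u x) (du x) (s x) (ds x).
rewrite -/(flux u du x) -/(flux s ds x) fls in PN.
have W1 : u x * ds x - du x * s x = 1 by rewrite -W0 -Wx.
rewrite W1 cabs1 expr1n in PN.
apply: (@limit_point_bound R a (Im z) (nsq s x) w D d
  (cabs (wronskian (conjc \o u) (conjc \o du) s ds x))) => //.
- exact: cabs_ge0.
- rewrite dE /d2 le_eqVlt; apply/orP; left; apply/eqP.
  by field; rewrite gt_eqF.
- have := nsx; rewrite le_eqVlt => /predU1P[S0|S0].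
    (* when [nsq s x = 0] every weight in [clI_cross] works *)
    have inc := clI_increment (csysJ su) ss c0 cx xb.
    have E : cabs (wronskian (conjc \o u) (conjc \o du) s ds x
        - wronskian (conjc \o u) (conjc \o du) s ds c) <= 0.
      apply/ler_addgt0Pl => e e0; rewrite addr0 inc cabsN.
      rewrite (@clI_eq x _ (fun y => (conjc \o u) y * ((z - conjc z) * s y))); last first.
        by move=> y /=; rewrite rmorphM /=; ring.
      rewrite (@clI_eq c _ (fun y => (conjc \o u) y * ((z - conjc z) * s y))); last first.
        by move=> y /=; rewrite rmorphM /=; ring.
      have ed : 0 < e / d2 by rewrite divr_gt0.
      apply: (le_trans (clI_cross (loc_sqJ lu) (loc_sqZ _ ls) ed (ltW c0) cx x0 xb)).
      rewrite !nsqJ !(nsqZ _ ls) // -S0.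
      have sc : nsq s c = 0.
        by apply/eqP; rewrite eq_le nsq_ge0 andbT S0 (nsq_mono ls (ltW c0)).
      rewrite sc mulr0 subr0 mul0r addr0 mulrAC ler_pdivrMr // ler_pM2l //.
      exact: hc.
    have {}E : wronskian (conjc \o u) (conjc \o du) s ds x
        = wronskian (conjc \o u) (conjc \o du) s ds c.
      by apply/eqP; rewrite -subr_eq0 -cabs_eq0 eq_le E cabs_ge0.
    by rewrite E -S0 sqrtr0 !mulr0 addr0.
  have inc := clI_increment (csysJ su) ss c0 cx xb.
  rewrite -[wronskian _ _ _ _ x](subrK (wronskian (conjc \o u) (conjc \o du) s ds c)).
  rewrite addrC; apply: (le_trans (cabsD_le _ _)); rewrite lerD2l inc cabsN.
  rewrite (@clI_eq x _ (fun y => (conjc \o u) y * ((z - conjc z) * s y))); last first.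
    by move=> y /=; rewrite rmorphM /=; ring.
  rewrite (@clI_eq c _ (fun y => (conjc \o u) y * ((z - conjc z) * s y))); last first.
    by move=> y /=; rewrite rmorphM /=; ring.
  pose t := Num.sqrt (nsq s x).
  have t0 : 0 < t by rewrite sqrtr_gt0.
  have tE : t ^+ 2 = nsq s x by rewrite sqr_sqrtr // ltW.
  (* This weight makes both terms of [clI_cross] equal to D d t, as in Cauchy-Schwarz. *)
  have l0 : 0 < D * t / d by rewrite divr_gt0 ?mulr_gt0.
  apply: (le_trans (clI_cross (loc_sqJ lu) (loc_sqZ _ ls) l0 (ltW c0) cx x0 xb)).
  rewrite !nsqJ !(nsqZ _ ls) // -/D -/t.
  have -> : 2 * (D * d * t) = D * t / d * d2 + D ^+ 2 * nsq s x / (D * t / d).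
    by rewrite -dE -tE; field; rewrite !gt_eqF.
  apply: lerD; first by rewrite ler_pM2l //; exact: hc.
  rewrite ler_pM2r ?invr_gt0 // gerBl mulr_ge0 ?sqr_ge0 //.
  exact: nsq_ge0.
- rewrite PN lerD2l ler_pM2l // mulrN -mulNr -mulrA.
  rewrite ler_wpM2r //; first by rewrite mulr_ge0 // ltW.
  by rewrite lerNr.
Qed.

End Weyl.

Lemma half_le_of_dist_lt {R : realFieldType} (p q r : R) : p < q / 2 -> q <= r + p -> q / 2 <= r.
Proof. by lra. Qed.

(** * Weyl's alternative and the limit-circle case *)

Section WeylAlternative.
Context {R : realType}.
Notation T := (measurableTypeR R).
Notation mu := (@lebesgue_measure R).
Variables (b : \bar R) (chi : signed_measure b).
Notation Re := (@complex.Re R).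
Notation Im := (@complex.Im R).
Implicit Types (f df g dg u du v dv s ds w dw h dh hh k : R -> R[i]) (z : R[i]).

(** Up to sign, the increment is the integral of (z - z') v s by the Lagrange identity; the constant
    3 comes from 2 (|u| + |s|) |s| <= 3 (|u|^2 + |s|^2). *)
Lemma wronskian_increment_le z z' v dv s ds u c x N :
  eigen chi z s ds -> eigen chi z' v dv -> loc_sq b u ->
  0 < c -> c <= x -> (x%:E < b)%E -> 0 <= N ->
  (forall y, c <= y <= x -> cabs (v y) <= (cabs (u y) + cabs (s y)) * N) ->
  cabs (wronskian v dv s ds x - wronskian v dv s ds c) <=
  3 * (cabs (z - z') * N) * ((nsq u x - nsq u c) + (nsq s x - nsq s c)).
Proof.
move=> ss sv lu c0 cx xb N0 vN.
have x0 := lt_le_trans c0 cx.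
have ls := csys_loc_sq ss; have lv := csys_loc_sq sv.
rewrite (clI_increment sv ss c0 cx xb) cabsN.
have FE y : v y * (z * s y) - s y * (z' * v y) = v y * ((z - z') * s y) by ring.
rewrite (clI_eq x FE) (clI_eq c FE).
have [_ _ ui] := lu x x0 xb; have [_ _ si] := ls x x0 xb.
pose K := 3 * (cabs (z - z') * N).
have K0 : 0 <= K by rewrite !mulr_ge0 ?cabs_ge0.
have usi : mu.-integrable `[0, x[%classic (EFin \o (fun t => sqmod u t + sqmod s t)).
  exact: (@integrableD _ T R mu `[0, x[%classic (measurable_itv _)
    (EFin \o sqmod u) (EFin \o sqmod s)).
have sub F : mu.-integrable `[0, x[%classic (EFin \o F) ->
    mu.-integrable `[c, x[%classic (EFin \o F).
  by apply: integrable_itvS => //; apply: subset_bcoo => //; exact: ltW.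
have -> : K * ((nsq u x - nsq u c) + (nsq s x - nsq s c)) =
    \int[mu]_(t in `[c, x[) (K * (sqmod u t + sqmod s t)).
  rewrite RintegralZl //; last exact: sub.
  rewrite RintegralD //; [|exact: sub..].
  by rewrite (nsqB lu (ltW c0) cx x0 xb) (nsqB ls (ltW c0) cx x0 xb).
apply: (@clI_bound _ b) => //.
- by apply: loc_sqM => //; exact: loc_sqZ.
- exact: ltW.
- exact: (bmeas_mul_integrable (bmeas_cst x K) usi).
move=> t /andP[ct tx]; rewrite !cabsM /K /sqmod.
have := vN t; rewrite ct (ltW tx) => /(_ isT).
have := cabs_ge0 (u t); have := cabs_ge0 (s t); have := cabs_ge0 (z - z').
have := cabs_ge0 (v t).
move: (cabs (v t)) (cabs (z - z')) (cabs (s t)) (cabs (u t)) => p D q r p0 D0 q0 r0 H.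
apply: (@le_trans _ _ (2 * (((r + q) * N) * (D * q)))).
  by rewrite ler_pM2l // ler_wpM2r // mulr_ge0.
rewrite -subr_ge0.
have -> : 3 * (D * N) * (r ^+ 2 + q ^+ 2) - 2 * ((r + q) * N * (D * q)) =
  D * N * ((r - q) ^+ 2 + 2 * r ^+ 2) by ring.
by rewrite mulr_ge0 ?mulr_ge0 // addr_ge0 ?sqr_ge0 // mulr_ge0 ?sqr_ge0.
Qed.

(* Variation of constants: if [W(u, s) = 1] then [v = u W(v, s) - s W(v, u)]. *)
Lemma weyl_alternative z z' u du s ds v dv : (0 < b)%E ->
  eigen chi z u du -> eigen chi z s ds -> eigen chi z' v dv ->
  wronskian u du s ds 0 = 1 -> bnd_sq b u -> bnd_sq b s -> bnd_sq b v.
Proof.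
move=> b0 su ss sv W0 bu bs.
have lu := csys_loc_sq su; have ls := csys_loc_sq ss; have lv := csys_loc_sq sv.
have [x1 [x10 _ x1b]] := ereal_between b0 b0.
pose D := cabs (z - z'); have D0 : 0 <= D := cabs_ge0 _.
(* With the tails of u and s at most [e], the increments of the two Wronskians in [F] add up to at
   most 12 D N e <= N / 2. *)
pose e := (24 * (D + 1))^-1.
have e0 : 0 < e by rewrite invr_gt0 mulr_gt0 // ltr_wpDl.
have [c1 [x1c1 c1b hc1]] := nsq_tail lu bu e0 x10 x1b.
have c10 := lt_le_trans x10 x1c1.
have [c [c1c cb hc]] := nsq_tail ls bs e0 c10 c1b.
have c0 := lt_le_trans c10 c1c.
have tu x : c <= x -> (x%:E < b)%E -> nsq u x - nsq u c <= e.
  move=> cx xb; apply: le_trans (hc1 x (le_trans c1c cx) xb).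
  by rewrite lerD2l lerN2 (nsq_mono lu (ltW c10)).
pose F y := cabs (wronskian v dv s ds y) + cabs (wronskian v dv u du y).
have vF y : 0 < y -> (y%:E < b)%E -> cabs (v y) <= (cabs (u y) + cabs (s y)) * F y.
  move=> y0 yb.
  have Wy : u y * ds y - du y * s y = 1.
    by rewrite -W0 -(wronskian_eigen su ss y0 yb).
  have -> : v y = u y * wronskian v dv s ds y - s y * wronskian v dv u du y.
    rewrite -[LHS]mulr1 -Wy /wronskian; ring.
  apply: (le_trans (cabsB_le _ _)); rewrite !cabsM mulrDl.
  apply: lerD; apply: ler_wpM2l; rewrite ?cabs_ge0 //.
    by rewrite lerDl cabs_ge0.
  by rewrite lerDr cabs_ge0.
have FC x : c <= x -> (x%:E < b)%E -> F x <= 2 * F c.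
  move=> cx xb.
  have x0 := lt_le_trans c0 cx.
  have [N1 hu] := csys_bounded su x0 xb; have [N2 hs] := csys_bounded ss x0 xb.
  have [N3 hv] := csys_bounded sv x0 xb.
  (* The a priori bound comes from boundedness on [0, x] and depends on x; the improved bound 2 F c
     does not. *)
  apply: (@bound_improve R R (fun y => c <= y <= x) F (F c)
    (2 * (N3 * N2) + 2 * (N3 * N1))).
  - move=> y /andP[cy yx]; have y0 := le_trans (ltW c0) cy.
    have yI : 0 <= y <= x by rewrite y0.
    have [u1 u2] := hu y yI; have [s1 s2] := hs y yI; have [v1 v2] := hv y yI.
    have K (p q r t : R[i]) (M N : R) : cabs p <= M -> cabs q <= M -> cabs r <= N ->
        cabs t <= N -> cabs (p * t - q * r) <= 2 * (M * N).
      move=> pM qM rN tN; apply: (le_trans (cabsB_le _ _)); rewrite !cabsM.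
      by rewrite mulr_natl mulr2n; apply: lerD; apply: ler_pM; rewrite ?cabs_ge0.
    by rewrite /F /wronskian; apply: lerD; apply: K.
  - move=> N hN y /andP[cy yx].
    have yb : (y%:E < b)%E by apply: le_lt_trans xb; rewrite lee_fin.
    have N0 : 0 <= N.
      apply: le_trans (hN y _); last by rewrite cy yx.
      by rewrite addr_ge0 ?cabs_ge0.
    have vN t : c <= t <= y -> cabs (v t) <= (cabs (u t) + cabs (s t)) * N.
      move=> /andP[ct ty]; have t0 := lt_le_trans c0 ct.
      have tb : (t%:E < b)%E by apply: le_lt_trans yb; rewrite lee_fin.
      apply: (le_trans (vF t t0 tb)); apply: ler_wpM2l.
        by rewrite addr_ge0 ?cabs_ge0.
      by apply: hN; rewrite ct (le_trans ty).
    have vN' t : c <= t <= y -> cabs (v t) <= (cabs (s t) + cabs (u t)) * N.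
      by rewrite addrC; exact: vN.
    have I1 := wronskian_increment_le ss sv lu c0 cy yb N0 vN.
    have I2 := wronskian_increment_le su sv ls c0 cy yb N0 vN'.
    have T1 := tu y cy yb; have T2 := hc y cy yb.
    have A1 : cabs (wronskian v dv s ds y) <= cabs (wronskian v dv s ds c) +
        3 * (D * N) * ((nsq u y - nsq u c) + (nsq s y - nsq s c)).
      rewrite -[X in cabs X](subrK (wronskian v dv s ds c)) addrC.
      by apply: (le_trans (cabsD_le _ _)); rewrite lerD2l.
    have A2 : cabs (wronskian v dv u du y) <= cabs (wronskian v dv u du c) +
        3 * (D * N) * ((nsq s y - nsq s c) + (nsq u y - nsq u c)).
      rewrite -[X in cabs X](subrK (wronskian v dv u du c)) addrC.
      by apply: (le_trans (cabsD_le _ _)); rewrite lerD2l.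
    rewrite /F; apply: (le_trans (lerD A1 A2)).
    rewrite addrACA lerD2l [X in _ * X + _]addrC -mulrDl -mulrDr.
    apply: (@le_trans _ _ (3 * (D * N + D * N) * (e + e))).
      by apply: ler_wpM2l; [rewrite mulr_ge0 // addr_ge0 // mulr_ge0|exact: lerD].
    have -> : 3 * (D * N + D * N) * (e + e) = N / 2 * (D / (D + 1)).
      by rewrite /e; field; rewrite gt_eqF // ltr_wpDl.
    apply: ler_piMr; first by rewrite divr_ge0.
    by rewrite ler_pdivrMr ?ltr_wpDl // mul1r lerDl.
  - by rewrite cx lexx.
exists (nsq v c + 2 * (2 * F c) ^+ 2 * (e + e)) => x x0 xb.
have Fc0 : 0 <= F c by rewrite addr_ge0 ?cabs_ge0.
have [xc|/ltW cx] := leP x c.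
  apply: (le_trans (nsq_mono lv (ltW x0) xc c0 cb)); rewrite lerDl.
  by rewrite mulr_ge0 ?addr_ge0 ?(ltW e0) // mulr_ge0 ?sqr_ge0.
rewrite -lerBlDl (nsqB lv (ltW c0) cx x0 xb).
have [_ _ ui] := lu x x0 xb; have [_ _ si] := ls x x0 xb; have [_ _ vi] := lv x x0 xb.
set K := 2 * (2 * F c) ^+ 2.
have K0 : 0 <= K by rewrite mulr_ge0 ?sqr_ge0.
have usi : mu.-integrable `[0, x[%classic (EFin \o (fun t => sqmod u t + sqmod s t)).
  exact: (@integrableD _ T R mu `[0, x[%classic (measurable_itv _)
    (EFin \o sqmod u) (EFin \o sqmod s)).
have sub G : mu.-integrable `[0, x[%classic (EFin \o G) ->
    mu.-integrable `[c, x[%classic (EFin \o G).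
  by apply: integrable_itvS => //; apply: subset_bcoo => //; exact: ltW.
apply: (@le_trans _ _ (\int[mu]_(t in `[c, x[) (K * (sqmod u t + sqmod s t)))).
  apply: le_Rintegral => //; [exact: sub| |].
    by apply: sub; exact: (bmeas_mul_integrable (bmeas_cst x K) usi).
  move=> t /=; rewrite in_itv /= => /andP[ct tx].
  have t0 := lt_le_trans c0 ct.
  have tb : (t%:E < b)%E by apply: lt_trans xb; rewrite lte_fin.
  have H1 := vF t t0 tb; have H2 := FC t ct tb.
  rewrite /K /sqmod; move: (cabs_ge0 (u t)) (cabs_ge0 (s t)) (cabs_ge0 (v t)) H1 H2.
  move: (cabs (u t)) (cabs (s t)) (cabs (v t)) (F t) => p q r m p0 q0 r0 H1 H2.
  have {}H1 : r <= (p + q) * (2 * F c).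
    by apply: (le_trans H1); apply: ler_wpM2l => //; rewrite addr_ge0.
  apply: (@le_trans _ _ (((p + q) * (2 * F c)) ^+ 2)).
    by rewrite ler_pXn2r ?nnegrE // (le_trans r0).
  rewrite -subr_ge0.
  have -> : 2 * (2 * F c) ^+ 2 * (p ^+ 2 + q ^+ 2) - ((p + q) * (2 * F c)) ^+ 2 =
    (2 * F c) ^+ 2 * (p - q) ^+ 2 by ring.
  by rewrite mulr_ge0 ?sqr_ge0.
rewrite RintegralZl //; last exact: sub.
apply: ler_wpM2l => //.
rewrite RintegralD //; [|exact: sub..].
rewrite -(nsqB lu (ltW c0) cx x0 xb) -(nsqB ls (ltW c0) cx x0 xb).
by apply: lerD; [exact: tu|exact: hc].
Qed.

Lemma wronskian_conj_end_near f df g dg l e :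
  wronskian_conj_end b f df g dg l -> 0 < e ->
  exists2 c : \bar R, (c < b)%E & forall x : R, (c < x%:E)%E -> (x%:E < b)%E ->
    cabs (wronskian f df (conjc \o g) (conjc \o dg) x - l) < e.
Proof.
move=> H e0.
have := H (ball (0 : R) e) (nbhsx_ballx _ _ e0) => -[c cb hc].
exists c%:E => // x cx xb; have := hc x.
rewrite /ball /= sub0r normrN ger0_norm ?cabs_ge0 //; apply.
by split=> //; rewrite -lte_fin.
Qed.

(** Near [b], W(u, conj w) and W(w, conj w) are small and all Wronskians of u, conj u and h are
    bounded, so [plucker_norm] makes W(u, w) small. The relation [plucker] for u, conj u, conj w and
    h then bounds W(u, conj u) W(conj w, h) by small terms, while the second factor stays above |l|
    / 2 in modulus. A negative flux, which cannot recover, contradicts this. *)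
Lemma limit_circle_flux z u du w dw h dh hh l : 0 < Im z ->
  eigen chi z u du -> bnd_sq b u ->
  csys chi h dh h hh -> loc_sq b hh -> bnd_sq b h -> bnd_sq b hh ->
  wronskian_conj_end b u du w dw 0 -> wronskian_conj_end b w dw w dw 0 ->
  wronskian_conj_end b h dh w dw l -> l != 0 ->
  forall x, 0 < x -> (x%:E < b)%E -> 0 <= flux u du x.
Proof.
move=> z0 su bu sh lhh bh bhh Wu Ww Wh l0 x1 x10 x1b; rewrite leNgt; apply/negP => a0.
have lu := csys_loc_sq su; have lh := csys_loc_sq sh.
have lzu := loc_sqZ z lu; have bzu := bnd_sqZ z lu bu.
have [M1 hM1] := wronskian_bounded su sh lzu lhh bu bh bzu bhh.
have [M2 hM2] := wronskian_bounded sh (csysJ su) lhh (loc_sqJ lzu) bh (bnd_sqJ bu)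
  bhh (bnd_sqJ bzu).
have [M3 hM3] := wronskian_bounded su (csysJ su) lzu (loc_sqJ lzu) bu (bnd_sqJ bu)
  bzu (bnd_sqJ bzu).
pose M := Num.max 1 (Num.max M1 (Num.max M2 M3)).
have M0 : 0 < M by rewrite lt_max ltr01.
pose a := - flux u du x1; have {}a0 : 0 < a by rewrite oppr_gt0.
have L0 : 0 < cabs l by rewrite cabs_gt0.
have [e e0 He] := limit_circle_contradiction M0 a0 L0.
have L2 : 0 < cabs l / 2 by rewrite divr_gt0.
have [c1 c1b hc1] := wronskian_conj_end_near Wu e0.
have [c2 c2b hc2] := wronskian_conj_end_near Ww e0.
have [c3 c3b hc3] := wronskian_conj_end_near Wh L2.
have [y1 [x1y1 c1y1 y1b]] := ereal_between x1b c1b.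
have [y2 [y1y2 c2y2 y2b]] := ereal_between y1b c2b.
have [x [y2x c3x xb]] := ereal_between y2b c3b.
have y1x := lt_trans y1y2 y2x; have x1x := lt_trans x1y1 y1x.
have x0 := lt_trans x10 x1x.
have := hc1 x (lt_trans c1y1 _) xb; rewrite lte_fin subr0 => /(_ y1x)/ltW H1.
have := hc2 x (lt_trans c2y2 _) xb; rewrite lte_fin subr0 => /(_ y2x)/ltW H2.
have H3 := hc3 x c3x xb.
have flx : flux u du x <= - a.
  rewrite /a opprK (energy su x0 xb) (energy su x10 x1b) lerD2l lerN2.
  by rewrite ler_pM2l // (nsq_mono lu (ltW x10) (ltW x1x)).
have {}hM1 : cabs (wronskian u du h dh x) <= M.
  by rewrite (le_trans (hM1 x x0 xb)) // !le_max lexx !orbT.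
have {}hM2 : cabs (wronskian h dh (conjc \o u) (conjc \o du) x) <= M.
  by rewrite (le_trans (hM2 x x0 xb)) // !le_max lexx !orbT.
have {}hM3 : cabs (wronskian u du (conjc \o u) (conjc \o du) x) <= M.
  by rewrite (le_trans (hM3 x x0 xb)) // !le_max lexx !orbT.
move: H1 H2 H3 hM1 hM2 hM3 flx; rewrite /wronskian /flux /=.
move: (u x) (du x) (w x) (dw x) (h x) (dh x) => p dp q dq r dr H1 H2 H3 hM1 hM2 hM3 flx.
have Wuu := cabs_wronskian_conj p dp.
have Www := cabs_wronskian_conj q dq.
rewrite Wuu in hM3; rewrite Www in H2.
have apa : a <= `|Im (dp * conjc p)|.
  by rewrite -normrN (le_trans _ (ler_norm _)) // lerNr.
apply: (He (cabs (p * dq - dp * q))); first exact: cabs_ge0.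
  have PN := plucker_norm p dp q dq.
  have H1' : cabs (conjc p * dq - conjc dp * q) <= e.
    by rewrite -conjcB_wronskian !conjcK.
  have -> : cabs (p * dq - dp * q) ^+ 2 = cabs (conjc p * dq - conjc dp * q) ^+ 2
      - 4 * (Im (dp * conjc p) * Im (dq * conjc q)) by rewrite PN addrK.
  apply: lerD; first by rewrite ler_pXn2r ?nnegrE ?cabs_ge0 // ltW.
  apply: (le_trans (ler_norm _)); rewrite normrN !normrM [`|4|]ger0_norm //.
  have -> : 4 * (`|Im (dp * conjc p)| * `|Im (dq * conjc q)|) =
    (2 * `|Im (dp * conjc p)|) * (2 * `|Im (dq * conjc q)|) by ring.
  by apply: ler_pM => //; rewrite mulr_ge0.
have PL := plucker p dp (conjc p) (conjc dp) (conjc q) (conjc dq) r dr.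
have W3 : cabs l / 2 <= cabs (conjc q * dr - conjc dq * r).
  have -> : cabs (conjc q * dr - conjc dq * r) = cabs (r * conjc dq - dr * conjc q).
    by rewrite -cabsN; congr cabs; ring.
  have : cabs l <= cabs (r * conjc dq - dr * conjc q) + cabs (r * conjc dq - dr * conjc q - l).
    by rewrite -[X in cabs X <= _](subKr (r * conjc dq - dr * conjc q)) cabsB_le.
  exact: half_le_of_dist_lt H3.
have W2 : cabs (conjc p * conjc dq - conjc dp * conjc q) = cabs (p * dq - dp * q).
  exact: conjcB_wronskian.
apply: (@le_trans _ _ (cabs ((p * conjc dp - dp * conjc p) * (conjc q * dr - conjc dq * r)))).
  rewrite cabsM; apply: ler_pM => //; rewrite ?(ltW a0) ?(ltW L2) // Wuu.
  by rewrite (le_trans apa) // ler_peMl // ler1n.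
have -> : (p * conjc dp - dp * conjc p) * (conjc q * dr - conjc dq * r) =
  - ((p * conjc dq - dp * conjc q) * (r * conjc dp - dr * conjc p)
   + (p * dr - dp * r) * (conjc p * conjc dq - conjc dp * conjc q)) by ring.
rewrite cabsN; apply: (le_trans (cabsD_le _ _)); rewrite !cabsM W2.
apply: lerD; first by apply: ler_pM; rewrite ?cabs_ge0.
by apply: ler_wpM2r; rewrite ?cabs_ge0.
Qed.

End WeylAlternative.

(** * Nonnegative flux of the Weyl solution *)

Section WeylFlux.
Context {R : realType}.
Notation T := (measurableTypeR R).
Notation mu := (@lebesgue_measure R).
Variables (b : \bar R) (chi : signed_measure b).
Notation Re := (@complex.Re R).
Notation Im := (@complex.Im R).
Implicit Types (f df g dg u du v dv s ds w dw h dh hh k : R -> R[i]) (z : R[i]).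

Lemma AC_loc_bmeas f X : AC_loc b f -> 0 < X -> (X%:E < b)%E ->
  bmeas X (Re \o f) /\ bmeas X (Im \o f).
Proof.
move=> af X0 Xb; have aX := af X X0 Xb; split; apply: cont_bmeas; apply: abscont_cont.
- apply: (abs_continuous_abscont _ aX) => x y.
  by rewrite -cReN -cReD; exact: Re_le_cabs.
- apply: (abs_continuous_abscont _ aX) => x y.
  by rewrite -cImN -cImD; exact: Im_le_cabs.
Qed.

Lemma solution_eigen z u du : is_solution chi z u du -> eigen chi z u du.
Proof.
move=> [Du tu]; apply: (Dtau_csys Du tu) => X X0 Xb.
have [au _ _] := Du; have [br bi] := AC_loc_bmeas au X0 Xb.
have bZ (c d : R) : bmeas X (fun y => c * (Re \o u) y + d * (Im \o u) y).
  by apply: bmeasD; apply: bmeasM => //; exact: bmeas_cst.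
split; apply: bmeas_lint.
- apply: (@bmeas_eq _ _ _ (fun y => Re z * (Re \o u) y + (- Im z) * (Im \o u) y)) => //.
  by move=> x _; rewrite /= cReM; ring.
- apply: (@bmeas_eq _ _ _ (fun y => Im z * (Re \o u) y + Re z * (Im \o u) y)) => //.
  by move=> x _; rewrite /= cImM; ring.
Qed.

Lemma loc_sq_cloc_int f : loc_sq b f -> cloc_integrable b f.
Proof.
move=> lf X X0 Xb; have [mr mi fi] := lf X X0 Xb.
have ci : mu.-integrable `[0, X[%classic (EFin \o (fun=> 1 : R)).
  by apply: bmeas_lint; exact: bmeas_cst.
have fci := @integrableD _ T R mu `[0, X[%classic (measurable_itv _)
  (EFin \o sqmod f) (EFin \o (fun=> 1 : R)) fi ci.
have key t : cabs (f t) <= sqmod f t + 1.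
  have := sqr_ge0 (cabs (f t) - 1); have := cabs_ge0 (f t); rewrite /sqmod sqrrB1.
  by move: (cabs (f t)) => p p0; rewrite expr2; lra.
split; apply: (le_integrable _ _ _ fci) => //.
- exact/measurable_EFinP.
- move=> t _; change (`|Re (f t)|%:E <= `|sqmod f t + 1|%:E)%E.
  rewrite lee_fin [leRHS]ger0_norm ?addr_ge0 ?sqmod_ge0 //.
  exact: (le_trans (Re_le_cabs _)).
- exact/measurable_EFinP.
- move=> t _; change (`|Im (f t)|%:E <= `|sqmod f t + 1|%:E)%E.
  rewrite lee_fin [leRHS]ger0_norm ?addr_ge0 ?sqmod_ge0 //.
  exact: (le_trans (Im_le_cabs _)).
Qed.

Lemma dom_Tmax_csys h dh : (0 < b)%E -> dom_Tmax chi h dh -> exists hh,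
  [/\ csys chi h dh h hh, loc_sq b hh, bnd_sq b h & bnd_sq b hh].
Proof.
move=> b0 [Dh Lh [hh Lhh th]]; exists hh.
have lhh := L2_loc_sq Lhh.
split=> //; [|exact: L2_bnd_sq (L2_loc_sq Lh) _ _ Lh|exact: L2_bnd_sq lhh _ _ Lhh].
by apply: (Dtau_csys Dh th); exact: loc_sq_cloc_int.
Qed.

(** If s were square integrable in the limit-point case, [weyl_alternative] would make every
    solution for every z' square integrable near [b], which is [limit_circle]. Since that definition
    ranges over all z', the alternative has to compare two spectral parameters. *)
Lemma weyl_flux w dw (m : R[i] -> R[i]) z : (0 < b)%E ->
  (limit_circle chi -> boundary_function chi w dw) ->
  weyl_function chi w dw m -> 0 < Im z ->
  exists u du, [/\ eigen chi z u du, u 0 = 1, du 0 = m z &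
    forall x, 0 < x -> (x%:E < b)%E -> 0 <= flux u du x].
Proof.
move=> b0 Hw Hm z0.
have zn0 : Im z != 0 by rewrite gt_eqF.
have [c [dc [s [ds [[sc c1 c'0] [ss s0 s'1] L2u bcu]]]]] := Hm z zn0.
have ec := solution_eigen sc; have es := solution_eigen ss.
pose u x := c x + m z * s x; pose du x := dc x + m z * ds x.
have eu : eigen chi z u du.
  apply: csys_ext (csysD ec (csysZ (m z) es)) => x //.
  by rewrite /u; ring.
have u0 : u 0 = 1 by rewrite /u c1 s0 mulr0 addr0.
have du0 : du 0 = m z by rewrite /du c'0 s'1 mulr1 add0r.
exists u, du; split => // x x0 xb.
have lu := csys_loc_sq eu.
have bu : bnd_sq b u.
  by have [d [d0 db Ld]] := L2u; exact: L2_bnd_sq lu (ltW d0) db Ld.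
have [lc|nlc] := pselect (limit_circle chi).
  have [_ Ww [h [dh [l [Dh Wh l0]]]]] := Hw lc.
  have [hh [sh lhh bh bhh]] := dom_Tmax_csys b0 Dh.
  exact: (limit_circle_flux z0 eu bu sh lhh bh bhh (bcu lc) Ww Wh l0).
have W1 : wronskian u du s ds 0 = 1.
  by rewrite /wronskian u0 s0 s'1 mulr0 subr0 mulr1.
apply: (limit_point_flux z0 eu es s0 W1 bu _ x0 xb) => bs; apply: nlc => z' v dv sv.
have ev := solution_eigen sv.
exact: bnd_sq_L2 b0 (csys_loc_sq ev) (weyl_alternative b0 eu es ev W1 bu bs).
Qed.

End WeylFlux.

(** * Comparison with exponentials *)

Section Exponential.
Context {R : realType}.
Notation T := (measurableTypeR R).
Notation mu := (@lebesgue_measure R).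
Notation Re := (@complex.Re R).
Notation Im := (@complex.Im R).
Implicit Types (c d z : R[i]) (x y : R).

Lemma cexpD z c : cexp (z + c) = cexp z * cexp c.
Proof.
by apply: complex_ext; rewrite /cexp !partE /= expRD ?cosD ?sinD; ring.
Qed.

Lemma cexp0 : cexp (0 : R[i]) = 1.
Proof. by apply: complex_ext; rewrite /= expR0 ?cos0 ?sin0 mul1r. Qed.

Lemma cabs_cexp z : cabs (cexp z) = expR (Re z).
Proof.
rewrite -[LHS]ger0_norm ?cabs_ge0 // -sqrtr_sqr cabs_sqr /cexp /=.
by rewrite !exprMn -mulrDr cos2Dsin2 mulr1 sqrtr_sqr ger0_norm ?expR_ge0.
Qed.

Definition cexpl c x := cexp (c * x%:C).

Lemma cexpl0 c : cexpl c 0 = 1.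
Proof. by rewrite /cexpl (_ : 0%:C = 0) // mulr0 cexp0. Qed.

Lemma cexplD c d x : cexpl (c + d) x = cexpl c x * cexpl d x.
Proof. by rewrite /cexpl mulrDl cexpD. Qed.

Lemma cexplNV c x : cexpl (- c) x * cexpl c x = 1.
Proof. by rewrite -cexplD addNr /cexpl mul0r cexp0. Qed.

Lemma cabs_cexpl c x : cabs (cexpl c x) = expR (Re c * x).
Proof. by rewrite cabs_cexp cReM /= mulr0 subr0. Qed.

Lemma Re_cexpl c x : Re (cexpl c x) = expR (Re c * x) * cos (Im c * x).
Proof. by rewrite /= !partE /= !mulr0 subr0 add0r. Qed.

Lemma Im_cexpl c x : Im (cexpl c x) = expR (Re c * x) * sin (Im c * x).
Proof. by rewrite /= !partE /= !mulr0 subr0 add0r. Qed.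

Lemma is_derive_Re_cexpl c d x :
  is_derive x 1 (fun y => Re (d * cexpl c y)) (Re (d * c * cexpl c x)).
Proof.
have -> : (fun y => Re (d * cexpl c y)) = (fun y =>
    Re d * (expR (Re c * y) * cos (Im c * y)) - Im d * (expR (Re c * y) * sin (Im c * y))).
  by apply/funext => y; rewrite cReM Re_cexpl Im_cexpl.
apply: is_derive_eq; rewrite !cReM cImM Re_cexpl Im_cexpl.
by rewrite /GRing.scale /=; ring.
Qed.

Lemma derive_FTC (f f' : R -> R) : (forall x, is_derive x 1 f (f' x)) ->
  (forall x, derivable f' x 1) -> forall x, 0 <= x ->
  f x = f 0 + \int[mu]_(t in `[0, x[) f' t.
Proof.
move=> df df' x; rewrite le_eqVlt => /predU1P[<-|x0].
  by rewrite set_itvco0 Rintegral_set0 addr0.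
have cont_of (g : R -> R) : (forall x, derivable g x 1) -> continuous g.
  by move=> dg t; apply: differentiable_continuous; exact/derivable1_diffP.
have cf : continuous f by apply: cont_of => t; have [] := df t.
have cf' : continuous f' := cont_of _ df'.
have cw : {within `[0, x], continuous f'} by exact: continuous_subspaceT.
have := continuous_FTC2 x0 cw.
move=> /(_ f _ _)/(congr1 fine) H; rewrite Rintegral_itv_bndo_bndc; last first.
  by apply: bmeas_lint; exact: cont_bmeas.
rewrite /Rintegral H.
- by rewrite /=; ring.
- split.
  + by move=> t _; have [] := df t.
  + exact/cvg_at_right_filter/cf.
  + exact/cvg_at_left_filter/cf.
- by move=> t _; rewrite derive1E; have [] := df t.
Qed.

Lemma Re_cexpl_FTC c d x : 0 <= x ->
  Re (d * cexpl c x) = Re d + \int[mu]_(t in `[0, x[) Re (d * c * cexpl c t).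
Proof.
move=> x0; rewrite -[Re d in RHS]/(Re d) -[in X in X + _](mulr1 d) -(cexpl0 c).
apply: (@derive_FTC (fun y => Re (d * cexpl c y)) (fun y => Re (d * c * cexpl c y))) => //.
  by move=> y; exact: is_derive_Re_cexpl.
by move=> y; have [] := is_derive_Re_cexpl c (d * c) y.
Qed.

Lemma cont_Re_cexpl c d X : cont X (fun y => Re (d * cexpl c y)).
Proof.
apply: continuous_subspaceT => y; apply: differentiable_continuous.
by apply/derivable1_diffP; have [] := is_derive_Re_cexpl c d y.
Qed.

(** Imaginary parts become real parts with coefficient -i; this is why a coefficient [d] accompanies
    the exponentials. *)
Lemma cImRe z : Im z = Re (- 'i * z).
Proof. by rewrite !partE /=; ring. Qed.

Variables (b : \bar R) (chi : signed_measure b).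

Lemma rep_Re_cexpl (mu1 mu2 : {finite_measure set T -> \bar R}) X c d :
  rep mu1 mu2 X (fun x => Re (d * cexpl c x)) (fun x => Re (d * c * cexpl c x))
    (fun=> 0) (fun x => Re (- (d * c * c) * cexpl c x)).
Proof.
split.
- exact: bmeas_cst.
- by apply: bmeas_lint; apply: cont_bmeas; exact: cont_Re_cexpl.
- move=> x /andP[x0 _]; rewrite Re_cexpl_FTC // cexpl0 mulr1.
  rewrite /sI !Rintegral_cst // !mul0r subrr addr0; congr (_ + _).
  rewrite (_ : (fun t => Re (- (d * c * c) * cexpl c t)) =
    (fun t => -1 * Re (d * c * c * cexpl c t))); last first.
    by apply/funext => t; rewrite mulN1r -cReN; congr Re; exact: mulNr.
  rewrite RintegralZl //; first by rewrite mulN1r opprK.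
  by apply: bmeas_lint; apply: cont_bmeas; exact: cont_Re_cexpl.
- by move=> x /andP[x0 _]; rewrite Re_cexpl_FTC // cexpl0 mulr1.
Qed.

Lemma csys_cexpl c :
  csys chi (cexpl c) (fun x => c * cexpl c x) (fun=> 0) (fun x => - c ^+ 2 * cexpl c x).
Proof.
move=> X X0 Xb; split.
- apply: rep_ext (rep_Re_cexpl _ _ X c 1) => x.
  + by rewrite mul1r.
  + by rewrite mul1r.
  + by [].
  + by rewrite mul1r -expr2.
- apply: rep_ext (rep_Re_cexpl _ _ X c (- 'i)) => x.
  + by rewrite -cImRe.
  + by rewrite -mulrA -cImRe.
  + by [].
  + rewrite [RHS]cImRe; congr Re; ring.
Qed.

End Exponential.

(** * Integrals against the signed measure *)

Section ChargeIntegral.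
Context {R : realType}.
Notation T := (measurableTypeR R).
Notation mu := (@lebesgue_measure R).
Notation Re := (@complex.Re R).
Notation Im := (@complex.Im R).
Variables (b : \bar R) (chi : signed_measure b) (X : R).
Implicit Types (f g : R -> R[i]) (D : set T).
Notation P := (jordan_pos (sm_hahn chi X)).
Notation N := (jordan_neg (sm_hahn chi X)).

Definition csI D f : R[i] := chiI chi X D (Re \o f) +i* chiI chi X D (Im \o f).

(** The total variation |chi|(D), for D inside [0, X[. *)
Definition cvar D : R := fine (P D) + fine (N D).

Definition cbmeas f := bmeas X (Re \o f) /\ bmeas X (Im \o f).

Lemma cbmeasM f g : cbmeas f -> cbmeas g -> cbmeas (fun y => f y * g y).
Proof.
move=> [fr fi] [gr gi]; split.
- apply: (@bmeas_eq _ _ _ (fun y => (Re \o f) y * (Re \o g) y - (Im \o f) y * (Im \o g) y)).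
    by move=> y _; exact: cReM.
  by apply: bmeasB; apply: bmeasM.
- apply: (@bmeas_eq _ _ _ (fun y => (Re \o f) y * (Im \o g) y + (Im \o f) y * (Re \o g) y)).
    by move=> y _; exact: cImM.
  by apply: bmeasD; apply: bmeasM.
Qed.

Lemma cbmeasB f g : cbmeas f -> cbmeas g -> cbmeas (fun y => f y - g y).
Proof.
move=> [fr fi] [gr gi]; split.
- apply: (@bmeas_eq _ _ _ (fun y => (Re \o f) y - (Re \o g) y)).
    by move=> y _; rewrite /= cReD cReN.
  exact: bmeasB.
- apply: (@bmeas_eq _ _ _ (fun y => (Im \o f) y - (Im \o g) y)).
    by move=> y _; rewrite /= cImD cImN.
  exact: bmeasB.
Qed.

Lemma csys_cbmeas f df phi h : 0 < X -> (X%:E < b)%E -> csys chi f df phi h -> cbmeas f.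
Proof. by move=> X0 Xb /(_ X X0 Xb)[fr fi]; split; [exact: rep_f fr|exact: rep_f fi]. Qed.

Lemma cvar_ge0 D : 0 <= cvar D.
Proof. by rewrite addr_ge0 ?fine_ge0. Qed.

Lemma cvarS D D' : measurable D -> measurable D' -> D `<=` D' -> cvar D <= cvar D'.
Proof.
move=> mD mD' DD'; apply: lerD; apply: fine_le; try exact: fin_num_measure.
- by apply: le_measure; rewrite ?inE.
- by apply: le_measure; rewrite ?inE.
Qed.

Lemma chiI_bound D (f : R -> R) M : measurable D -> D `<=` `[0, X[ -> bmeas X f ->
  (forall y, D y -> `|f y| <= M) -> `|chiI chi X D f| <= M * cvar D.
Proof.
move=> mD DX bf fM; rewrite /chiI /sI mulrDr.
have fin (nu : {finite_measure set T -> \bar R}) : nu.-integrable D (EFin \o f).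
  by apply: integrable_itvS mD DX _; exact: bmeas_fint.
apply: (le_trans (ler_normB _ _)); apply: lerD.
- exact: Rintegral_norm_cst_le mD (fin_itv P mD) (fin P) fM.
- exact: Rintegral_norm_cst_le mD (fin_itv N mD) (fin N) fM.
Qed.

(** The factor 2 again comes from treating real and imaginary parts separately. *)
Lemma csI_bound D f M : measurable D -> D `<=` `[0, X[ -> cbmeas f ->
  (forall y, D y -> cabs (f y) <= M) -> cabs (csI D f) <= 2 * (M * cvar D).
Proof.
move=> mD DX [fr fi] fM; apply: (le_trans (cabs_le_ReIm _)) => /=.
rewrite mulr_natl mulr2n; apply: lerD; apply: chiI_bound => // y /fM H.
- exact: (le_trans (Re_le_cabs _)).
- exact: (le_trans (Im_le_cabs _)).
Qed.

Lemma csI_split (x : R) f : 0 <= x -> x <= X -> cbmeas f ->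
  csI `[0, X[%classic f = csI `[0, x[%classic f + csI `[x, X[%classic f.
Proof.
move=> x0 xX [fr fi].
have S (g : R -> R) : bmeas X g -> chiI chi X `[0, X[%classic g =
    chiI chi X `[0, x[%classic g + chiI chi X `[x, X[%classic g.
  move=> bg; rewrite /chiI /sI !(Rintegral_split x0 xX) //; try exact: bmeas_fint.
  by ring.
by apply: complex_ext; rewrite !partE /csI /=; exact: S.
Qed.

Lemma csI_B f g : cbmeas f -> cbmeas g ->
  csI `[0, X[%classic (fun y => f y - g y) =
  csI `[0, X[%classic f - csI `[0, X[%classic g.
Proof.
move=> [fr fi] [gr gi]; apply: complex_ext; rewrite !partE /csI /chiI /=.
- rewrite -sIB //; congr (sI _ _ _ _); apply/funext => y /=.
  by rewrite cReD cReN.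
- rewrite -sIB //; congr (sI _ _ _ _); apply/funext => y /=.
  by rewrite cImD cImN.
Qed.

Lemma sm_cintegralE (x : R) f : 0 <= x -> x <= X -> (X%:E < b)%E ->
  sm_cintegral chi x f = csI `[0, x[%classic f.
Proof.
by move=> x0 xX Xb; rewrite /sm_cintegral !(sm_integralE _ _ x0 xX Xb).
Qed.

Lemma csI_eq D f g : (forall y, f y = g y) -> csI D f = csI D g.
Proof. by move=> /funext ->. Qed.

End ChargeIntegral.

Section CharacteristicIdentity.
Context {R : realType}.
Notation T := (measurableTypeR R).
Notation mu := (@lebesgue_measure R).
Notation Re := (@complex.Re R).
Notation Im := (@complex.Im R).
Variables (b : \bar R) (chi : signed_measure b) (X : R).
Hypothesis Xb : (X%:E < b)%E.
Variables (z c : R[i]) (u du : R -> R[i]).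
Hypothesis zc : z = - c ^+ 2.
Hypothesis su : eigen chi z u du.

(* [(e^{cx} (u' - c u))' = e^{cx} u chi] *)
Lemma cexpl_identity x : 0 <= x -> x <= X ->
  cexpl c x * (du x - c * u x) = (du 0 - c * u 0)
    + csI chi X `[0, x[%classic (fun y => cexpl c y * u y).
Proof.
move=> x0 xX; have xb : (x%:E < b)%E by apply: le_lt_trans Xb; rewrite lee_fin.
move: x0; rewrite le_eqVlt => /predU1P[<-|x0].
  rewrite cexpl0 mul1r (_ : csI _ _ _ _ = 0) ?addr0 //.
  by rewrite /csI !chiI0.
have := csys_lagrange (csys_cexpl chi c) su x0 xb.
rewrite (sm_cintegralE chi _ (ltW x0) xX Xb).
(* As z = - c^2, the exponential and u belong to the same spectral parameter and the Lebesgue part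
   vanishes. *)
rewrite (@clI_eq _ x _ (fun=> 0)); last by move=> y; rewrite zc; ring.
rewrite [clI _ _](_ : _ = 0); last first.
  by rewrite /clI /= Rintegral_cst // mul0r.
rewrite (csI_eq _ _ _ (g := fun y => cexpl c y * u y)); last first.
  by move=> y; rewrite mulr0 subr0.
rewrite subr0 => /(canRL (subrK _)) H.
transitivity (wronskian (cexpl c) (fun x => c * cexpl c x) u du x).
  by rewrite /wronskian; ring.
by rewrite H addrC; congr (_ + _); rewrite /wronskian cexpl0; ring.
Qed.

End CharacteristicIdentity.

(** Arithmetic for [u_lower]: [i] and [ex] are the decaying and the growing exponential in modulus,
    [U] is |u(x)| and [r] the modulus of the remainder. *)
Lemma lower_bound_of_triangle {R : realFieldType} (n beta i ex U r : R) :
  0 < n -> 0 <= beta -> 0 <= i -> i <= 1 -> r <= n / 2 * (i + beta * ex) ->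
  n * beta * ex <= 2 * n * U + 2 * n * i + n * beta * i + r ->
  2 * n * (beta * ex / 4 - beta / 2 - 5 / 4) <= 2 * n * U.
Proof.
move=> n0 b0 i0 i1 rn H.
have H1 : n * i <= n by rewrite ler_piMr // ltW.
have H2 : n * beta * i <= n * beta by rewrite ler_piMr // mulr_ge0 // ltW.
have E1 : n / 2 * (i + beta * ex) = (n * i) / 2 + (n * beta * ex) / 2 by field.
have E2 : 2 * n * (beta * ex / 4 - beta / 2 - 5 / 4) =
  (n * beta * ex) / 2 - n * beta - 5 / 2 * n by field.
rewrite E1 in rn; rewrite E2; have E3 : 2 * n * i = 2 * (n * i) by ring.
rewrite E3 in H; move: H H1 H2 rn.
move: (n * beta * ex) (2 * n * U) (n * i) (n * beta * i) (n * beta) => p q t w v.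
lra.
Qed.

Lemma four_sum_le {R : realFieldType} (p q r : R) :
  24 * p <= r -> q <= p -> 0 <= p -> 4 * q + 4 * p <= r.
Proof. by lra. Qed.

(** * A priori bound and expansion of m for a single z *)

Section LocalEstimate.
Context {R : realType}.
Notation T := (measurableTypeR R).
Notation mu := (@lebesgue_measure R).
Notation Re := (@complex.Re R).
Notation Im := (@complex.Im R).
Variables (b : \bar R) (chi : signed_measure b) (X : R).
Hypotheses (X0 : 0 < X) (Xb : (X%:E < b)%E).
Variables (z k m : R[i]) (u du : R -> R[i]).
Hypothesis zk : z = - k ^+ 2.
Hypothesis su : eigen chi z u du.
Hypotheses (u0 : u 0 = 1) (du0 : du 0 = m).

Let kap := Re k.
Let n := cabs k.
Let V := cvar chi X `[0, X[%classic.
Hypothesis kap0 : 0 < kap.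
Hypothesis Vn : 24 * V <= n.

Let e x := expR (kap * x).
Let E := cexpl (- k).
Let F := cexpl k.
(** The amplitude of the growing exponential: if chi vanished, u would be E + B / (2 k) (F - E). *)
Let B := E X * (du X + k * u X).
Let beta := cabs B / n.
(** The weight in which u is measured: a decaying exponential plus a growing one of relative
    amplitude [beta]. *)
Let Om x := (e x)^-1 + beta * e x.
Let I0 := csI chi X `[0, X[%classic (fun y => E y * u y).

Let e_gt0 x : 0 < e x. Proof. exact: expR_gt0. Qed.

Let e_le x y : x <= y -> e x <= e y.
Proof. by move=> xy; rewrite ler_expR ler_pM2l. Qed.

Let cabsE x : cabs (E x) = (e x)^-1.
Proof. by rewrite /E cabs_cexpl cReN mulNr expRN. Qed.

Let cabsF x : cabs (F x) = e x.
Proof. by rewrite /F cabs_cexpl. Qed.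

Let n_gt0 : 0 < n.
Proof.
by rewrite cabs_gt0; apply: contraTneq kap0 => k0; rewrite /kap k0 ltxx.
Qed.

Let beta_ge0 : 0 <= beta.
Proof. by rewrite divr_ge0 ?cabs_ge0. Qed.

Let V_ge0 : 0 <= V. Proof. exact: cvar_ge0. Qed.

Let Om_gt0 x : 0 < Om x.
Proof.
by rewrite ltr_pwDl ?invr_gt0 // mulr_ge0 ?beta_ge0 // ltW.
Qed.

Let cbu : cbmeas X u. Proof. exact: csys_cbmeas su. Qed.
Let cbE : cbmeas X E. Proof. exact: csys_cbmeas (csys_cexpl chi (- k)). Qed.
Let cbF : cbmeas X F. Proof. exact: csys_cbmeas (csys_cexpl chi k). Qed.

Lemma char_decay x : 0 <= x -> x <= X ->
  E x * (du x + k * u x) = (m + k) + csI chi X `[0, x[%classic (fun y => E y * u y).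
Proof.
move=> x0 xX; have zk' : z = - (- k) ^+ 2 by rewrite sqrrN.
have := cexpl_identity Xb zk' su x0 xX.
by rewrite !mulNr !opprK u0 du0 mulr1.
Qed.

Lemma char_growth x : 0 <= x -> x <= X ->
  F x * (du x - k * u x) = (m - k) + csI chi X `[0, x[%classic (fun y => F y * u y).
Proof.
by move=> x0 xX; have := cexpl_identity Xb zk su x0 xX; rewrite u0 du0 mulr1.
Qed.

Lemma mkE : m + k = B - I0.
Proof. by have := char_decay (ltW X0) (lexx X); rewrite -/B -/I0 => ->; ring. Qed.

(** This is 2 k times the deviation of u from the free solution E + B / (2 k) (F - E). *)
Let rem x := 2 * k * (u x - E x) - B * (F x - E x).

(** Variation of constants, by eliminating u' between [char_decay] and [char_growth]. Since B is
    read off at X, the growing factor F x multiplies an integral over [x, X[, where |F x E y| <=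
    1. *)
Lemma remE x : 0 <= x -> x <= X ->
  rem x = E x * I0 - E x * csI chi X `[0, x[%classic (fun y => F y * u y)
    - F x * csI chi X `[x, X[%classic (fun y => E y * u y).
Proof.
move=> x0 xX; have P := char_decay x0 xX; have Q := char_growth x0 xX.
have EF : E x * F x = 1 by exact: cexplNV.
have S := csI_split chi x0 xX (cbmeasM cbE cbu); rewrite -/I0 in S.
have M : m = B - I0 - k by rewrite -mkE addrK.
rewrite /rem; move: P Q S; rewrite M.
move: (csI _ _ _ _) (csI _ _ _ _) (csI _ _ _ _) => I2 I1 J1 P Q S.
have P' : du x + k * u x = F x * (B - I0 - k + k + J1).
  by rewrite -P mulrA [F x * _]mulrC EF mul1r.
have Q' : du x - k * u x = E x * (B - I0 - k - k + I1).
  by rewrite -Q mulrA EF mul1r.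
have -> : 2 * k * (u x - E x) - B * (F x - E x) =
  (du x + k * u x) - (du x - k * u x) - 2 * k * E x - B * (F x - E x) by ring.
by rewrite P' Q' S; ring.
Qed.

(** Each of the three terms of [remE] is at most 2 V S Om x, because the weight reproduces itself: e
    y Om y = 1 + beta (e y)^2 increases up to y = x, and Om y / e y = (e y)^-2 + beta decreases from
    y = x on. *)
Lemma rem_bound S : 0 <= S -> (forall y, 0 <= y <= X -> cabs (u y) <= S * Om y) ->
  forall x, 0 <= x -> x <= X -> cabs (rem x) <= 6 * V * S * Om x.
Proof.
move=> S0 uS x x0 xX; rewrite remE //.
have ex := e_gt0 x.
have cbEu := cbmeasM cbE cbu; have cbFu := cbmeasM cbF cbu.
have sub0 : `[0, x[ `<=` `[0, X[ by apply: subset_bcoo.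
have subx : `[x, X[ `<=` `[0, X[ by apply: subset_bcoo.
have Eu y : 0 <= y <= X -> cabs (E y * u y) <= S * ((e y)^-1 ^+ 2 + beta).
  move=> yX; rewrite cabsM cabsE.
  apply: (@le_trans _ _ ((e y)^-1 * (S * Om y))).
    by apply: ler_wpM2l; [rewrite invr_ge0 ltW|exact: uS].
  by rewrite /Om le_eqVlt; apply/orP; left; apply/eqP; field; rewrite gt_eqF.
have Fu y : 0 <= y <= X -> cabs (F y * u y) <= S * (1 + beta * e y ^+ 2).
  move=> yX; rewrite cabsM cabsF.
  apply: (@le_trans _ _ (e y * (S * Om y))).
    by apply: ler_wpM2l; [rewrite ltW|exact: uS].
  by rewrite /Om le_eqVlt; apply/orP; left; apply/eqP; field; rewrite gt_eqF.
have inv_le a c : 0 <= a -> a <= c -> (e c)^-1 ^+ 2 <= (e a)^-1 ^+ 2.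
  move=> a0 ac; rewrite ler_pXn2r ?nnegrE ?invr_ge0 ?(ltW (e_gt0 _)) //.
  by rewrite lef_pV2 ?posrE // e_le.
have e01 : e 0 = 1 by rewrite /e mulr0 expR0.
have T1 : cabs (E x * I0) <= 2 * V * S * Om x.
  rewrite cabsM cabsE.
  have H : cabs I0 <= 2 * (S * (1 + beta) * V).
    apply: csI_bound => // y /=; rewrite in_itv /= => /andP[y0 yX].
    apply: (le_trans (Eu y _)); first by rewrite y0 ltW.
    by apply: ler_wpM2l => //; rewrite lerD2r (le_trans (inv_le 0 y _ y0)) // e01 invr1 expr1n.
  apply: (@le_trans _ _ ((e x)^-1 * (2 * (S * (1 + beta) * V)))).
    by apply: ler_wpM2l; [rewrite invr_ge0 ltW|exact: H].
  have -> : (e x)^-1 * (2 * (S * (1 + beta) * V)) = 2 * V * S * ((e x)^-1 + beta * (e x)^-1) by ring.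
  apply: ler_wpM2l; first by rewrite !mulr_ge0.
  rewrite lerD2l ler_wpM2l // (le_trans (y := 1)) //.
    by rewrite invf_le1 // -e01 e_le.
  by rewrite -e01 e_le.
have T2 : cabs (E x * csI chi X `[0, x[%classic (fun y => F y * u y)) <= 2 * V * S * Om x.
  rewrite cabsM cabsE.
  have H : cabs (csI chi X `[0, x[%classic (fun y => F y * u y)) <=
      2 * (S * (1 + beta * e x ^+ 2) * V).
    apply: (@le_trans _ _ (2 * (S * (1 + beta * e x ^+ 2) * cvar chi X `[0, x[%classic))).
      apply: csI_bound => // y /=; rewrite in_itv /= => /andP[y0 yx].
      apply: (le_trans (Fu y _)); first by rewrite y0 (ltW (lt_le_trans yx xX)).
      apply: ler_wpM2l => //; rewrite lerD2l ler_wpM2l //.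
      by rewrite ler_pXn2r ?nnegrE ?(ltW (e_gt0 _)) // e_le // ltW.
    rewrite ler_pM2l // ler_wpM2l //; last exact: cvarS.
    by rewrite mulr_ge0 // addr_ge0 // mulr_ge0 // sqr_ge0.
  apply: (@le_trans _ _ ((e x)^-1 * (2 * (S * (1 + beta * e x ^+ 2) * V)))).
    by apply: ler_wpM2l; [rewrite invr_ge0 ltW|exact: H].
  by rewrite /Om le_eqVlt; apply/orP; left; apply/eqP; field; rewrite gt_eqF.
have T3 : cabs (F x * csI chi X `[x, X[%classic (fun y => E y * u y)) <= 2 * V * S * Om x.
  rewrite cabsM cabsF.
  have H : cabs (csI chi X `[x, X[%classic (fun y => E y * u y)) <=
      2 * (S * ((e x)^-1 ^+ 2 + beta) * V).
    apply: (@le_trans _ _ (2 * (S * ((e x)^-1 ^+ 2 + beta) * cvar chi X `[x, X[%classic))).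
      apply: csI_bound => // y /=; rewrite in_itv /= => /andP[xy yX].
      apply: (le_trans (Eu y _)); first by rewrite (le_trans x0 xy) ltW.
      by apply: ler_wpM2l => //; rewrite lerD2r inv_le.
    rewrite ler_pM2l // ler_wpM2l //; last exact: cvarS.
    by rewrite mulr_ge0 // addr_ge0 // sqr_ge0.
  apply: (@le_trans _ _ (e x * (2 * (S * ((e x)^-1 ^+ 2 + beta) * V)))).
    by apply: ler_wpM2l; [exact: ltW|exact: H].
  by rewrite /Om le_eqVlt; apply/orP; left; apply/eqP; field; rewrite gt_eqF.
apply: (le_trans (cabsB_le _ _)).
have -> : 6 * V * S * Om x = (2 * V * S * Om x + 2 * V * S * Om x) + 2 * V * S * Om x by ring.
by apply: lerD => //; apply: (le_trans (cabsB_le _ _)); apply: lerD.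
Qed.

Lemma u_decomp x : 2 * k * u x = 2 * k * E x + B * (F x - E x) + rem x.
Proof. by rewrite /rem; ring. Qed.

Let cabs2k : cabs (2 * k) = 2 * n.
Proof. by rewrite cabsM (_ : 2 = (2 : R)%:C) ?rmorph_nat // -(rmorph_nat (real_complex R)) cabs_real ger0_norm. Qed.

(** By [u_decomp], [rem_bound] and 6 V <= n, a bound |u| <= S Om improves to |u| <= (1 + S / 2) Om,
    so [bound_improve] applies. *)
Lemma u_bound x : 0 <= x <= X -> cabs (u x) <= 2 * Om x.
Proof.
move=> xX; rewrite -ler_pdivrMr //.
have [N1 hN] := csys_bounded su X0 Xb.
rewrite -[2]mulr1.
apply: (@bound_improve R R (fun y => 0 <= y <= X) (fun y => cabs (u y) / Om y) 1 (N1 * e X)) => //.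
- move=> y yX; have [uN _] := hN y yX; case/andP: yX => y0 yX.
  have N0 : 0 <= N1 := le_trans (cabs_ge0 _) uN.
  rewrite ler_pdivrMr //; apply: (le_trans uN); rewrite -mulrA ler_peMr //.
  rewrite /Om mulrDr; apply: (@le_trans _ _ (e X * (e y)^-1)).
    by rewrite ler_pdivlMr // mul1r e_le.
  rewrite lerDl; apply: mulr_ge0; first exact: ltW.
  by apply: mulr_ge0 => //; exact: ltW.
move=> S hS y yX; have [y0 yX'] := andP yX.
have S0 : 0 <= S.
  by apply: le_trans (hS y yX); rewrite divr_ge0 ?cabs_ge0 // ltW.
have uS t : 0 <= t <= X -> cabs (u t) <= S * Om t.
  by move=> /hS; rewrite ler_pdivrMr.
have Rb := rem_bound S0 uS y0 yX'.
rewrite ler_pdivrMr // -(ler_pM2l (_ : 0 < 2 * n)) ?mulr_gt0 //.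
rewrite -cabs2k -cabsM u_decomp.
apply: (le_trans (cabsD_le _ _)); apply: (le_trans (lerD (cabsD_le _ _) Rb)).
rewrite (cabsM (2 * k)) cabs2k (cabsM B) cabsE.
have Bn : cabs B = n * beta by rewrite /beta mulrC divfK // gt_eqF.
have FE : cabs (F y - E y) <= e y + (e y)^-1.
  by apply: (le_trans (cabsB_le _ _)); rewrite cabsF cabsE.
have ey := e_gt0 y.
have ey1 : (e y)^-1 <= e y.
  have e01 : e 0 = 1 by rewrite /e mulr0 expR0.
  rewrite (le_trans (y := 1)) //; last by rewrite -e01 e_le.
  by rewrite invf_le1 // -e01 e_le.
apply: (@le_trans _ _ (2 * n * (e y)^-1 + n * beta * (2 * e y) + n * S * Om y)).
  apply: lerD; first apply: lerD => //.
    rewrite Bn; apply: ler_wpM2l; first by rewrite mulr_ge0 // ltW.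
    by apply: (le_trans FE); rewrite mulr_natl mulr2n lerD2l.
  apply: ler_wpM2r; first exact: ltW.
  apply: ler_wpM2r => //; apply: le_trans Vn.
  by rewrite ler_wpM2r // ler_nat.
by rewrite /Om le_eqVlt; apply/orP; left; apply/eqP; field; rewrite gt_eqF.
Qed.

Lemma rem_le x : 0 <= x -> x <= X -> cabs (rem x) <= 12 * V * Om x.
Proof.
move=> x0 xX; have := rem_bound (ler0n _ 2) u_bound x0 xX.
by rewrite (_ : 6 * V * 2 = 12 * V) //; ring.
Qed.

Hypotheses (z1 : 1 <= Im z) (n1 : 1 <= n) (kapX : 1 <= kap * X) (eX : 16 <= e X).
Hypothesis fluxX : 0 <= flux u du X.

Let Bn : cabs B = n * beta.
Proof. by rewrite /beta mulrC divfK // gt_eqF. Qed.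

Let e_ge1 x : 0 <= x -> 1 <= e x.
Proof. by move=> x0; rewrite -expR0 ler_expR mulr_ge0 // ltW. Qed.

Let kap_le : kap <= n.
Proof. by apply: le_trans (Re_le_cabs k); exact: ler_norm. Qed.

Let e_inv_le x y : x <= y -> (e y)^-1 ^+ 2 <= (e x)^-1 ^+ 2.
Proof.
move=> xy; have i0 w : 0 <= (e w)^-1 by rewrite invr_ge0 ltW.
by rewrite ler_pXn2r ?nnegrE // lef_pV2 ?posrE // e_le.
Qed.

Let t := beta * e X.

Let beta_le_t : beta <= t / 16.
Proof. by rewrite ler_pdivlMr // ler_wpM2l. Qed.

Let I0_le : cabs I0 <= n * (1 + beta).
Proof.
apply: (@le_trans _ _ (2 * (2 * (1 + beta) * V))).
  apply: csI_bound => //; first exact: cbmeasM.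
  move=> y /=; rewrite in_itv /= => /andP[y0 yX].
  rewrite cabsM cabsE; have ey := e_gt0 y.
  apply: (@le_trans _ _ ((e y)^-1 * (2 * Om y))).
    apply: ler_wpM2l; first by rewrite invr_ge0 ltW.
    by apply: u_bound; rewrite y0 ltW.
  have -> : (e y)^-1 * (2 * Om y) = 2 * ((e y)^-1 ^+ 2 + beta).
    by rewrite /Om; field; rewrite gt_eqF.
  rewrite ler_pM2l // lerD2r expr_le1 ?invr_ge0 ?(ltW ey) //.
  by rewrite invf_le1 // e_ge1.
have -> : 2 * (2 * (1 + beta) * V) = 4 * V * (1 + beta) by ring.
apply: ler_wpM2r; first by rewrite addr_ge0.
by apply: le_trans Vn; rewrite ler_wpM2r // ler_nat.
Qed.

Let m_le : cabs m <= 2 * n * (1 + beta).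
Proof.
have -> : m = B - I0 - k by rewrite -mkE addrK.
apply: (le_trans (cabsB_le _ _)); apply: (le_trans (lerD (cabsB_le _ _) (lexx _))).
rewrite Bn -/n; apply: (le_trans (lerD (lerD (lexx _) I0_le) (lexx _))).
by rewrite le_eqVlt; apply/orP; left; apply/eqP; ring.
Qed.

(** The energy identity with Im z >= 1. The sign of the flux at X enters only here, and with it all
    that is known about u beyond X. *)
Let nsq_le : nsq u X <= cabs m.
Proof.
have En := energy su X0 Xb.
have F0 : flux u du 0 = Im m by rewrite /flux u0 du0 rmorph1 mulr1.
apply: (@le_trans _ _ (Im z * nsq u X)); first by rewrite ler_peMl // nsq_ge0.
apply: (@le_trans _ _ (Im m)); last by apply: le_trans (Im_le_cabs m); exact: ler_norm.
by rewrite -subr_ge0 -F0 -En.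
Qed.

(** Reverse triangle inequality in [u_decomp]: B F x is the dominant term, and the remainder costs
    at most half of it up to a decaying term. *)
Let u_lower x : 0 <= x -> x <= X -> beta * e x / 4 - beta / 2 - 5 / 4 <= cabs (u x).
Proof.
move=> x0 xX; rewrite -(ler_pM2l (_ : 0 < 2 * n)) ?mulr_gt0 //.
have ex := e_gt0 x; have ex1 := e_ge1 x0.
have iex : (e x)^-1 <= 1 by rewrite invf_le1.
have ie0 : 0 <= (e x)^-1 by rewrite invr_ge0 ltW.
have H : cabs (B * F x) <= cabs (2 * k * u x) + cabs (2 * k * E x) + cabs (B * E x) + cabs (rem x).
  have -> : B * F x = 2 * k * u x - 2 * k * E x + B * E x - rem x by rewrite u_decomp; ring.
  apply: (le_trans (cabsB_le _ _)); rewrite lerD2r.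
  apply: (le_trans (cabsD_le _ _)); rewrite lerD2r.
  exact: cabsB_le.
rewrite (cabsM B (F x)) (cabsM (2 * k) (u x)) (cabsM (2 * k) (E x)) (cabsM B (E x)) cabsE cabsF Bn !cabs2k in H.
have R1 : cabs (rem x) <= n / 2 * Om x.
  apply: (le_trans (rem_le x0 xX)); apply: ler_wpM2r; first exact: ltW.
  by rewrite ler_pdivlMr // mulrAC -natrM.
apply: (lower_bound_of_triangle n_gt0 beta_ge0 ie0 iex _ H).
exact: R1.
Qed.

Lemma beta_le : beta * e X <= 2 ^+ 12 * n ^+ 2.
Proof.
rewrite -/t; have [t64|t64] := leP t 64.
  apply: (le_trans t64); apply: (@le_trans _ _ (2 ^+ 12 * 1)).
    by rewrite mulr1 -natrX ler_nat.
  by apply: ler_wpM2l; [exact: exprn_ge0|exact: exprn_ege1].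
(* On the last stretch of this length before X the growing exponential keeps at least half of its
   final value. *)
pose d := (2 * kap)^-1.
have d0 : 0 < d by rewrite invr_gt0 mulr_gt0.
have dX : 0 <= X - d.
  rewrite subr_ge0 /d -div1r ler_pdivrMr ?mulr_gt0 //.
  have -> : X * (2 * kap) = 2 * (kap * X) by ring.
  by apply: (le_trans kapX); rewrite ler_peMl ?ler1n // (le_trans ler01).
have Xd : X - d <= X by rewrite gerDl oppr_le0 ltW.
have t0 : 0 < t by apply: lt_trans t64.
(* Because beta <= t / 16 and t > 64, t / 8 - beta / 2 - 5 / 4 is at least t / 16. *)
have ul x : X - d <= x -> x < X -> t / 16 <= cabs (u x).
  move=> dx xX; apply: le_trans (u_lower (le_trans dX dx) (ltW xX)).
  have eh : e X / 2 <= e x.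
    have -> : e x = e X * expR (kap * (x - X)).
      by rewrite /e -expRD; congr expR; ring.
    rewrite ler_pM2l //; apply: le_trans (expR_ge1Dx _).
    have : kap * (X - x) <= kap * d by rewrite ler_pM2l // lerBlDl -lerBlDr.
    have -> : kap * d = 2^-1 by rewrite /d; field; rewrite gt_eqF.
    have -> : kap * (x - X) = - (kap * (X - x)) by ring.
    by move: (kap * (X - x)) => q; lra.
  have : t / 2 <= beta * e x by rewrite /t -mulrA ler_wpM2l.
  move: beta_le_t t64; move: (beta * e x) beta t => p q r; lra.
have [_ _ ui] := csys_loc_sq su X0 Xb.
have mDX : `[X - d, X[ `<=` `[0, X[ by apply: subset_bcoo.
have uiD := integrable_itvS (measurable_itv `[X - d, X[) mDX ui.
have L : (t / 16) ^+ 2 * d <= nsq u X.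
  apply: (@le_trans _ _ (\int[mu]_(x in `[X - d, X[) sqmod u x)); last first.
    by apply: Rintegral_subset => // x; exact: sqmod_ge0.
  have -> : (t / 16) ^+ 2 * d = \int[mu]_(x in `[X - d, X[) ((t / 16) ^+ 2).
    have md : mu (`[X - d, X[%classic : set T) = d%:E.
      by rewrite lebesgue_measure_itv /= lte_fin gtrBl d0 -EFinB subKr.
    by rewrite Rintegral_cst //; congr (_ * _); exact: (esym (congr1 fine md)).
  apply: le_Rintegral => //.
    apply: (integrable_itvS _ mDX) => //.
    by apply: bmeas_lint; exact: bmeas_cst.
  move=> x /=; rewrite in_itv /= => /andP[dx xX].
  rewrite /sqmod ler_pXn2r ?nnegrE ?cabs_ge0 //; first exact: ul.
  by rewrite divr_ge0 // ltW.
have M : nsq u X <= 4 * n * t.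
  apply: (le_trans nsq_le); apply: (le_trans m_le).
  rewrite (_ : 4 * n * t = 2 * n * (2 * t)); last by ring.
  apply: ler_wpM2l; first by rewrite mulr_ge0 // ltW.
  by move: beta_le_t t64; move: beta t => p q; lra.
have tk : t <= 2 ^+ 11 * n * kap.
  have := le_trans L M; rewrite /d => H.
  rewrite -(ler_pM2r t0).
  have -> : 2 ^+ 11 * n * kap * t = 2 ^+ 9 * kap * (4 * n * t) by ring.
  have -> : t * t = 2 ^+ 9 * kap * ((t / 16) ^+ 2 / (2 * kap)).
    by field; rewrite gt_eqF.
  by rewrite ler_pM2l ?mulr_gt0 ?exprn_gt0.
apply: (le_trans tk); rewrite expr2 -mulrA.
apply: (@le_trans _ _ (2 ^+ 11 * (n * n))).
  apply: ler_wpM2l; first exact: exprn_ge0.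
  by apply: ler_wpM2l; [exact: ltW|exact: kap_le].
apply: ler_wpM2r; first by rewrite mulr_ge0 // ltW.
by rewrite exprS ler_peMl ?exprn_ge0 // ler1n.
Qed.

(** An atom of chi at 0 does not see a function vanishing there, so [0, eps[ can be traded for an
    interval whose variation tends to 0. *)
Let chiI_open0 (f : R -> R) eps : f 0 = 0 ->
  chiI chi X `[0, eps[%classic f = chiI chi X `]0, eps[%classic f.
Proof.
move=> f0; have P : f \_ `[0, eps[%classic = f \_ `]0, eps[%classic.
  apply/funext => y; rewrite !patchE !mem_setE !in_itv /=.
  have [->|yn0] := eqVneq y 0; first by rewrite f0 !if_same.
  by rewrite [0 < y]lt_neqAle eq_sym yn0.
have H (nu : {measure set T -> \bar R}) :
    \int[nu]_(y in `[0, eps[) f y = \int[nu]_(y in `]0, eps[) f y.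
  by rewrite [LHS]Rintegral_mkcond [RHS]Rintegral_mkcond P.
by rewrite /chiI /sI !H.
Qed.

(** The error is B - int Gf dchi, and Gf 0 = 0 because u 0 = 1. *)
Let Gf y := E y * u y - E y * E y.

Let Gf_le y : 0 <= y -> y <= X ->
  cabs (Gf y) <= 2 * beta + 6 * (V / n) * (e y)^-1 ^+ 2.
Proof.
move=> y0 yX; have ey := e_gt0 y; have ey1 := e_ge1 y0.
have iey : (e y)^-1 <= 1 by rewrite invf_le1.
have H : cabs (u y - E y) <= beta * e y + 6 * (V / n) * Om y.
  rewrite -(ler_pM2l (_ : 0 < 2 * n)) ?mulr_gt0 // -cabs2k -cabsM cabs2k.
  have -> : 2 * k * (u y - E y) = B * (F y - E y) + rem y by rewrite /rem; ring.
  apply: (le_trans (cabsD_le _ _)); rewrite cabsM Bn.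
  have -> : 2 * n * (beta * e y + 6 * (V / n) * Om y) =
    n * beta * (2 * e y) + 12 * V * Om y by field; rewrite gt_eqF.
  apply: lerD; last exact: rem_le.
  apply: ler_wpM2l; first by rewrite mulr_ge0 // ltW.
  apply: (le_trans (cabsB_le _ _)); rewrite cabsF cabsE mulr_natl mulr2n lerD2l.
  exact: le_trans ey1.
rewrite /Gf -mulrBr cabsM cabsE.
apply: (@le_trans _ _ ((e y)^-1 * (beta * e y + 6 * (V / n) * Om y))).
  by apply: ler_wpM2l => //; rewrite invr_ge0 ltW.
have -> : (e y)^-1 * (beta * e y + 6 * (V / n) * Om y) =
    beta + 6 * (V / n) * beta + 6 * (V / n) * (e y)^-1 ^+ 2.
  by rewrite /Om; field; rewrite !gt_eqF.
have -> : 2 * beta = beta + beta by ring.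
rewrite lerD2r lerD2l ler_piMl //.
rewrite mulrA ler_pdivrMr // mul1r; apply: le_trans Vn.
by rewrite ler_wpM2r // ler_nat.
Qed.

(** On ]0, eps[ the variation of chi is to be small, on [eps, X[ the factor (e y)^-2. The first
    summand gathers all multiples of [beta], by [beta_le] and 24 V <= n. *)
Lemma local_estimate eps : 0 < eps -> eps <= X ->
  n * cabs (m + k + csI chi X `[0, X[%classic (fun y => E y * E y)) <=
  2 ^+ 13 * n ^+ 4 / e X
  + 12 * V * (cvar chi X `]0, eps[%classic + V * (e eps)^-1 ^+ 2).
Proof.
move=> eps0 epsX; have cbG : cbmeas X Gf by apply: cbmeasB; exact: cbmeasM.
have -> : m + k + csI chi X `[0, X[%classic (fun y => E y * E y) =
    B - csI chi X `[0, X[%classic Gf.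
  by rewrite mkE /Gf csI_B; [rewrite -/I0; ring|exact: cbmeasM..].
have G0 : Gf 0 = 0 by rewrite /Gf /E cexpl0 u0; ring.
rewrite (csI_split chi (ltW eps0) epsX cbG).
have -> : csI chi X `[0, eps[%classic Gf = csI chi X `]0, eps[%classic Gf.
  by rewrite /csI !chiI_open0 //= G0.
set v := cvar chi X `]0, eps[%classic.
have vV : v <= V.
  apply: cvarS => // y /=; rewrite !in_itv /= => /andP[/ltW -> ye].
  exact: lt_le_trans epsX.
have v0 : 0 <= v by exact: cvar_ge0.
have Vn0 : 0 <= V / n by rewrite divr_ge0 // ltW.
have T1 : cabs (csI chi X `]0, eps[%classic Gf) <= 2 * ((2 * beta + 6 * (V / n)) * v).
  apply: csI_bound => //.
    move=> y /=; rewrite !in_itv /= => /andP[/ltW -> ye].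
    exact: lt_le_trans epsX.
  move=> y /=; rewrite in_itv /= => /andP[y0 ye].
  apply: (le_trans (Gf_le (ltW y0) (ltW (lt_le_trans ye epsX)))).
  have i1 : (e y)^-1 ^+ 2 <= 1.
    rewrite expr_le1 //; last by rewrite invr_ge0 ltW.
    by rewrite invf_le1 // e_ge1 // ltW.
  by rewrite lerD2l; apply: ler_piMr => //; exact: mulr_ge0.
have T2 : cabs (csI chi X `[eps, X[%classic Gf) <=
    2 * ((2 * beta + 6 * (V / n) * (e eps)^-1 ^+ 2) * V).
  apply: (@le_trans _ _ (2 * ((2 * beta + 6 * (V / n) * (e eps)^-1 ^+ 2)
      * cvar chi X `[eps, X[%classic))).
    apply: csI_bound => //.
      by apply: subset_bcoo => //; exact: ltW.
    move=> y /=; rewrite in_itv /= => /andP[ey yX].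
    apply: (le_trans (Gf_le (le_trans (ltW eps0) ey) (ltW yX))).
    rewrite lerD2l; apply: ler_wpM2l; first exact: mulr_ge0.
    by apply: e_inv_le.
  rewrite ler_pM2l //; apply: ler_wpM2l.
    apply: addr_ge0; first exact: mulr_ge0.
    by apply: mulr_ge0; [exact: mulr_ge0|exact: sqr_ge0].
  by apply: cvarS => //; apply: subset_bcoo => //; exact: ltW.
have T3 : cabs (B - (csI chi X `]0, eps[%classic Gf + csI chi X `[eps, X[%classic Gf)) <=
  n * beta + (2 * ((2 * beta + 6 * (V / n)) * v)
    + 2 * ((2 * beta + 6 * (V / n) * (e eps)^-1 ^+ 2) * V)).
  apply: (le_trans (cabsB_le _ _)); rewrite Bn lerD2l.
  by apply: (le_trans (cabsD_le _ _)); exact: lerD.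
apply: (le_trans (ler_wpM2l (ltW n_gt0) T3)).
have bl : beta <= 2 ^+ 12 * n ^+ 2 / e X by rewrite ler_pdivlMr // beta_le.
have -> : n * (n * beta + (2 * ((2 * beta + 6 * (V / n)) * v)
    + 2 * ((2 * beta + 6 * (V / n) * (e eps)^-1 ^+ 2) * V))) =
  (n ^+ 2 + 4 * n * v + 4 * n * V) * beta + 12 * V * (v + V * (e eps)^-1 ^+ 2).
  by field; rewrite !gt_eqF.
rewrite lerD2r.
have -> : 2 ^+ 13 * n ^+ 4 / e X = 2 * n ^+ 2 * (2 ^+ 12 * n ^+ 2 / e X).
  by field; rewrite gt_eqF.
apply: ler_pM => //; first by rewrite !addr_ge0 ?sqr_ge0 // !mulr_ge0 // ltW.
have -> : 2 * n ^+ 2 = n ^+ 2 + n * n by ring.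
rewrite -addrA lerD2l.
have -> : 4 * n * v + 4 * n * V = n * (4 * v + 4 * V) by ring.
apply: ler_wpM2l; first exact: ltW.
exact: four_sum_le Vn vV V_ge0.
Qed.

End LocalEstimate.

(** * Asymptotics in a sector *)

Lemma sum_bounds {R : realFieldType} (v a p q r : R) :
  v <= a -> 0 <= a -> 0 <= p -> 0 <= q -> 0 <= r ->
  let N := 1 + a + p + q + r in
  [/\ 1 <= N, v <= N, p <= N, q <= N & r <= N].
Proof. by move=> ? ? ? ? ? /=; split; lra. Qed.

Section SectorRoot.
Context {R : realType}.
Notation Re := (@complex.Re R).
Notation Im := (@complex.Im R).
Implicit Types (z : R[i]) (K : R).

Definition kroot z := sqrtc (- z).

Lemma kroot_sqr z : z = - kroot z ^+ 2.
Proof. by rewrite /kroot sqr_sqrtc opprK. Qed.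

Lemma cabs_kroot_sqr z : cabs (kroot z) ^+ 2 = cabs z.
Proof. by rewrite expr2 -cabsM -expr2 sqr_sqrtc cabsN. Qed.

Lemma cabs_kroot z : cabs (kroot z) = Num.sqrt (cabs z).
Proof. by rewrite -(cabs_kroot_sqr z) sqrtr_sqr ger0_norm ?cabs_ge0. Qed.

Lemma Re_kroot z : Re (kroot z) = Num.sqrt ((cabs z - Re z) / 2).
Proof.
case: z => x y; rewrite /kroot /sqrtc /cabs /= !sqrrN.
by [].
Qed.

(** For z = x + i y and r = |z| the right-hand side is the square of Re sqrt(-z). If x > 0, it is
    bounded below by means of y^2 = (r - x) (r + x) <= 2 r (r - x) and r <= (1 + K) y. *)
Lemma sector_real (r x y K : R) : 0 <= K -> 0 < y -> x <= K * y -> 0 <= r ->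
  r ^+ 2 = x ^+ 2 + y ^+ 2 -> ((2 * (1 + K))^-1) ^+ 2 * r <= (r - x) / 2.
Proof.
move=> K0 y0 xK r0 rE; have K1 : 0 < 1 + K by rewrite ltr_wpDr.
have rx : x <= r.
  apply: (le_trans (ler_norm x)); rewrite -(ler_pXn2r (n := 2)) ?nnegrE //.
  by rewrite rE real_normK ?num_real // lerDl sqr_ge0.
have [x0|x0] := leP x 0.
  apply: (@le_trans _ _ (r / 2)); last by rewrite ler_pM2r ?invr_gt0 // lerDl oppr_ge0.
  rewrite mulrC; apply: ler_wpM2l => //.
  have -> : (2 * (1 + K))^-1 ^+ 2 = 2^-1 * (2^-1 * (1 + K)^-1 ^+ 2).
    by field; rewrite gt_eqF.
  rewrite ler_piMr ?invr_ge0 // mulr_ile1 ?invr_ge0 ?sqr_ge0 //.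
    by rewrite invf_le1 // ler1n.
  by rewrite expr_le1 ?invr_ge0 ?(ltW K1) // invf_le1 // lerDl.
have r_gt0 : 0 < r by exact: lt_le_trans rx.
have rK : r <= (1 + K) * y.
  have Ky : 0 <= (1 + K) * y by rewrite mulr_ge0 // ltW.
  rewrite -(ler_pXn2r (n := 2)) ?nnegrE // rE.
  have x2 : x ^+ 2 <= (K * y) ^+ 2.
    by rewrite ler_pXn2r ?nnegrE ?(ltW x0) // (le_trans (ltW x0)).
  apply: (@le_trans _ _ ((K * y) ^+ 2 + y ^+ 2)); first by rewrite lerD2r.
  rewrite -subr_ge0; have -> : ((1 + K) * y) ^+ 2 - ((K * y) ^+ 2 + y ^+ 2) = 2 * K * y ^+ 2 by ring.
  by apply: mulr_ge0; [exact: mulr_ge0|exact: sqr_ge0].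
have yE : y ^+ 2 = (r - x) * (r + x) by rewrite -subr_sqr rE; ring.
rewrite -(ler_pM2r r_gt0).
apply: (@le_trans _ _ (y ^+ 2 / 4)).
  have r2 : r ^+ 2 <= ((1 + K) * y) ^+ 2.
    by rewrite ler_pXn2r ?nnegrE // mulr_ge0 // ltW.
  have -> : (2 * (1 + K))^-1 ^+ 2 * r * r = r ^+ 2 / (4 * (1 + K) ^+ 2).
    by field; rewrite gt_eqF.
  rewrite ler_pdivrMr ?mulr_gt0 ?exprn_gt0 //; apply: (le_trans r2).
  by rewrite le_eqVlt; apply/orP; left; apply/eqP; field.
rewrite yE -subr_ge0.
have -> : (r - x) / 2 * r - (r - x) * (r + x) / 4 = (r - x) ^+ 2 / 4 by field.
by rewrite divr_ge0 ?sqr_ge0.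
Qed.

(** The absolute value allows negative K: in the upper half plane the sector for K lies in the one
    for |K|. *)
Definition sector_const K : R := (2 * (1 + `|K|))^-1.

Lemma sector_const_gt0 K : 0 < sector_const K.
Proof. by rewrite invr_gt0 mulr_gt0 // ltr_wpDr. Qed.

Lemma sector_kroot K z : 0 < Im z -> Re z <= K * Im z ->
  sector_const K * cabs (kroot z) <= Re (kroot z).
Proof.
move=> y0 xK; have c0 := ltW (sector_const_gt0 K).
have H : sector_const K ^+ 2 * cabs z <= (cabs z - Re z) / 2.
  apply: (@sector_real _ _ (Im z)) => //; [|exact: cabs_ge0|exact: cabs_sqr].
  by apply: (le_trans xK); rewrite ler_pM2r // ler_norm.
have cz := cabs_ge0 z.
rewrite Re_kroot -(ler_pXn2r (n := 2)) ?nnegrE ?sqrtr_ge0 //; last first.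
  by rewrite mulr_ge0 // cabs_ge0.
rewrite exprMn cabs_kroot_sqr sqr_sqrtr //; apply: le_trans H.
by rewrite mulr_ge0 // sqr_ge0.
Qed.

(** The fifth power absorbs the factor |k|^4 of [local_estimate] with one power to spare. *)
Lemma expR_ge_pow5 (t : R) : 0 <= t -> (t / 5) ^+ 5 <= expR t.
Proof.
move=> t0; have -> : expR t = expR (t / 5) ^+ 5.
  by rewrite -expRM_natl; congr expR; field.
have t5 : 0 <= t / 5 by rewrite divr_ge0.
rewrite lerXn2r ?nnegrE ?expR_ge0 //.
by apply: le_trans (expR_ge1Dx _); rewrite lerDr.
Qed.

(** A threshold that sees chi only through a bound V on its variation, and does not see [b];
    uniformity of the final estimate rests on this. *)
Lemma sector_large (X V K d eps : R) : 0 < X -> 0 < d -> 0 < eps -> exists Y : R,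
  forall z, Y < Im z -> Re z <= K * Im z ->
  [/\ 1 <= Im z, 1 <= cabs (kroot z), 24 * V <= cabs (kroot z) & 0 < Re (kroot z)] /\
  [/\ 1 <= Re (kroot z) * X, 16 <= expR (Re (kroot z) * X),
      2 ^+ 13 * cabs (kroot z) ^+ 4 / expR (Re (kroot z) * X) <= d &
      (expR (Re (kroot z) * eps))^-1 ^+ 2 <= d].
Proof.
move=> X0 d0 e0; pose c := sector_const K; have c0 : 0 < c := sector_const_gt0 K.
(* [N1] yields Re k X >= 15, hence an exponential of at least 1 + 15; [N2] and [N3] serve the last
   two estimates. *)
pose N1 := 15 / (c * X); pose N2 := 2 ^+ 13 * (5 / (c * X)) ^+ 5 / d.
pose N3 := (1 + d^-1) / (c * eps).
pose N := 1 + `|24 * V| + N1 + N2 + N3.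
have N10 : 0 <= N1 by rewrite divr_ge0 // mulr_ge0 ?ltW.
have N20 : 0 <= N2.
  by rewrite divr_ge0 ?(ltW d0) // mulr_ge0 ?exprn_ge0 // divr_ge0 // mulr_ge0 ?ltW.
have N30 : 0 <= N3.
  by rewrite divr_ge0 ?mulr_ge0 ?ltW // addr_gt0 // invr_gt0.
have NE : [/\ 1 <= N, 24 * V <= N, N1 <= N, N2 <= N & N3 <= N].
  exact: sum_bounds (ler_norm _) (normr_ge0 _) N10 N20 N30.
(* Since |k|^2 = |z| >= Im z, this threshold forces |k| >= N. *)
exists (N ^+ 2) => z Yz xK.
have [N_ge1 NV NN1 NN2 NN3] := NE.
have N0 : 0 <= N := le_trans ler01 N_ge1.
have z1 : 1 <= Im z by apply: le_trans (ltW Yz); rewrite expr_ge1.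
have z0 : 0 < Im z := lt_le_trans ltr01 z1.
have Nn : N <= cabs (kroot z).
  rewrite -(ler_pXn2r (n := 2)) ?nnegrE ?cabs_ge0 // cabs_kroot_sqr.
  apply: (le_trans (ltW Yz)); apply: le_trans (Im_le_cabs z); exact: ler_norm.
have kn : c * cabs (kroot z) <= Re (kroot z) := sector_kroot z0 xK.
set n := cabs (kroot z) in Nn kn *; set kap := Re (kroot z) in kn *.
have n0 : 0 < n by apply: lt_le_trans Nn; exact: lt_le_trans N_ge1.
have kap0 : 0 < kap by apply: lt_le_trans kn; rewrite mulr_gt0.
have kX : 15 <= kap * X.
  apply: (@le_trans _ _ (c * n * X)); last by rewrite ler_pM2r.
  have : N1 <= n := le_trans NN1 Nn.
  rewrite /N1 ler_pdivrMr ?mulr_gt0 // => /le_trans; apply.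
  by rewrite le_eqVlt; apply/orP; left; apply/eqP; ring.
split; split => //.
- exact: le_trans Nn.
- exact: le_trans Nn.
- by apply: le_trans kX; rewrite ler1n.
- by apply: le_trans (expR_ge1Dx _); move: kX; move: (kap * X) => q; lra.
- have e5 : (c * n * X / 5) ^+ 5 <= expR (kap * X).
    have le1 : c * n * X <= kap * X by rewrite ler_pM2r.
    have ge1 : 0 <= c * n * X by rewrite !mulr_ge0 // ltW.
    by apply: (le_trans (expR_ge_pow5 ge1)); rewrite ler_expR.
  rewrite ler_pdivrMr ?expR_gt0 //.
  apply: (@le_trans _ _ (d * (c * n * X / 5) ^+ 5)); last by rewrite ler_pM2l.
  have : N2 <= n := le_trans NN2 Nn.
  rewrite /N2 ler_pdivrMr // => H2.
  have -> : d * (c * n * X / 5) ^+ 5 = n * d * ((c * X / 5) ^+ 5 * n ^+ 4) by field.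
  have -> : 2 ^+ 13 * n ^+ 4 =
      2 ^+ 13 * (5 / (c * X)) ^+ 5 * ((c * X / 5) ^+ 5 * n ^+ 4).
    by field; rewrite !gt_eqF.
  apply: ler_wpM2r => //.
  by rewrite mulr_ge0 ?exprn_ge0 ?divr_ge0 ?mulr_ge0 ?ltW.
- have ee : 1 + d^-1 <= expR (kap * eps).
    apply: le_trans (expR_ge1Dx _); apply: (@le_trans _ _ (c * n * eps)).
      have : N3 <= n := le_trans NN3 Nn.
      rewrite /N3 ler_pdivrMr ?mulr_gt0 // => /le_trans; apply.
      by rewrite le_eqVlt; apply/orP; left; apply/eqP; ring.
    by rewrite ler_wpDl // ler_pM2r.
  have eg := expR_gt0 (kap * eps).
  have i1 : (expR (kap * eps))^-1 <= 1.
    by rewrite invf_le1 //; apply: le_trans ee; rewrite lerDl invr_ge0 ltW.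
  have i2 : (expR (kap * eps))^-1 <= d.
    rewrite -[d]invrK lef_pV2 ?posrE ?invr_gt0 //.
    by apply: le_trans ee; rewrite lerDr.
  by rewrite expr2; apply: (le_trans _ i2); rewrite ler_piMr // invr_ge0 ltW.
Qed.

End SectorRoot.

(** The three summands are at most e / 48, e / 4 and e / 4. *)
Lemma three_term_lt {R : realFieldType} (V e p v q : R) : 0 <= V -> 0 < e ->
  p <= e / (48 * (1 + V) ^+ 2) -> v <= e / (48 * (1 + V)) ->
  q <= e / (48 * (1 + V) ^+ 2) -> p + 12 * V * (v + V * q) < e.
Proof.
move=> V0 e0 pd vd qd; have V1 : 0 < 1 + V by rewrite ltr_wpDr.
have i1 : (1 + V)^-1 <= 1 by rewrite invf_le1 // lerDl.
have i0 : 0 <= (1 + V)^-1 by rewrite invr_ge0 ltW.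
have ii : (1 + V)^-1 ^+ 2 <= 1 by rewrite expr_le1.
have r1 : V / (1 + V) <= 1 by rewrite ler_pdivrMr // mul1r lerDr.
have r0 : 0 <= V / (1 + V) by rewrite mulr_ge0.
have r2 : (V / (1 + V)) ^+ 2 <= 1 by rewrite expr_le1.
have P1 : p <= e / 48.
  apply: (le_trans pd).
  have -> : e / (48 * (1 + V) ^+ 2) = e / 48 * (1 + V)^-1 ^+ 2 by field; rewrite gt_eqF.
  by rewrite ler_piMr // divr_ge0 // ltW.
have P2 : 12 * V * v <= e / 4.
  apply: (@le_trans _ _ (12 * V * (e / (48 * (1 + V))))).
    by apply: ler_wpM2l => //; rewrite mulr_ge0.
  have -> : 12 * V * (e / (48 * (1 + V))) = e / 4 * (V / (1 + V)) by field; rewrite gt_eqF.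
  by rewrite ler_piMr // divr_ge0 // ltW.
have P3 : 12 * V * (V * q) <= e / 4.
  apply: (@le_trans _ _ (12 * V * (V * (e / (48 * (1 + V) ^+ 2))))).
    by apply: ler_wpM2l; [rewrite mulr_ge0|exact: ler_wpM2l].
  have -> : 12 * V * (V * (e / (48 * (1 + V) ^+ 2))) = e / 4 * (V / (1 + V)) ^+ 2.
    by field; rewrite gt_eqF.
  by rewrite ler_piMr // divr_ge0 // ltW.
rewrite mulrDr; move: P1 P2 P3 e0; move: (12 * V * v) (12 * V * (V * q)) => s t.
lra.
Qed.

(** * The asymptotic expansion and its uniform error bound *)

Section WeylAsymptotics.
Context {R : realType}.
Notation T := (measurableTypeR R).
Notation Re := (@complex.Re R).
Notation Im := (@complex.Im R).

(** Leaving out 0 makes the intersection of the intervals empty, so continuity from above gives the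
    limit 0 even when [nu] charges 0. *)
Lemma open_itv_vanishing (nu : {finite_measure set T -> \bar R}) (eta : R) :
  0 < eta -> \forall n \near \oo, fine (nu (`]0, (n.+1%:R)^-1[%classic : set T)) < eta.
Proof.
move=> eta0; pose F n : set T := `]0, (n.+1%:R)^-1[%classic.
have F0 : \bigcap_n F n = set0.
  apply/seteqP; split=> // x Fx.
  have := Fx 0%N I; rewrite /F /= in_itv /= => /andP[x0 _].
  have xi : 0 < x^-1 by rewrite invr_gt0.
  have xb : x^-1 < (Num.bound x^-1).+1%:R.
    by apply: (lt_le_trans (archi_boundP (ltW xi))); rewrite ler_nat.
  have := Fx (Num.bound x^-1) I; rewrite /F /= in_itv /= => /andP[_].
  rewrite -[ltLHS]invrK ltf_pV2 ?posrE ?ltr0n // => /(lt_trans xb).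
  by rewrite ltxx.
have cv := @nonincreasing_cvg_mu _ T R nu F.
have {}cv : nu \o F @ \oo --> nu (\bigcap_n F n).
  apply: cv.
  - exact: (@fin_itv _ nu (F 0%N) (measurable_itv _)).
  - by move=> n; exact: measurable_itv.
  - by rewrite F0; exact: measurable0.
  - move=> m n mn; apply/subsetPset => x; rewrite /F /= !in_itv /= => /andP[-> xn].
    by apply: (lt_le_trans xn); rewrite lef_pV2 ?posrE ?ltr0n // ler_nat ltnS.
rewrite F0 measure0 in cv.
have /fine_cvgP[_ /cvgrPdist_lt/(_ _ eta0)] := cv.
apply: filterS => n; rewrite sub0r normrN /= ger0_norm ?fine_ge0 //.
Qed.

Variables (b : \bar R) (chi : signed_measure b).

Lemma cvar_vanishing X (eta : R) : 0 < X -> 0 < eta ->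
  exists eps, [/\ 0 < eps, eps <= X & cvar chi X `]0, eps[%classic < eta].
Proof.
move=> X0 eta0; have eta2 : 0 < eta / 2 by rewrite divr_gt0.
have [n _ H] : \forall n \near \oo, [/\ (n.+1%:R)^-1 <= X,
    fine (jordan_pos (sm_hahn chi X) (`]0, (n.+1%:R)^-1[%classic : set T)) < eta / 2 &
    fine (jordan_neg (sm_hahn chi X) (`]0, (n.+1%:R)^-1[%classic : set T)) < eta / 2].
  have H1 := open_itv_vanishing (jordan_pos (sm_hahn chi X)) eta2.
  have H2 := open_itv_vanishing (jordan_neg (sm_hahn chi X)) eta2.
  have H3 := near_infty_natSinv_lt (PosNum X0).
  apply: filterS3 H1 H2 H3 => n h1 h2 h3; split => //; exact: ltW.
have [h1 h2 h3] := H n (leqnn n).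
exists (n.+1%:R)^-1; split => //.
by rewrite /cvar (splitr eta) ltrD.
Qed.

Lemma sm_variation_cvar X : sm_variation chi X = cvar chi X `[0, X[%classic.
Proof. exact: sm_variationE. Qed.

Lemma weyl_error_le w dw (m : R[i] -> R[i]) X z eps :
  (0 < b)%E -> (limit_circle chi -> boundary_function chi w dw) ->
  weyl_function chi w dw m -> 0 < X -> (X%:E < b)%E ->
  [/\ 1 <= Im z, 1 <= cabs (kroot z), 24 * sm_variation chi X <= cabs (kroot z)
    & 0 < Re (kroot z)] ->
  1 <= Re (kroot z) * X -> 16 <= expR (Re (kroot z) * X) ->
  0 < eps -> eps <= X ->
  cabs (weyl_error chi m X z) * Num.sqrt (cabs z) <=
  2 ^+ 13 * cabs (kroot z) ^+ 4 / expR (Re (kroot z) * X) +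
  12 * sm_variation chi X * (cvar chi X `]0, eps[%classic +
     sm_variation chi X * (expR (Re (kroot z) * eps))^-1 ^+ 2).
Proof.
move=> b0 Hw Hm X0 Xb [z1 n1 nV k0] kX eX e0 eX'.
have z0 : 0 < Im z := lt_le_trans ltr01 z1.
have [u [du [su u0 du0 fl]]] := weyl_flux b0 Hw Hm z0.
have := local_estimate X0 Xb (kroot_sqr z) su u0 du0 k0.
rewrite -sm_variation_cvar => /(_ nV z1 n1 kX eX (fl X X0 Xb) eps e0 eX').
rewrite mulrC -cabs_kroot; apply: le_trans.
rewrite le_eqVlt; apply/orP; left; apply/eqP; congr (cabs _ * _).
rewrite /weyl_error (sm_cintegralE chi _ (ltW X0) (lexx X) Xb) -/(kroot z).
rewrite (csI_eq _ _ _ (g := fun y => cexpl (- kroot z) y * cexpl (- kroot z) y)).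
  by ring.
by move=> y; rewrite -cexplD /cexpl; congr cexp; ring.
Qed.

End WeylAsymptotics.

Theorem theorem3p3 (R : realType) :
  (forall (b : \bar R) (chi : signed_measure b) (w dw : R -> R[i])
      (m : R[i] -> R[i]),
    (0 < b)%E ->
    (limit_circle chi -> boundary_function chi w dw) ->
    weyl_function chi w dw m ->
    forall x0 : R, 0 < x0 -> (x0%:E < b)%E ->
    forall K : R,
      (fun z => cabs (weyl_error chi m x0 z) * Num.sqrt (cabs z)) @ im_infty K
        --> (0 : R))
  /\
  (exists C : R -> R, forall x0 V K : R, 0 < x0 ->
    exists Y : R,
      forall (b : \bar R) (chi : signed_measure b) (w dw : R -> R[i])
        (m : R[i] -> R[i]),
      (0 < b)%E ->
      (limit_circle chi -> boundary_function chi w dw) ->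
      weyl_function chi w dw m ->
      (x0%:E < b)%E -> sm_variation chi x0 = V ->
      forall z : R[i], Y < complex.Im z -> complex.Re z <= K * complex.Im z ->
        cabs (weyl_error chi m x0 z) <= C V / Num.sqrt (cabs z)).
Proof.
split.
  move=> b chi w dw m b0 Hw Hm x0 x00 x0b K A /nbhs_ballP[e e0 hA].
  pose V := sm_variation chi x0.
  have V0 : 0 <= V by rewrite /V sm_variation_cvar cvar_ge0.
  have V1 : 0 < 1 + V by rewrite ltr_wpDr.
  (* The smallness required by [three_term_lt]; 1 + V replaces V, which may be 0. *)
  pose eta := e / (48 * (1 + V)); pose d := e / (48 * (1 + V) ^+ 2).
  have eta0 : 0 < eta by rewrite divr_gt0 // mulr_gt0.
  have d0 : 0 < d by rewrite divr_gt0 // mulr_gt0 // exprn_gt0.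
  have [eps [eps0 epsx ve]] := cvar_vanishing chi x00 eta0.
  have [Y HY] := sector_large V K x00 d0 eps0.
  exists Y => z Yz xK; have [H [kX eX T1 T2]] := HY z Yz xK.
  apply: hA; rewrite /ball /= sub0r normrN ger0_norm; last first.
    by rewrite mulr_ge0 ?cabs_ge0 ?sqrtr_ge0.
  apply: (le_lt_trans (weyl_error_le b0 Hw Hm x00 x0b H kX eX eps0 epsx)).
  rewrite -/V.
  exact: (three_term_lt V0 e0 T1 (ltW ve) T2).
(* With eps = x0 and d = 1 the estimate becomes 1 + 12 V (V + V): smallness of the variation near 0,
   which depends on chi itself, does not enter. *)
exists (fun V => 24 * V ^+ 2 + 1) => x0 V K x00.
have [Y HY] := sector_large V K x00 ltr01 x00.
exists Y => b chi w dw m b0 Hw Hm x0b VE z Yz xK.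
have [H [kX eX T1 T2]] := HY z Yz xK.
rewrite -VE in H; have [_ n1 _ _] := H.
have sz : 0 < Num.sqrt (cabs z) by rewrite -cabs_kroot (lt_le_trans ltr01 n1).
rewrite ler_pdivlMr //.
apply: (le_trans (weyl_error_le b0 Hw Hm x00 x0b H kX eX x00 (lexx x0))).
have V0 : 0 <= V by rewrite -VE sm_variation_cvar cvar_ge0.
have vV : cvar chi x0 `]0, x0[%classic <= V.
  rewrite -VE sm_variation_cvar; apply: cvarS => // y /=.
  by rewrite !in_itv /= => /andP[/ltW -> ->].
rewrite VE addrC; apply: lerD => //.
have -> : 24 * V ^+ 2 = 12 * V * (V + V * 1) by ring.
apply: ler_wpM2l; first by rewrite mulr_ge0.
by apply: lerD => //; exact: ler_wpM2l.
Qed.
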